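(* Let $\Omega\subset\mathbb R^2$ be one of the following polygonal domains: (i) a rectangle; (ii) an isosceles right triangle; (iii) an equilateral triangle; (iv) a hemi-equilateral ($30^\circ$–$60^\circ$–$90^\circ$) triangle. Let $V\subset\Omega$ be measurable with positive Lebesgue measure, $|V|>0$. Then there exists a constant $c_{\Omega,V}>0$ such that every Dirichlet Laplacian eigenfunction $u\in E_\lambda(\Omega)$ satisfies $$\|u\|_{L^2(V)}\ge c_{\Omega,V}\|u\|_{L^2(\Omega)}.$$ The constant $c_{\Omega,V}$ is independent of the eigenvalue $\lambda$, its multiplicity, and the particular choice of $u\in E_\lambda(\Omega)$. Consequently, $C_2(V;\Omega)>0$.
   Context: $-\Delta_\Omega$ is the nonnegative self-adjoint Dirichlet Laplacian on $L^2(\Omega)$ (complex-valued functions), associated with the closed form $\int_\Omega\nabla u\cdot\nabla\overline v\,dx$ with form domain $H_0^1(\Omega)$. For $\lambda\in\sigma(-\Delta_\Omega)$, $E_\lambda(\Omega):=\ker(-\Delta_\Omega-\lambda I)$. Set $$C_2(V;\Omega):=\inf_{\lambda\in\sigma(-\Delta_\Omega)}\ \inf_{u\in E_\lambda(\Omega)\setminus\{0\}}\frac{\|u\|_{L^2(V)}}{\|u\|_{L^2(\Omega)}}.$$ *)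

(* Defs.v *)
From HB Require Import structures.
From mathcomp Require Import all_boot all_order all_algebra.
From mathcomp Require Import all_classical all_reals all_analysis.
From mathcomp Require Import measurable_realfun complex.

Set Implicit Arguments.
Unset Strict Implicit.
Unset Printing Implicit Defensive.
Import Order.TTheory GRing.Theory Num.Theory.
Import numFieldNormedType.Exports.

Local Open Scope classical_set_scope.
Local Open Scope ring_scope.
Local Open Scope complex_scope.

Notation plane R := (R^o * R^o)%type.
Local Notation Re := complex.Re.
Local Notation Im := complex.Im.

Section Lebesgue_plane.
Context {R : realType}.

Definition leb2 : {measure set (measurableTypeR R * measurableTypeR R) -> \bar R} :=
  (@lebesgue_measure R \x @lebesgue_measure R)%E.

(* Lebesgue (not only Borel) measurable sets: a Borel set together with a
   subset of a Borel null set. *)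
Definition lebesgue_measurable2 (V : set (plane R)) : Prop :=
  completed_algebra_gen leb2 V.

(* The Lebesgue measure of such a set, by outer extension of [leb2]. *)
Definition area (V : set (plane R)) : \bar R := (leb2^*)%mu V.

Definition Cintegral (D : set (plane R)) (f : plane R -> R[i]) : R[i] :=
  (\int[leb2]_(x in D) Re (f x)) +i* (\int[leb2]_(x in D) Im (f x)).

(* [leb2] lives on the Borel sigma-algebra, but the integral of a nonnegative
   function is the supremum over the measurable simple functions below it, so
   this is also the L^2 norm over a set that is only Lebesgue measurable; see
   [L2norm_setU_negligible] below. *)
Definition L2norm (D : set (plane R)) (u : plane R -> R[i]) : R :=
  Num.sqrt (\int[leb2]_(x in D) (Normc.normc (u x) ^+ 2)).

(* Elements of L^2(D) are represented by functions on the plane whose values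
   outside D are irrelevant; every class has a Borel representative. *)
Definition L2 (D : set (plane R)) : set (plane R -> R[i]) :=
  [set u | [/\ measurable_fun D
                 (fun x => Re (u x) : R),
               measurable_fun D
                 (fun x => Im (u x) : R) &
               leb2.-integrable D (fun x => (Normc.normc (u x) ^+ 2)%:E)]].

Definition L2inner (D : set (plane R)) (u v : plane R -> R[i]) : R[i] :=
  Cintegral D (fun x => u x * (v x)^*).

Definition L2zero (D : set (plane R)) (u : plane R -> R[i]) : Prop :=
  {ae leb2, forall x, D x -> u x = 0}.

Import HBNNSimple.

Lemma L2norm_setU_negligible (A N : set (plane R)) u :
  leb2.-negligible N -> L2norm (A `|` N) u = L2norm A u.
Proof.
move=> [M [mM M0 NM]]; rewrite /L2norm /Rintegral; congr (Num.sqrt (fine _)).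
have f0 x : (0 <= (Normc.normc (u x) ^+ 2)%:E)%E by rewrite lee_fin sqr_ge0.
rewrite !ge0_integralE; [|by move=> x _; exact: f0..].
apply/eqP; rewrite eq_le; apply/andP; split; last first.
  apply: ge_ereal_sup => _ [h hA <-]; apply: ereal_sup_ubound; exists h => // x.
  apply: le_trans (hA x) _; rewrite /patch.
  case: ifPn => [xA|_]; first by rewrite ifT// inE; left; exact: set_mem.
  by case: ifP.
apply: ge_ereal_sup => _ [h hAN <-]; apply: ereal_sup_ubound.
have mCM : measurable (~` M) by exact: measurableC.
exists (proj_nnsfun h mCM).
  move=> x; rewrite -mrestrict /patch; have := hAN x; rewrite /patch.
  case: (boolP (x \in ~` M)) => [|_ _]; last by case: ifP.
  rewrite inE => Mx; case: (boolP (x \in A)) => xA.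
    by rewrite ifT// inE; left; exact: set_mem.
  by rewrite ifF//; apply/negP; rewrite inE => -[/mem_set|/NM//]; exact/negP.
rewrite -mrestrict -integral_nnsfun// -setTD.
have mh : measurable_fun [set: measurableTypeR R * measurableTypeR R]
    (EFin \o h) by apply/measurable_EFinP.
rewrite -ge0_negligible_integral// => [|x _]; last by rewrite lee_fin.
by rewrite integral_nnsfun// patch_setT.
Qed.

End Lebesgue_plane.

Section Sobolev.
Context {R : realType}.
Implicit Types (Om : set (plane R)) (u v f phi : plane R -> R[i]).

Definition e1 : plane R := (1, 0).
Definition e2 : plane R := (0, 1).

Definition smooth (h : plane R -> R) : Prop :=
  forall (s : seq bool) (x : plane R),
    differentiable
      (foldr (fun b k => fun y => 'D_(if b then e1 else e2) k y) h s) x.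

Definition partial (e : plane R) phi : plane R -> R[i] :=
  fun x => 'D_e (fun y => Re (phi y)) x +i* 'D_e (fun y => Im (phi y)) x.

(* C_c^oo(Om; C) *)
Definition test_function Om phi : Prop :=
  [/\ smooth (fun x => Re (phi x)), smooth (fun x => Im (phi x)),
      compact (closure [set x | phi x != 0]) &
      closure [set x | phi x != 0] `<=` Om].

Definition weak_partial Om (e : plane R) u g : Prop :=
  forall phi, test_function Om phi ->
    Cintegral Om (fun x => u x * partial e phi x) =
    - Cintegral Om (fun x => g x * phi x).

Definition weak_grad Om u (g : (plane R -> R[i]) * (plane R -> R[i])) : Prop :=
  [/\ L2 Om g.1, L2 Om g.2, weak_partial Om e1 u g.1 & weak_partial Om e2 u g.2].

Definition H1 Om : set (plane R -> R[i]) :=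
  [set u | L2 Om u /\ exists g, weak_grad Om u g].

(* H^1_0(Om): the closure of C_c^oo(Om) in H^1(Om). *)
Definition H10 Om : set (plane R -> R[i]) :=
  [set u | H1 Om u /\
    forall g, weak_grad Om u g -> forall eps : R, 0 < eps ->
      exists2 phi, test_function Om phi &
        Num.sqrt (L2norm Om (fun x => u x - phi x) ^+ 2
                + L2norm Om (fun x => g.1 x - partial e1 phi x) ^+ 2
                + L2norm Om (fun x => g.2 x - partial e2 phi x) ^+ 2) < eps].

(* The graph of the operator associated with the Dirichlet form: u is in the
   domain and its image is f.  Weak gradients are unique almost everywhere on
   Om, so the choice of gu and gv does not matter. *)
Definition dirichlet_laplacian Om u f : Prop :=
  [/\ H10 Om u, L2 Om f &
      forall gu, weak_grad Om u gu ->
      forall v gv, H10 Om v -> weak_grad Om v gv ->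
        L2inner Om gu.1 gv.1 + L2inner Om gu.2 gv.2 = L2inner Om f v].

(* (- Delta_Om - lambda) u = f *)
Definition shifted_laplacian Om (lambda : R[i]) u f : Prop :=
  dirichlet_laplacian Om u (fun x => lambda * u x + f x).

(* - Delta_Om - lambda is onto L^2(Om) and has a bounded inverse; the estimate
   includes injectivity. *)
Definition resolvent_set Om : set R[i] :=
  [set lambda |
    (forall f, L2 Om f -> exists u, shifted_laplacian Om lambda u f) /\
    (exists M : R, forall u f, L2 Om f -> shifted_laplacian Om lambda u f ->
      L2norm Om u <= M * L2norm Om f)].

Definition spectrum Om : set R[i] := ~` resolvent_set Om.

Definition dirichlet_eigenspace Om (lambda : R[i]) : set (plane R -> R[i]) :=
  [set u | shifted_laplacian Om lambda u (fun=> 0)].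

Definition C2 (V Om : set (plane R)) : \bar R :=
  ereal_inf [set ereal_inf [set (L2norm V u / L2norm Om u)%:E
                             | u in dirichlet_eigenspace Om lambda `\` L2zero Om]
              | lambda in spectrum Om].

End Sobolev.

Section Polygons.
Context {R : realType}.
Implicit Types (A B C p q : plane R) (Om : set (plane R)).

Definition dot p q : R := p.1 * q.1 + p.2 * q.2.

(* The norm of the library on a product is the maximum of the coordinates. *)
Definition euclid p : R := Num.sqrt (dot p p).

(* The unoriented angle at A between the rays AB and AC. *)
Definition angle A B C : R :=
  acos (dot (B - A) (C - A) / (euclid (B - A) * euclid (C - A))).

Definition rectangle Om : Prop :=
  exists A p q, [/\ p != 0, q != 0, dot p q = 0 &
    Om = [set x | exists s t : R, [/\ 0 < s < 1, 0 < t < 1 &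
                    x = A + s *: p + t *: q]]].

Definition triangle A B C Om : Prop :=
  (B - A).1 * (C - A).2 - (B - A).2 * (C - A).1 != 0 /\
  Om = [set x | exists a b c : R, [/\ 0 < a, 0 < b, 0 < c, a + b + c = 1 &
                  x = a *: A + b *: B + c *: C]].

Definition isosceles_right_triangle Om : Prop :=
  exists A B C, [/\ triangle A B C Om, angle A B C = pi / 2 &
    euclid (B - A) = euclid (C - A)].

Definition equilateral_triangle Om : Prop :=
  exists A B C, [/\ triangle A B C Om, euclid (B - A) = euclid (C - B) &
    euclid (C - B) = euclid (A - C)].

Definition hemi_equilateral_triangle Om : Prop :=
  exists A B C, [/\ triangle A B C Om, angle A B C = pi / 2,
    angle B C A = pi / 3 & angle C A B = pi / 6].

End Polygons.

(* Submission.v *)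
(* In suitable affine coordinates (s, t) each polygon is an alcove of an affine
   reflection group W * Z^2, with W a finite group of integer matrices.  The
   alternating sums over W of cos and sin of 2 pi (k . (s, t)) vanish on the walls, so
   they are Dirichlet eigenfunctions, and they are complete in L^2 of the alcove.
   Hence every eigenfunction coincides almost everywhere on the polygon with a
   trigonometric polynomial on the torus whose frequencies k lie on one circle.

   For such polynomials the integral of |u|^2 over a set V of positive measure
   dominates a fixed multiple of the sum of the squared coefficients.  Expand it in
   the Fourier coefficients tau(k - l) of the indicator of V.  These are square
   summable, and a nonzero difference k - l is attained at most twice on a circle, so
   the pairs with k - l outside a finite set F contribute little.  On a large circle
   every k has at most one l with k - l in F, and the corresponding 2 x 2 blocks are
   uniformly definite because |tau(m)| < |V| for m != 0.  On small circles only
   finitely many frequencies occur, and linear independence on V is enough. *)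

Require Import Defs.
From HB Require Import structures.
From mathcomp Require Import all_boot all_order all_algebra.
From mathcomp Require Import all_classical all_reals all_analysis.
From mathcomp Require Import measurable_realfun complex.
From mathcomp Require Import ring lra zify.

Set Implicit Arguments.
Unset Strict Implicit.
Unset Printing Implicit Defensive.
Import Order.TTheory GRing.Theory Num.Theory.
Import numFieldNormedType.Exports.

Local Open Scope classical_set_scope.
Local Open Scope ring_scope.

(** * Translations and bounded Borel functions *)

(** No spectral theorem is invoked. Green's identity makes an eigenfunction orthogonal to every
    alternating mode of another energy; after subtracting its projection onto the finitely many
    modes of its own energy, completeness annihilates the remainder. Completeness itself uses no
    density theorem: the bounded functions by which a test family may be multiplied while all its
    pairings stay zero are closed under products and bounded pointwise limits, hence contain the
    indicators of Borel sets of the torus. The same result for the trivial group gives uniqueness of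
    weak gradients. Linear independence on V is made quantitative by a finite difference along a
    translation h for which V and V - h overlap: it removes one frequency and leads to an induction
    on their number. The strict inequality |tau(m)| < |V| is the case of two frequencies. Modes lie
    in H^1_0 because a Lipschitz function that is odd in a wall is bounded by a multiple of the
    distance to it, which outweighs the gradient of cutoffs built from exp(-1/t). *)

Notation PT R := (measurableTypeR R * measurableTypeR R)%type.

Section Translation.
Context {R : realType}.
Implicit Types (h : R * R) (A V : set (PT R)).

(** The pushforward under the translation agrees with Lebesgue measure on half-open intervals, which
    determine it. *)
Lemma lebesgue_measure_translate (h : R) (A : set (measurableTypeR R)) :
  measurable A ->
  lebesgue_measure [set x : measurableTypeR R | A (x + h)] = lebesgue_measure A.
Proof.
move=> mA.
pose f : measurableTypeR R -> measurableTypeR R := fun x => x + h.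
have mf : measurable_fun setT f by apply: measurable_funD.
pose nu : {measure set (measurableTypeR R) -> \bar R} :=
  measure_function_pushforward__canonical__measure_function_Measure
    (@lebesgue_measure R) mf.
rewrite -[LHS]/(nu A); apply/esym/lebesgue_measure_unique => //.
move=> X [[a b] _ <-] /=.
rewrite /nu /= /pushforward /=.
have -> : f @^-1` (`]a, b]%classic) = `](a-h), (b-h)]%classic :> set R.
  by apply/seteqP; split => x /=; rewrite /f /= !in_itv /= ltrBlDr lerBrDr.
rewrite !lebesgue_measure_itv /= !lte_fin ltrD2r; case: ifP => // _.
by rewrite -!EFinD; congr EFin; ring.
Qed.

Definition shift2 h (x : PT R) : PT R := (x.1 + h.1, x.2 + h.2).

Lemma measurable_shift2 h : measurable_fun setT (shift2 h).
Proof.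
by apply/measurable_fun_pairP; split; rewrite /comp /=; apply: measurable_funD.
Qed.

Lemma measurable_preshift2 h A : measurable A -> measurable (shift2 h @^-1` A).
Proof.
by move=> mA; rewrite -[X in measurable X]setTI; exact: measurable_shift2.
Qed.

Let shifted h := measure_function_pushforward__canonical__measure_function_Measure
  (@leb2 R) (measurable_shift2 h).

Lemma leb2_translate h A : measurable A -> leb2 (shift2 h @^-1` A) = leb2 A.
Proof.
move=> mA; rewrite -[LHS]/(shifted h A); apply/esym/product_measure_unique => //.
move=> X Y mX mY; rewrite /= /pushforward /=.
have -> : shift2 h @^-1` (X `*` Y) =
    [set x | X (x + h.1)] `*` [set x | Y (x + h.2)].
  by apply/seteqP; split => x.
have mpre (c : R) (Z : set (measurableTypeR R)) : measurable Z ->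
    measurable [set x : measurableTypeR R | Z (x + c)].
  have mf : measurable_fun setT (fun x : measurableTypeR R => x + c).
    exact: measurable_funD.
  by move=> mZ; rewrite -[X in measurable X]setTI; exact: mf.
rewrite product_measure1E; [|exact: mpre..].
by congr (_ * _)%E; exact: lebesgue_measure_translate.
Qed.

Lemma integral_shift_ge0 h V (g : PT R -> \bar R) : measurable V ->
  measurable_fun V g -> (forall x, V x -> (0 <= g x)%E) ->
  (\int[leb2]_(x in shift2 h @^-1` V) g (shift2 h x) = \int[leb2]_(x in V) g x)%E.
Proof.
move=> mV mg g0.
have g0' : {in V, forall x, (0 <= g x)%E} by move=> x; rewrite inE => /g0.
have <- := ge0_integral_pushforward (measurable_shift2 h) leb2 mV mg g0'.
apply: (eq_measure_integral leb2 (m1 := shifted h)) => A mA _.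
exact: leb2_translate.
Qed.

Lemma integrable_shift h V (g : PT R -> \bar R) : measurable V ->
  measurable_fun setT g -> leb2.-integrable V g ->
  leb2.-integrable (shift2 h @^-1` V) (g \o shift2 h).
Proof.
move=> mV mg /integrableP[_ gV]; apply/integrableP; split.
  by apply: measurable_funTS; apply: measurableT_comp => //; exact: measurable_shift2.
rewrite (integral_shift_ge0 h (g := fun x => `|g x|%E))//.
by apply: measurableT_comp => //; exact: measurable_funTS.
Qed.

Lemma Rintegral_shift h V (g : PT R -> R) : measurable V ->
  measurable_fun setT g -> leb2.-integrable V (EFin \o g) ->
  \int[leb2]_(x in shift2 h @^-1` V) g (shift2 h x) = \int[leb2]_(x in V) g x.
Proof.
move=> mV mg ig; rewrite /Rintegral; congr fine.
have mg' : measurable_fun setT (EFin \o g) by exact/measurable_EFinP.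
have := integrable_shift h mV mg' ig => igs.
have <- := integral_pushforward (measurable_shift2 h) mg' igs mV.
apply: (eq_measure_integral leb2 (m1 := shifted h)) => A mA _.
exact: leb2_translate.
Qed.

End Translation.

Section BoundedMeasurable.
Context {R : realType}.
Implicit Types (f g : PT R -> R) (V : set (PT R)).

(** Measurability and the bound hold on the whole plane rather than almost everywhere on a domain,
    so translates and compositions stay in the class; each member is integrable over every
    measurable set of finite measure. *)
Definition bmf f := measurable_fun setT f /\ exists M, forall x, `|f x| <= M.

Lemma bmf_meas f : bmf f -> measurable_fun setT f. Proof. by case. Qed.

Lemma bmf_cst c : bmf (fun _ => c).
Proof. by split; [exact: measurable_cst|exists `|c|]. Qed.

Lemma bmfD f g : bmf f -> bmf g -> bmf (fun x => f x + g x).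
Proof.
move=> [mf [M fM]] [mg [N gN]]; split; first exact: measurable_funD.
by exists (M + N) => x; apply: le_trans (ler_normD _ _) _; exact: lerD.
Qed.

Lemma bmfM f g : bmf f -> bmf g -> bmf (fun x => f x * g x).
Proof.
move=> [mf [M fM]] [mg [N gN]]; split; first exact: measurable_funM.
by exists (M * N) => x; rewrite normrM; apply: ler_pM.
Qed.

Lemma bmfZ c f : bmf f -> bmf (fun x => c * f x).
Proof. by apply: bmfM; exact: bmf_cst. Qed.

Lemma bmfN f : bmf f -> bmf (fun x => - f x).
Proof.
by move=> /(bmfZ (-1)); congr bmf; apply/funext => x; rewrite mulN1r.
Qed.

Lemma bmfB f g : bmf f -> bmf g -> bmf (fun x => f x - g x).
Proof. by move=> bf /bmfN; exact: bmfD. Qed.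

Lemma bmfX f n : bmf f -> bmf (fun x => f x ^+ n).
Proof.
move=> bf; elim: n => [|n ih]; first exact: bmf_cst.
by under eq_fun do rewrite exprS; exact: bmfM.
Qed.

Lemma bmf_sum I (s : seq I) (F : I -> PT R -> R) : (forall i, bmf (F i)) ->
  bmf (fun x => \sum_(i <- s) F i x).
Proof.
move=> bF; elim: s => [|i s ih].
  by under eq_fun do rewrite big_nil; exact: bmf_cst.
by under eq_fun do rewrite big_cons; exact: bmfD.
Qed.

Lemma bmf_indic V : measurable V -> bmf (\1_V).
Proof.
move=> mV; split; first exact: measurable_indic.
by exists 1 => x; rewrite indicE; case: (_ \in _); rewrite ?normr1 ?normr0.
Qed.

Lemma bmf_shift h f : bmf f -> bmf (fun x => f (shift2 h x)).
Proof.
move=> [mf [M fM]]; split; last by exists M.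
by apply: (measurableT_comp mf); exact: measurable_shift2.
Qed.

Lemma bmf_comp (F : R -> R) f M : measurable_fun setT F ->
  (forall t, `|F t| <= M) -> measurable_fun setT f -> bmf (fun x => F (f x)).
Proof.
by move=> mF FM mf; split; [exact: (measurableT_comp mF)|exists M].
Qed.

Lemma bmf_integrable V f : measurable V -> (leb2 V < +oo)%E -> bmf f ->
  leb2.-integrable V (EFin \o f).
Proof.
move=> mV Voo [mf [M fM]]; apply: measurable_bounded_integrable => //.
  exact: measurable_funTS.
exists M; split; first exact: num_real.
by move=> N MN x _; apply: le_trans (fM x) _; exact: ltW.
Qed.

Lemma integrable_bmfM V f g : measurable V -> leb2.-integrable V (EFin \o f) ->
  bmf g -> leb2.-integrable V (EFin \o (fun x => f x * g x)).
Proof.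
move=> mV If [mg [M gM]].
apply: (@integrableMl _ _ _ _ _ mV (EFin \o f) g) => //.
  exact: measurable_funTS.
exists M; split; first exact: num_real.
by move=> N MN x _; apply: le_trans (gM x) _; exact: ltW.
Qed.

Lemma Rintegral_sum V I (s : seq I) (F : I -> PT R -> R) : measurable V ->
  (forall i, leb2.-integrable V (EFin \o F i)) ->
  \int[leb2]_(x in V) (\sum_(i <- s) F i x) =
  \sum_(i <- s) \int[leb2]_(x in V) F i x.
Proof.
move=> mV iF.
have iS t : leb2.-integrable V (EFin \o (fun x => \sum_(i <- t) F i x)).
  have := integrable_sum (mu := leb2) mV t (P := xpredT) (h := fun i => EFin \o F i)
    (fun i _ => iF i).
  congr (_.-integrable _ _); apply/funext => x /=.
  by rewrite sumEFin.
elim: s => [|i s ih].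
  under eq_Rintegral do rewrite big_nil.
  by rewrite Rintegral_cst ?mul0r// big_nil.
rewrite big_cons -ih -RintegralD//.
by apply: eq_Rintegral => x _; rewrite big_cons.
Qed.

(* Every open set is the union of the boxes with rational corners that it contains. *)
Lemma open_plane_measurable (U : set (plane R)) : open U ->
  measurable (U : set (PT R)).
Proof.
move=> oU.
pose box (k : nat * (int * int)) : set (PT R) :=
  [set x | k.2.1%:~R <= x.1 * k.1.+1%:R < k.2.1%:~R + 1] `&`
  [set x | k.2.2%:~R <= x.2 * k.1.+1%:R < k.2.2%:~R + 1].
have mbox k : measurable (box k).
  have mh (f : PT R -> R) (a b c : R) : measurable_fun setT f ->
      measurable [set x | a <= f x * c < b].
    move=> mf; have mfc : measurable_fun setT (fun x => f x * c).
      by apply: measurable_funM.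
    rewrite (_ : mkset _ = setT `&` (fun x => f x * c) @^-1` `[a, b[%classic).
      by apply: mfc.
    by apply/seteqP; split => x /=; rewrite in_itv /=; [split|case].
  apply: measurableI; exact: mh.
have -> : U = \bigcup_(k in setT) (if `[< box k `<=` U >] then box k else set0).
  apply/seteqP; split => [x Ux|x [k _]]; last first.
    by case: asboolP => // kU /kU.
  have [e/= e0 xeU] : nbhs_ball (x : plane R) U.
    by rewrite nbhs_ballE; exact: open_nbhs_nbhs.
  pose n := Num.truncn (e^-1).
  have ne : n.+1%:R^-1 < e.
    by rewrite invf_plt ?posrE ?ltr0n// truncnS_gt.
  have n0 : 0 < n.+1%:R :> R by rewrite ltr0n.
  pose k := (n, (Num.floor (x.1 * n.+1%:R), Num.floor (x.2 * n.+1%:R))).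
  exists k => //.
  have bk : box k x.
    by split => /=; have := floor_itv (x.1 * n.+1%:R);
      have := floor_itv (x.2 * n.+1%:R); rewrite !intrD.
  rewrite asboolT// => y [yk1 yk2]; apply: xeU; case: bk => xk1 xk2.
  have close (a b : R) (j : int) : j%:~R <= a * n.+1%:R < j%:~R + 1 ->
      j%:~R <= b * n.+1%:R < j%:~R + 1 -> `|a - b| < e.
    move=> /andP[a1 a2] /andP[b1 b2]; apply: lt_trans ne.
    rewrite -(ltr_pM2r n0) mulVf ?gt_eqF// -[X in _ * X]ger0_norm ?ltW// -normrM.
    by rewrite mulrBl ltr_distl; lra.
  by split; rewrite /ball /=; [exact: close xk1 yk1|exact: close xk2 yk2].
apply: countable_bigcupT_measurable => // k.
by case: ifP => // _; exact: mbox.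
Qed.

Lemma continuous_plane_measurable (f : plane R -> R) : continuous f ->
  measurable_fun setT (f : PT R -> R).
Proof.
move=> cf; apply: (measurability _ (RGenOpens.measurableE R)).
move=> _ [_ [a [b ->] <-]]; rewrite setTI; apply: open_plane_measurable.
apply: open_comp; last exact: interval_open.
by move=> x _; exact: cf.
Qed.

End BoundedMeasurable.

(** * Trigonometric polynomials on a planar torus *)

Section Frame.
Context {R : realType}.
Variables (p q o : R * R).
Implicit Types (x : PT R) (k l m : int * int) (V : set (PT R)) (a b : int * int -> R).

(** [(fs, ft)] is an affine chart whose unit cell represents the torus: [p] and [q] are the rows of
    its linear part and [o] is the image of the origin. *)
Definition fs x : R := p.1 * x.1 + p.2 * x.2 + o.1.
Definition ft x : R := q.1 * x.1 + q.2 * x.2 + o.2.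
Definition fdet : R := p.1 * q.2 - p.2 * q.1.
Hypothesis fdet0 : fdet != 0.

Lemma measurable_fs : measurable_fun setT fs.
Proof. by apply: measurable_funD => //; apply: measurable_funD; apply: measurable_funM. Qed.

Lemma measurable_ft : measurable_fun setT ft.
Proof. by apply: measurable_funD => //; apply: measurable_funD; apply: measurable_funM. Qed.

(** Cramer's rule: the plane vector along which the chart moves by [(c, d)]. *)
Definition fvec (c d : R) : R * R :=
  ((c * q.2 - d * p.2) / fdet, (d * p.1 - c * q.1) / fdet).

Lemma fs_shift c d x : fs (shift2 (fvec c d) x) = fs x + c.
Proof. by rewrite /fs /fvec /=; move: fdet0; rewrite /fdet => ?; field. Qed.

Lemma ft_shift c d x : ft (shift2 (fvec c d) x) = ft x + d.
Proof. by rewrite /ft /fvec /=; move: fdet0; rewrite /fdet => ?; field. Qed.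

Lemma frameE x : x = (((fs x - o.1) * q.2 - (ft x - o.2) * p.2) / fdet,
                      ((ft x - o.2) * p.1 - (fs x - o.1) * q.1) / fdet).
Proof.
case: x => u v; move: fdet0; rewrite /fs /ft /fdet /= => ?.
by congr pair; field.
Qed.

Definition angk k (c d : R) : R := 2 * pi * (k.1%:~R * c + k.2%:~R * d).
Definition phase k x := angk k (fs x) (ft x).
Definition ck k x : R := cos (phase k x).
Definition sk k x : R := sin (phase k x).

Lemma phaseB k l x : phase (k - l) x = phase k x - phase l x.
Proof. by rewrite /phase /angk /= !intrB; ring. Qed.

Lemma phase0 x : phase 0 x = 0.
Proof. by rewrite /phase /angk /=; ring. Qed.

Lemma phase_shift k c d x : phase k (shift2 (fvec c d) x) = phase k x + angk k c d.
Proof. by rewrite /phase /angk fs_shift ft_shift; ring. Qed.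

Lemma measurable_phase k : measurable_fun setT (phase k).
Proof.
have ms := measurable_fs; have mt := measurable_ft.
by apply: measurable_funM => //; apply: measurable_funD; apply: measurable_funM.
Qed.

Lemma bmf_ck k : bmf (ck k).
Proof.
apply: (bmf_comp (M := 1)); last exact: measurable_phase.
  by apply: continuous_measurable_fun; exact: continuous_cos.
by move=> t; exact: cos_max.
Qed.

Lemma bmf_sk k : bmf (sk k).
Proof.
apply: (bmf_comp (M := 1)); last exact: measurable_phase.
  by apply: continuous_measurable_fun; exact: continuous_sin.
by move=> t; exact: sin_max.
Qed.

Definition cell (u v : R) : set (PT R) := [set x | 0 <= fs x < u /\ 0 <= ft x < v].
Definition Pcell := cell 1 1.

Lemma measurable_strip (f : PT R -> R) (c d : R) : measurable_fun setT f ->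
  measurable [set x | c <= f x < d].
Proof.
move=> mf; rewrite (_ : mkset _ = setT `&` f @^-1` `[c, d[%classic).
  by apply: mf.
by apply/seteqP; split => x /=; rewrite in_itv /=; [split|case].
Qed.

Lemma leb2_box (c d : R) : (leb2 [set x : PT R | (c <= x.1 < d)%R /\ (c <= x.2 < d)%R] < +oo)%E.
Proof.
have -> : [set x : PT R | c <= x.1 < d /\ c <= x.2 < d] =
    (`[c, d[%classic : set R) `*` (`[c, d[%classic : set R).
  by apply/seteqP; split => x /=; rewrite !in_itv.
rewrite [X in (X < _)%E](_ : _ = (lebesgue_measure (`[c, d[%classic : set R) *
  lebesgue_measure (`[c, d[%classic : set R))%E); last exact: product_measure1E.
rewrite lebesgue_measure_itv /=.
by case: ifP => _; rewrite ?mule0// -EFinD -EFinM ltry.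
Qed.

Lemma leb2_bounded (c : R) V : measurable V ->
  (forall x, V x -> `|fs x| <= c /\ `|ft x| <= c) -> (leb2 V < +oo)%E.
Proof.
move=> mV Vc.
(* Inverting the chart by Cramer's rule bounds the plane coordinates; the final [+ 1] makes the
   bound strict, as the half-open box requires. *)
pose M : R := (2 * (c + `|o.1| + `|o.2|) * (`|p.1| + `|p.2| + `|q.1| + `|q.2|)) / `|fdet| + 1.
apply: le_lt_trans (leb2_box (- M) M).
apply: le_measure; rewrite ?inE//.
  rewrite (_ : mkset _ = [set x : PT R | - M <= x.1 < M] `&` [set x : PT R | - M <= x.2 < M])//.
  by apply: measurableI; exact: measurable_strip.
have fd0 : 0 < `|fdet| by rewrite normr_gt0.
have key (u v r1 r2 : R) : `|u| <= c + `|o.1| + `|o.2| ->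
    `|v| <= c + `|o.1| + `|o.2| ->
    `|r1| + `|r2| <= `|p.1| + `|p.2| + `|q.1| + `|q.2| ->
    - M <= (u * r1 - v * r2) / fdet < M.
  move=> uc vc rr; have : `|(u * r1 - v * r2) / fdet| < M.
    rewrite normrM normfV /M -ltrBlDr.
    apply: (@lt_le_trans _ _ (`|u * r1 - v * r2| / `|fdet|)).
      by rewrite ltrBlDr ltrDl.
    rewrite ler_pM2r ?invr_gt0//.
    apply: le_trans (ler_normB _ _) _; rewrite !normrM.
    have c0 : 0 <= c + `|o.1| + `|o.2| by apply: le_trans uc.
    have := normr_ge0 r1; have := normr_ge0 r2.
    have : `|u| * `|r1| <= (c + `|o.1| + `|o.2|) * `|r1| by apply: ler_wpM2r.
    have : `|v| * `|r2| <= (c + `|o.1| + `|o.2|) * `|r2| by apply: ler_wpM2r.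
    have : (c + `|o.1| + `|o.2|) * (`|r1| + `|r2|) <=
      (c + `|o.1| + `|o.2|) * (`|p.1| + `|p.2| + `|q.1| + `|q.2|) by apply: ler_wpM2l.
    have : 0 <= (c + `|o.1| + `|o.2|) * (`|p.1| + `|p.2| + `|q.1| + `|q.2|).
      by apply: mulr_ge0 => //; rewrite !addr_ge0.
    by nra.
  by rewrite ltr_norml => /andP[/ltW -> ->].
move=> x /Vc[sc tc]; rewrite (frameE x) /=.
have b1 : `|fs x - o.1| <= c + `|o.1| + `|o.2|.
  by have := ler_normB (fs x) o.1; have := normr_ge0 o.2; lra.
have b2 : `|ft x - o.2| <= c + `|o.1| + `|o.2|.
  by have := ler_normB (ft x) o.2; have := normr_ge0 o.1; lra.
have := (normr_ge0 p.1, normr_ge0 p.2, normr_ge0 q.1, normr_ge0 q.2).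
by move=> [[[? ?] ?] ?]; split; apply: key => //; lra.
Qed.

Lemma measurable_cell u v : measurable (cell u v).
Proof.
apply: measurableI; apply: measurable_strip; [exact: measurable_fs|exact: measurable_ft].
Qed.

Lemma leb2_cell u v : (leb2 (cell u v) < +oo)%E.
Proof.
apply: (@leb2_bounded (`|u| + `|v|)); first exact: measurable_cell.
move=> x [/andP[s0 su] /andP[t0 tv]]; rewrite (ger0_norm s0) (ger0_norm t0).
have := (normr_ge0 u, normr_ge0 v, ler_norm u, ler_norm v).
by move=> [[[? ?] ?] ?]; split; lra.
Qed.

End Frame.

Section Strips.
Context {R : realType}.

(** The region splits into an even number of slices of width [d]. Translation by [h] carries each
    slice to the next and reverses the sign of [g], so consecutive slices cancel. *)
Lemma Rintegral_antiperiodic (f1 f2 g : PT R -> R) (h : R * R) (d v : R) (n : nat) :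
  measurable_fun setT f1 -> measurable_fun setT f2 -> bmf g -> 0 < d ->
  (forall u, (leb2 [set x | (0 <= f1 x < u)%R /\ (0 <= f2 x < v)%R] < +oo)%E) ->
  (forall x, f1 (shift2 h x) = f1 x + d) -> (forall x, f2 (shift2 h x) = f2 x) ->
  (forall x, g (shift2 h x) = - g x) ->
  \int[leb2]_(x in [set x | 0 <= f1 x < (n.*2)%:R * d /\ 0 <= f2 x < v]) g x = 0.
Proof.
move=> mf1 mf2 bg d0 foo f1h f2h gh.
pose A (n : nat) : set (PT R) := [set x | 0 <= f1 x < n%:R * d /\ 0 <= f2 x < v].
pose B (n : nat) : set (PT R) :=
  [set x | n%:R * d <= f1 x < n.+1%:R * d /\ 0 <= f2 x < v].
have mA k : measurable (A k) by apply: measurableI; exact: measurable_strip.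
have mB k : measurable (B k) by apply: measurableI; exact: measurable_strip.
have AS k : A k.+1 = A k `|` B k.
  apply/seteqP; split => x; rewrite /A /B /= -(natr1 k).
    move=> [/andP[x0 xk] xv]; have [xl|xl] := ltP (f1 x) (k%:R * d).
      by left; split => //; apply/andP.
    by right; split => //; apply/andP.
  have kd : 0 <= k%:R * d by rewrite mulr_ge0// ltW.
  by move=> [|] [/andP[x1 x2] xv]; split => //; apply/andP; split; lra.
have iA k : leb2.-integrable (A k) (EFin \o g).
  by apply: bmf_integrable => //; exact: foo.
have iB k : leb2.-integrable (B k) (EFin \o g).
  by apply: (integrableS (mA k.+1)) => //; rewrite AS; exact: subsetUr.
have IS k : \int[leb2]_(x in A k.+1) g x =
    \int[leb2]_(x in A k) g x + \int[leb2]_(x in B k) g x.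
  rewrite AS Rintegral_setU//; first by rewrite -AS.
  apply/disj_setPS => x [[/andP[_ x1] _] [/andP[x2 _] _]].
  by move: (lt_le_trans x1 x2); rewrite ltxx.
have preB k : shift2 h @^-1` B k.+1 = B k.
  apply/seteqP; split => x; rewrite /B /= f1h f2h.
    rewrite -!(natr1 k.+1) -!(natr1 k) => -[/andP[? ?] ->].
    by split => //; apply/andP; split; lra.
  rewrite -!(natr1 k.+1) -!(natr1 k) => -[/andP[? ?] ->].
  by split => //; apply/andP; split; lra.
have IB k : \int[leb2]_(x in B k) g x = - \int[leb2]_(x in B k.+1) g x.
  have <- := Rintegral_shift h (mB k.+1) (bmf_meas bg) (iB k.+1).
  rewrite preB -[RHS]mulN1r -RintegralZl//.
    by apply: eq_Rintegral => x _; rewrite gh mulN1r opprK.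
  rewrite -preB; apply: (integrable_shift h (mB k.+1) _ (iB k.+1)).
  by apply/measurable_EFinP; exact: bmf_meas.
rewrite -/(A _); elim: n => [|n ih].
  rewrite (_ : A 0%N = set0) ?Rintegral_set0//.
  by apply/seteqP; split => x //; rewrite /A /= mul0r => -[/andP[]]; lra.
by rewrite doubleS 2!IS ih add0r IB addNr.
Qed.

End Strips.

(** * Fourier coefficients and orthogonality on the unit cell *)

Section Torus.
Context {R : realType}.
Variables (p q o : R * R).
Hypothesis fdet0 : fdet p q != 0.
Implicit Types (x : PT R) (k l m : int * int) (V : set (PT R)).
Implicit Types (a b : int * int -> R) (K : seq (int * int)).

Local Notation c := (ck p q o).
Local Notation s := (sk p q o).
Local Notation P := (Pcell p q o).
Local Notation fs := (fs p o).
Local Notation ft := (ft q o).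

(** The pair [(a k, b k)] encodes the complex coefficient z_k = a k + i b k. With e_k = exp(2 pi i
    k.(s, t)), [reU] and [imU] are the real and imaginary parts of the sum of the z_k e_k, and [en]
    is its squared modulus. *)
Definition reU K a b x : R := \sum_(k <- K) (a k * c k x - b k * s k x).
Definition imU K a b x : R := \sum_(k <- K) (a k * s k x + b k * c k x).
Definition en K a b x : R := reU K a b x ^+ 2 + imU K a b x ^+ 2.
Definition nrm K a b : R := \sum_(k <- K) (a k ^+ 2 + b k ^+ 2).
Definition cV V k : R := \int[leb2]_(x in V) c k x.
Definition sV V k : R := \int[leb2]_(x in V) s k x.

Lemma nrm_ge0 K a b : 0 <= nrm K a b.
Proof. by apply: sumr_ge0 => k _; rewrite addr_ge0// sqr_ge0. Qed.

Lemma en_ge0 K a b x : 0 <= en K a b x.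
Proof. by rewrite addr_ge0// sqr_ge0. Qed.

Lemma bmf_reU K a b : bmf (reU K a b).
Proof.
by apply: bmf_sum => k; apply: bmfB; apply: bmfZ; [exact: bmf_ck|exact: bmf_sk].
Qed.

Lemma bmf_imU K a b : bmf (imU K a b).
Proof.
by apply: bmf_sum => k; apply: bmfD; apply: bmfZ; [exact: bmf_sk|exact: bmf_ck].
Qed.

Lemma bmf_en K a b : bmf (en K a b).
Proof. by apply: bmfD; apply: bmfX; [exact: bmf_reU|exact: bmf_imU]. Qed.

(** The real part of z_k conj(z_l) tau(k - l), where tau = [cV] + i [sV]. The imaginary parts cancel
    between (k, l) and (l, k). *)
Definition cross V a b k l : R :=
  (a k * a l + b k * b l) * cV V (k - l) - (b k * a l - a k * b l) * sV V (k - l).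

Lemma en_quad K a b x : en K a b x = \sum_(k <- K) \sum_(l <- K)
  ((a k * a l + b k * b l) * c (k - l) x - (b k * a l - a k * b l) * s (k - l) x).
Proof.
rewrite /en /reU /imU !expr2 !mulr_suml -big_split; apply: eq_bigr => k _ /=.
rewrite !mulr_sumr -big_split; apply: eq_bigr => l _ /=.
by rewrite /ck /sk !phaseB cosB sinB; ring.
Qed.

Section FiniteMeasure.
Variable V : set (PT R).
Hypotheses (mV : measurable V) (Voo : (leb2 V < +oo)%E).

Lemma Rintegral_en K a b : \int[leb2]_(x in V) en K a b x =
  \sum_(k <- K) \sum_(l <- K) cross V a b k l.
Proof.
under eq_Rintegral do rewrite en_quad.
have bt k l : bmf (fun x => (a k * a l + b k * b l) * c (k - l) x -
    (b k * a l - a k * b l) * s (k - l) x).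
  by apply: bmfB; apply: bmfZ; [exact: bmf_ck|exact: bmf_sk].
rewrite Rintegral_sum//; last first.
  by move=> k; apply: bmf_integrable => //; apply: bmf_sum.
apply: eq_bigr => k _; rewrite Rintegral_sum//; last first.
  by move=> l; apply: bmf_integrable.
apply: eq_bigr => l _; rewrite /cross /cV /sV.
have ic := bmf_integrable mV Voo (bmf_ck p q o (k - l)).
have is_ := bmf_integrable mV Voo (bmf_sk p q o (k - l)).
rewrite RintegralB//; [|exact: bmf_integrable (bmfZ _ (bmf_ck _ _ _ _))|
  exact: bmf_integrable (bmfZ _ (bmf_sk _ _ _ _))].
by rewrite !RintegralZl.
Qed.

Lemma cV0 : cV V 0 = fine (leb2 V).
Proof.
rewrite /cV; under eq_Rintegral do rewrite /ck phase0 cos0.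
by rewrite Rintegral_cst// mul1r.
Qed.

Lemma sV0 : sV V 0 = 0.
Proof.
rewrite /sV; under eq_Rintegral do rewrite /sk phase0 sin0.
by rewrite Rintegral_cst// mul0r.
Qed.

Lemma cVN k : cV V (- k) = cV V k.
Proof.
apply: eq_Rintegral => x _; rewrite /ck -(sub0r k) phaseB phase0 sub0r.
exact: cosN.
Qed.

Lemma sVN k : sV V (- k) = - sV V k.
Proof.
rewrite /sV -[RHS]mulN1r -RintegralZl//; last first.
  exact: bmf_integrable (bmf_sk _ _ _ _).
apply: eq_Rintegral => x _; rewrite /sk -(sub0r k) phaseB phase0 sub0r mulN1r.
exact: sinN.
Qed.

Lemma int_en_ge0 K a b : 0 <= \int[leb2]_(x in V) en K a b x.
Proof. by apply: Rintegral_ge0 => x _; exact: en_ge0. Qed.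

End FiniteMeasure.

Lemma measurable_P : measurable P. Proof. exact: measurable_cell. Qed.

Lemma leb2_P : (leb2 P < +oo)%E. Proof. exact: leb2_cell. Qed.

Lemma trig_antiperiodic (F : R -> R) y z : (F = @cos R \/ F = @sin R) ->
  cos z = -1 -> sin z = 0 -> F (y + z) = - F y.
Proof. by move=> [] -> cz sz; rewrite ?cosD ?sinD cz sz; ring. Qed.

(** Moving a coordinate with k_i nonzero by 1 / (2 |k_i|) turns the phase by pi or - pi, which
    changes the sign of both trigonometric functions; the cell consists of 2 |k_i| strips of that
    width. *)
Lemma orthogonal_cell k : k != 0 -> cV P k = 0 /\ sV P k = 0.
Proof.
move=> k0.
have key (F : R -> R) : (F = @cos R \/ F = @sin R) -> bmf (fun x => F (phase p q o k x)) ->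
    \int[leb2]_(x in P) F (phase p q o k x) = 0.
  move=> FE bF.
  have halfturn (i : int) : i != 0 ->
      let z := 2 * pi * (i%:~R * (2 * `|i|%N%:R)^-1) in cos z = -1 :> R /\ sin z = 0 :> R.
    move=> i0 /=; have ai : `|i|%N%:R != 0 :> R by rewrite pnatr_eq0 absz_eq0.
    have [i1|i1] : i%:~R = `|i|%N%:R :> R \/ i%:~R = - `|i|%N%:R :> R.
      rewrite natr_absz intr_norm.
      have [i0'|i0'] := leP 0 (i%:~R : R); first by left; rewrite ger0_norm.
      by right; rewrite ltr0_norm ?opprK.
    - rewrite (_ : 2 * pi * _ = pi) ?cospi ?sinpi//.
      by rewrite i1; field.
    - rewrite (_ : 2 * pi * _ = - pi) ?cosN ?sinN ?cospi ?sinpi ?oppr0//.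
      by rewrite i1; field.
  have [k1|k1] := eqVneq k.1 0; last first.
    have [cz sz] := halfturn _ k1.
    have n0 : `|k.1|%N%:R != 0 :> R by rewrite pnatr_eq0 absz_eq0.
    have d0 : 0 < (2 * `|k.1|%N%:R)^-1 :> R.
      by rewrite invr_gt0 mulr_gt0// lt0r n0 /=.
    have := @Rintegral_antiperiodic _ fs ft _ (fvec p q (2 * `|k.1|%N%:R)^-1 0) _ 1 `|k.1|%N
      (measurable_fs p o) (measurable_ft q o) bF d0.
    have -> : (`|k.1|%N.*2)%:R * (2 * `|k.1|%N%:R)^-1 = 1 :> R.
      by rewrite -muln2 natrM; field.
    apply.
    - by move=> u; exact: leb2_cell.
    - by move=> x; rewrite fs_shift.
    - by move=> x; rewrite ft_shift// addr0.
    - by move=> x; rewrite phase_shift// /angk mulr0 addr0; exact: trig_antiperiodic.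
  have k2 : k.2 != 0.
    by apply: contra_neq k0 => k2; rewrite (surjective_pairing k) k1 k2.
  have [cz sz] := halfturn _ k2.
  have n0 : `|k.2|%N%:R != 0 :> R by rewrite pnatr_eq0 absz_eq0.
  have d0 : 0 < (2 * `|k.2|%N%:R)^-1 :> R.
    by rewrite invr_gt0 mulr_gt0// lt0r n0 /=.
  have := @Rintegral_antiperiodic _ ft fs _ (fvec p q 0 (2 * `|k.2|%N%:R)^-1) _ 1 `|k.2|%N
    (measurable_ft q o) (measurable_fs p o) bF d0.
  have -> : (`|k.2|%N.*2)%:R * (2 * `|k.2|%N%:R)^-1 = 1 :> R.
    by rewrite -muln2 natrM; field.
  have swap u : [set x | 0 <= ft x < u /\ 0 <= fs x < 1] = cell p q o 1 u.
    by apply/seteqP; split => x /= [].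
  rewrite swap; apply.
  - by move=> u; rewrite swap; exact: leb2_cell.
  - by move=> x; rewrite ft_shift.
  - by move=> x; rewrite fs_shift// addr0.
  - by move=> x; rewrite phase_shift// /angk mulr0 add0r; exact: trig_antiperiodic.
by split; apply: key; [left|exact: bmf_ck|right|exact: bmf_sk].
Qed.

Lemma parseval_cell K a b : uniq K ->
  \int[leb2]_(x in P) en K a b x = fine (leb2 P) * nrm K a b.
Proof.
move=> uK; rewrite (Rintegral_en measurable_P leb2_P) /nrm big_distrr.
apply: eq_big_seq => k kK /=.
rewrite (bigD1_seq k)//= big1 ?addr0.
  by rewrite /cross subrr (cV0 measurable_P) (sV0 measurable_P); ring.
move=> l lk; have [|c0 s0] := @orthogonal_cell (k - l).
  by rewrite subr_eq0 eq_sym.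
by rewrite /cross c0 s0 !mulr0 subr0.
Qed.

End Torus.

(** * Finite counting, tails of sums and chords of circles *)

Section Seqs.
Context {R : realType}.

Lemma seq_nat_bound (T : eqType) (f : T -> nat) (r : seq T) :
  exists N, forall x, x \in r -> (f x <= N)%N.
Proof.
elim: r => [|y r [N rN]]; first by exists 0%N.
exists (maxn (f y) N) => x; rewrite inE => /orP[/eqP ->|/rN xN].
  exact: leq_maxl.
by rewrite leq_max xN orbT.
Qed.

Lemma seq_real_bound (T : eqType) (f : T -> R) (r : seq T) :
  exists N, forall x, x \in r -> f x <= N.
Proof.
elim: r => [|y r [N rN]]; first by exists 0.
exists (Num.max (f y) N) => x; rewrite inE => /orP[/eqP ->|/rN xN].
  by rewrite le_max lexx.
by rewrite le_max xN orbT.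
Qed.

Lemma seq_pos_bound (T : eqType) (f : T -> R) (r : seq T) :
  (forall x, x \in r -> 0 < f x) -> exists2 g, 0 < g & forall x, x \in r -> g <= f x.
Proof.
elim: r => [|y r ih] fr; first by exists 1.
have [|g g0 gr] := ih; first by move=> x xr; apply: fr; rewrite inE xr orbT.
exists (Num.min (f y) g); first by rewrite lt_min g0 fr// mem_head.
by move=> x; rewrite inE ge_min => /orP[/eqP ->|/gr ->]; rewrite ?lexx ?orbT.
Qed.

Lemma count_le1 (T : eqType) (a : pred T) (r : seq T) : uniq r ->
  (forall x y, x \in r -> y \in r -> a x -> a y -> x = y) -> (count a r <= 1)%N.
Proof.
move=> ur h; rewrite -size_filter leqNgt; apply/negP.
have : uniq (seq.filter a r) by rewrite filter_uniq.
have : {subset seq.filter a r <= r} by move=> x; rewrite mem_filter => /andP[].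
have : all a (seq.filter a r) by rewrite filter_all.
case: (seq.filter a r) => [|x [|y t]] //= /andP[ax /andP[ay _]] sub.
rewrite inE negb_or => /andP[/andP[xy _] _] _.
case/eqP: xy; apply: h => //; apply: sub; rewrite ?mem_head//.
by rewrite !inE eqxx orbT.
Qed.

Lemma count_le2 (T : eqType) (a : pred T) (r : seq T) : uniq r ->
  (forall x y z, x \in r -> y \in r -> z \in r -> a x -> a y -> a z ->
     x = y \/ x = z \/ y = z) -> (count a r <= 2)%N.
Proof.
move=> ur h; rewrite -size_filter leqNgt; apply/negP.
have : uniq (seq.filter a r) by rewrite filter_uniq.
have : {subset seq.filter a r <= r} by move=> x; rewrite mem_filter => /andP[].
have : all a (seq.filter a r) by rewrite filter_all.
case: (seq.filter a r) => [|x [|y [|z t]]] //= /andP[ax /andP[ay /andP[az _]]] sub.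
rewrite !inE !negb_or => /andP[/andP[xy /andP[xz _]] /andP[/andP[yz _] _]] _.
have xr : x \in r by apply: sub; rewrite !inE eqxx.
have yr : y \in r by apply: sub; rewrite !inE eqxx orbT.
have zr : z \in r by apply: sub; rewrite !inE eqxx !orbT.
by case: (h x y z xr yr zr ax ay az) => [|[|]]; apply/eqP.
Qed.

(** [F0] is a finite set whose sum comes within [eta] of the supremum; a set disjoint from it can
    add no more than what is missing. *)
Lemma summable_tail (I : eqType) (T : I -> R) (B eta : R) : (forall i, 0 <= T i) ->
  (forall F, uniq F -> \sum_(i <- F) T i <= B) -> 0 < eta ->
  exists F0 : seq I, forall F, uniq F -> (forall i, i \in F -> i \notin F0) ->
    \sum_(i <- F) T i <= eta.
Proof.
move=> T0 TB eta0.
pose S := [set y | exists2 F, uniq F & y = \sum_(i <- F) T i].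
have hS : has_sup S.
  split; first by exists 0, [::] => //; rewrite big_nil.
  by exists B => _ [F uF ->]; exact: TB.
have [_ [F0 uF0 ->] F0S] := sup_adherent eta0 hS.
exists F0 => F uF disj.
have : \sum_(i <- F0 ++ F) T i <= sup S.
  apply: ub_le_sup; first by case: hS.
  exists (F0 ++ F) => //; rewrite cat_uniq uF0 uF andbT /=.
  by apply/hasPn => i iF; exact: disj.
by rewrite big_cat /=; lra.
Qed.

(** Trades a sum over pairs of frequencies for a sum over their differences, each of which occurs at
    most [n] times. *)
Lemma sum_fiber_le (I J : eqType) (f : I -> J) (T : J -> R) (r : seq I) (n : nat) (eta : R) :
  (forall j, 0 <= T j) ->
  (forall j, (count (fun i => f i == j) r <= n)%N) ->
  \sum_(j <- undup (map f r)) T j <= eta -> \sum_(i <- r) T (f i) <= n%:R * eta.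
Proof.
move=> T0 fn Teta; rewrite -(big_map f xpredT T) -big_undup_iterop_count /=.
apply: (@le_trans _ _ (\sum_(j <- undup (map f r)) n%:R * T j)).
  apply: ler_sum => j _; rewrite Monoid.iteropE /= iter_addr_0 mulr_natl.
  apply: ler_wpMn2l => //; rewrite count_map; apply: leq_trans (fn j).
  by apply: eq_leq; apply: eq_count => i.
by rewrite -mulr_sumr; apply: ler_wpM2l.
Qed.

Lemma amgm_lower (y u v : R) : 0 <= u -> 0 <= v -> y ^+ 2 <= u * v -> - (u + v) <= 2 * y.
Proof.
move=> u0 v0 yuv; rewrite leNgt; apply/negP => h.
have h1 : u + v < - (2 * y) by lra.
have : (u + v) ^+ 2 < (- (2 * y)) ^+ 2.
  by rewrite ltr_pXn2r// nnegrE; lra.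
have := sqr_ge0 (u - v); rewrite !expr2 in yuv *; nra.
Qed.

(** By Lagrange's identity the norm and the inner product with (x, y) fix the cross product up to
    sign, and the two products together determine the vector. Among three points, two have the same
    sign. *)
Lemma circle_line (x y X0 Y0 X1 Y1 X2 Y2 : R) : (x, y) <> (0, 0) ->
  X1 ^+ 2 + Y1 ^+ 2 = X0 ^+ 2 + Y0 ^+ 2 -> X2 ^+ 2 + Y2 ^+ 2 = X0 ^+ 2 + Y0 ^+ 2 ->
  X1 * x + Y1 * y = X0 * x + Y0 * y -> X2 * x + Y2 * y = X0 * x + Y0 * y ->
  (X0, Y0) = (X1, Y1) \/ (X0, Y0) = (X2, Y2) \/ (X1, Y1) = (X2, Y2).
Proof.
move=> xy0 n1 n2 l1 l2.
have d0 : x ^+ 2 + y ^+ 2 != 0.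
  apply/eqP => /eqP; rewrite paddr_eq0 ?sqr_ge0// !sqrf_eq0 => /andP[/eqP ? /eqP ?].
  by apply: xy0; congr pair.
have eqB (U V U' V' : R) : U * x + V * y = U' * x + V' * y ->
    U * y - V * x = U' * y - V' * x -> (U, V) = (U', V').
  move=> e1 e2; congr pair; apply: (mulIf d0).
    transitivity ((U * x + V * y) * x + (U * y - V * x) * y); first by ring.
    by rewrite e1 e2; ring.
  transitivity ((U * x + V * y) * y - (U * y - V * x) * x); first by ring.
  by rewrite e1 e2; ring.
have sqB (U V U' V' : R) : U ^+ 2 + V ^+ 2 = U' ^+ 2 + V' ^+ 2 ->
    U * x + V * y = U' * x + V' * y ->
    U * y - V * x = U' * y - V' * x \/ U * y - V * x = - (U' * y - V' * x).
  move=> e1 e2.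
  have /eqP : (U * y - V * x) ^+ 2 = (U' * y - V' * x) ^+ 2.
    transitivity ((U ^+ 2 + V ^+ 2) * (x ^+ 2 + y ^+ 2) - (U * x + V * y) ^+ 2).
      by ring.
    by rewrite e1 e2; ring.
  by rewrite eqf_sqr => /orP[/eqP|/eqP]; [left|right].
have [b1|b1] := sqB _ _ _ _ n1 l1; first by left; apply/esym/eqB.
have [b2|b2] := sqB _ _ _ _ n2 l2; first by right; left; apply/esym/eqB.
by right; right; apply: eqB; rewrite ?l1 ?l2 ?b1 ?b2.
Qed.

(** A chord m from (X, Y) gives the linear equation 2 (X, Y).m = |m|^2. Two distinct nonzero chords
    are not parallel, since m' = r m forces r (r - 1) = 0, so Cramer's rule recovers (X, Y); the
    radius therefore depends on the chords alone. *)
Lemma circle_two_chords (X Y x y x' y' : R) : (x, y) <> (0, 0) -> (x', y') <> (0, 0) ->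
  (x, y) <> (x', y') ->
  (X - x) ^+ 2 + (Y - y) ^+ 2 = X ^+ 2 + Y ^+ 2 ->
  (X - x') ^+ 2 + (Y - y') ^+ 2 = X ^+ 2 + Y ^+ 2 ->
  let D := 2 * (x * y' - x' * y) in
  let u := x ^+ 2 + y ^+ 2 in let u' := x' ^+ 2 + y' ^+ 2 in
  X ^+ 2 + Y ^+ 2 = ((u * y' - u' * y) / D) ^+ 2 + ((x * u' - x' * u) / D) ^+ 2.
Proof.
move=> m0 m0' mm' e1 e2 D u u'.
have f1 : 2 * (X * x + Y * y) = u by rewrite /u; move: e1; rewrite !expr2; lra.
have f2 : 2 * (X * x' + Y * y') = u' by rewrite /u'; move: e2; rewrite !expr2; lra.
have u0 (v w : R) : (v, w) <> (0, 0) -> v ^+ 2 + w ^+ 2 != 0.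
  move=> vw; apply/eqP => /eqP.
  rewrite paddr_eq0 ?sqr_ge0// !sqrf_eq0 => /andP[/eqP ? /eqP ?].
  by apply: vw; congr pair.
have un0 := u0 _ _ m0; have un0' := u0 _ _ m0'.
have D0 : D != 0.
  apply/eqP => D0; have dd : x * y' = x' * y by move: D0; rewrite /D; lra.
  pose r := (x * x' + y * y') / (x ^+ 2 + y ^+ 2).
  have xr : x' = r * x.
    rewrite /r; apply: (mulIf un0); rewrite mulrAC divfK//.
    transitivity (x ^+ 2 * x' + y * (x' * y)); first by ring.
    by rewrite -dd; ring.
  have yr : y' = r * y.
    rewrite /r; apply: (mulIf un0); rewrite mulrAC divfK//.
    transitivity (x * (x * y') + y ^+ 2 * y'); first by ring.
    by rewrite dd; ring.
  clearbody r; have /eqP : r * (r - 1) * u = 0.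
    transitivity (u' - r * u); first by rewrite /u' xr yr /u; ring.
    by rewrite -f2 -f1 xr yr; ring.
  rewrite !mulf_eq0 (negbTE un0) orbF subr_eq0 => /orP[] /eqP rE.
    by apply: m0'; rewrite xr yr rE !mul0r.
  by apply: mm'; rewrite xr yr rE !mul1r.
have -> : X = (u * y' - u' * y) / D.
  by apply: (mulIf D0); rewrite divfK// -f1 -f2 /D; ring.
have -> : Y = (x * u' - x' * u) / D.
  by apply: (mulIf D0); rewrite divfK// -f1 -f2 /D; ring.
by [].
Qed.

End Seqs.

Section Rintegral_tools.
Context {R : realType}.
Implicit Types (f g : PT R -> R) (A B V : set (PT R)).

Lemma Rintegral_subset A B f : measurable A -> measurable B -> A `<=` B ->
  (forall x, 0 <= f x) -> leb2.-integrable B (EFin \o f) ->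
  \int[leb2]_(x in A) f x <= \int[leb2]_(x in B) f x.
Proof.
move=> mA mB AB f0 fB; have fA := integrableS mB mA AB fB.
rewrite /Rintegral fine_le//; [exact: integrable_fin_num|exact: integrable_fin_num|].
apply: ge0_subset_integral => //; first exact: measurable_int fB.
by move=> x _; rewrite lee_fin.
Qed.

Lemma Rintegral_indicM A V f : measurable A -> V `<=` A ->
  \int[leb2]_(x in A) (\1_V x * f x) = \int[leb2]_(x in V) f x.
Proof.
move=> mA VA; have {2}-> : V = A `&` V by apply/esym/setIidPr.
rewrite Rintegral_mkcondr; apply: eq_Rintegral => x xA.
rewrite patchE indicE; case: (x \in V); rewrite ?mul1r ?mul0r//.
Qed.

End Rintegral_tools.

(** * Bessel's inequality and overlapping translates *)

Section TorusLower.
Context {R : realType}.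
Variables (p q o : R * R).
Hypothesis fdet0 : fdet p q != 0.
Implicit Types (x : PT R) (k l m : int * int) (V : set (PT R)).
Implicit Types (a b : int * int -> R) (K : seq (int * int)).

Local Notation c := (ck p q o).
Local Notation s := (sk p q o).
Local Notation P := (Pcell p q o).
Local Notation fs := (fs p o).
Local Notation ft := (ft q o).
Local Notation en := (en p q o).
Local Notation reU := (reU p q o).
Local Notation imU := (imU p q o).
Local Notation cV := (cV p q o).
Local Notation sV := (sV p q o).

Section Subset.
Variable V : set (PT R).
Hypotheses (mV : measurable V) (VP : V `<=` P).

Lemma leb2_subP : (leb2 V < +oo)%E.
Proof.
apply: le_lt_trans (leb2_P o fdet0); apply: le_measure; rewrite ?inE//.
exact: measurable_P.
Qed.

(** The integral of |1_V - U|^2 over the cell is nonnegative, where U carries the Fourier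
    coefficients conj(tau(m)) / w of the indicator of V and w is the area of the cell. *)
Lemma bessel F : (0 < leb2 V)%E -> uniq F ->
  \sum_(m <- F) (cV V m ^+ 2 + sV V m ^+ 2) <= fine (leb2 P) * fine (leb2 V).
Proof.
move=> V0 uF; set T := \sum_(m <- F) _.
have mP := measurable_P p q o; have Poo := leb2_P o fdet0; have Voo := leb2_subP.
have P0 : 0 < fine (leb2 P).
  rewrite fine_gt0// Poo andbT; apply: lt_le_trans V0 _.
  by apply: le_measure; rewrite ?inE.
set w := fine (leb2 P) in P0 *.
pose a m := w^-1 * cV V m; pose b m := - (w^-1 * sV V m).
have br := bmf_reU p q o F a b; have be := bmf_en p q o F a b.
have b1 := bmf_indic mV.
have : 0 <= \int[leb2]_(x in P)
    ((\1_V x * 1 - 2 * (\1_V x * reU F a b x)) + en F a b x).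
  apply: Rintegral_ge0 => x _; rewrite indicE.
  have := sqr_ge0 (imU F a b x); have := sqr_ge0 (1 - reU F a b x).
  have := sqr_ge0 (reU F a b x); rewrite /Submission.en !expr2.
  by case: (_ \in _) => /=; nra.
rewrite RintegralD//; [|apply: bmf_integrable => //; apply: bmfB;
  [exact: bmfM b1 (bmf_cst _)|exact: bmfZ (bmfM b1 br)]|exact: bmf_integrable].
rewrite RintegralB//; [|exact: bmf_integrable (bmfM b1 (bmf_cst _))|
  exact: bmf_integrable (bmfZ _ (bmfM b1 br))].
rewrite RintegralZl//; last exact: bmf_integrable (bmfM b1 br).
rewrite !Rintegral_indicM// Rintegral_cst// mul1r parseval_cell//.
have -> : \int[leb2]_(x in V) reU F a b x = w^-1 * T.
  rewrite /reU Rintegral_sum//; last first.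
    by move=> k; apply: bmf_integrable => //; apply: bmfB; apply: bmfZ;
      [exact: bmf_ck|exact: bmf_sk].
  rewrite /T mulr_sumr; apply: eq_bigr => k _.
  rewrite RintegralB// ?RintegralZl//; [|exact: bmf_integrable (bmf_sk _ _ _ _)|
    exact: bmf_integrable (bmf_ck _ _ _ _)|exact: bmf_integrable (bmfZ _ (bmf_ck _ _ _ _))
    |exact: bmf_integrable (bmfZ _ (bmf_sk _ _ _ _))].
  by rewrite -/(cV V k) -/(sV V k) /a /b; ring.
have -> : nrm F a b = w^-2 * T.
  rewrite /nrm /T mulr_sumr; apply: eq_bigr => k _.
  by rewrite /a /b; field; rewrite gt_eqF.
rewrite -/w => h.
have : 0 <= w * (fine (leb2 V) - 2 * (w^-1 * T) + w * (w^-2 * T)).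
  by rewrite mulr_ge0// ltW.
have -> : w * (fine (leb2 V) - 2 * (w^-1 * T) + w * (w^-2 * T)) =
   w * fine (leb2 V) - T by field; rewrite gt_eqF.
by rewrite subr_ge0.
Qed.

End Subset.

Lemma frame_inj x y : fs x = fs y -> ft x = ft y -> x = y.
Proof. by move=> e1 e2; rewrite (frameE o fdet0 x) e1 e2 -(frameE o fdet0). Qed.

(* Many translates of [V] fit in a fixed bounded set, hence two of them overlap. *)
Lemma overlapping_translate V : measurable V -> V `<=` P -> (0 < leb2 V)%E ->
  exists2 J : nat, (0 < J)%N & forall al be : R, J%:R * `|al| <= 1 -> J%:R * `|be| <= 1 ->
    exists2 d : nat, (0 < d <= J)%N &
      (0 < leb2 (V `&` shift2 (fvec p q (d%:R * al) (d%:R * be)) @^-1` V))%E.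
Proof.
move=> mV VP V0; have Voo := leb2_subP mV VP.
(* The coordinates of V lie in [0, 1) and the shifts move them by at most 1, so all translates stay
   in [B]. The number [J] of translates is chosen larger than |B| / |V|. *)
pose B : set (PT R) := [set x | -2 <= fs x < 3 /\ -2 <= ft x < 3].
have mB : measurable B.
  by apply: measurableI; apply: measurable_strip; [exact: measurable_fs|exact: measurable_ft].
have Boo : (leb2 B < +oo)%E.
  apply: (leb2_bounded (o := o) fdet0 (c := 3)) => // x [/andP[? ?] /andP[? ?]].
  by rewrite !ler_norml; split; apply/andP; split; lra.
have v0 : 0 < fine (leb2 V) by rewrite fine_gt0// V0.
pose J := (Num.truncn (fine (leb2 B) / fine (leb2 V))).+1.
have Jv : fine (leb2 B) < J%:R * fine (leb2 V).
  by rewrite -ltr_pdivrMr//; exact: truncnS_gt.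
have J0 : (0 < J)%N by [].
clearbody J; exists J => // al be Jal Jbe; apply: contrapT => /forall2NP h.
pose H (j : nat) := fvec p q (- (j%:R * al)) (- (j%:R * be)).
pose W j := shift2 (H j) @^-1` V.
have mW j : measurable (W j) by exact: measurable_preshift2.
have bnd (j : nat) (e : R) : (j < J)%N -> J%:R * `|e| <= 1 -> - 1 <= j%:R * e <= 1.
  move=> jJ Je; rewrite -ler_norml normrM normr_nat; apply: le_trans Je.
  by apply: ler_wpM2r => //; rewrite ler_nat ltnW.
have key (u e : R) : 0 <= u - e < 1 -> -1 <= e <= 1 -> -2 <= u < 3.
  by clear; move=> /andP[? ?] /andP[? ?]; apply/andP; split; lra.
have WB j : (j < J)%N -> W j `<=` B.
  move=> jJ x /VP; rewrite /Pcell /cell /= fs_shift// ft_shift//.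
  by move=> [xs xt]; split; [apply: key xs (bnd _ _ jJ Jal)|apply: key xt (bnd _ _ jJ Jbe)].
have W0 i j : (i < J)%N -> (j < J)%N -> i != j -> leb2 (W i `&` W j) = 0%E.
  wlog ij : i j / (i < j)%N.
    move=> wl iJ jJ; rewrite neq_ltn => /orP[ij|ij]; first by apply: wl; rewrite ?ltn_eqF.
    by rewrite setIC; apply: wl; rewrite ?ltn_eqF.
  move=> iJ jJ _; have [//|n0] := h (j - i)%N.
    by case; rewrite subn_gt0 ij (leq_trans (leq_subr _ _) (ltnW jJ)).
  have mWW : measurable (W i `&` W j) by exact: measurableI.
  rewrite -(leb2_translate (fvec p q (j%:R * al) (j%:R * be)) mWW).
  apply/eqP; rewrite eq_le measure_ge0 andbT leNgt; apply/negP => pos; apply: n0.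
  move: pos; congr (0 < leb2 _)%E; rewrite preimage_setI setIC; congr (_ `&` _).
    apply/seteqP; split => x; rewrite /W /=; congr V; apply: frame_inj;
      by rewrite ?fs_shift ?ft_shift//; ring.
  apply/seteqP; split => x; rewrite /W /=; congr V; apply: frame_inj;
      by rewrite ?fs_shift ?ft_shift// natrB ?(ltnW ij)//; ring.
have bW j : bmf (\1_(W j) : PT R -> R) by exact: bmf_indic.
have bS : bmf (fun x => \sum_(j <- iota 0 J) \1_(W j) x : R) by exact: bmf_sum.
(* The integrand is the square of the sum of the indicators minus 1. If all overlaps were null, the
   integral would equal |B| - J |V|, which is negative by the choice of [J]. *)
have : 0 <= \int[leb2]_(x in B)
    ((\sum_(i <- iota 0 J) \sum_(j <- iota 0 J) \1_(W i) x * \1_(W j) x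
     - 2 * \sum_(i <- iota 0 J) \1_(W i) x) + 1).
  apply: Rintegral_ge0 => x _.
  under eq_bigr do rewrite -mulr_sumr.
  by rewrite -mulr_suml; have := sqr_ge0 (\sum_(i <- iota 0 J) \1_(W i) x - 1 : R);
    rewrite expr2; lra.
have bSS : bmf (fun x => \sum_(i <- iota 0 J) \sum_(j <- iota 0 J) \1_(W i) x * \1_(W j) x : R).
  by apply: bmf_sum => i; apply: bmf_sum => j; exact: bmfM.
rewrite RintegralD//; [|exact: bmf_integrable (bmfB bSS (bmfZ _ bS))|
  exact: bmf_integrable (bmf_cst _)].
rewrite RintegralB//; [|exact: bmf_integrable|exact: bmf_integrable (bmfZ _ bS)].
rewrite RintegralZl//; last exact: bmf_integrable.
rewrite Rintegral_cst// mul1r.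
have IW j : (j < J)%N -> \int[leb2]_(x in B) \1_(W j) x = fine (leb2 V).
  move=> jJ; under eq_Rintegral do rewrite -[\1_(W j) _]mulr1.
  rewrite Rintegral_indicM//; last exact: WB.
  by rewrite Rintegral_cst// mul1r leb2_translate.
rewrite Rintegral_sum//; last first.
  by move=> i; apply: bmf_integrable => //; apply: bmf_sum => j; exact: bmfM.
rewrite Rintegral_sum//; last by move=> i; exact: bmf_integrable.
have -> : \sum_(i <- iota 0 J) \int[leb2]_(x in B) \1_(W i) x = J%:R * fine (leb2 V).
  rewrite (eq_big_seq (fun _ => fine (leb2 V))).
    by rewrite big_const_seq count_predT size_iota iter_addr_0 mulr_natl.
  by move=> i; rewrite mem_iota => /andP[_]; rewrite add0n => /IW.
have -> : \sum_(i <- iota 0 J) \int[leb2]_(x in B)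
    (\sum_(j <- iota 0 J) \1_(W i) x * \1_(W j) x) = J%:R * fine (leb2 V).
  rewrite (eq_big_seq (fun _ => fine (leb2 V))).
    by rewrite big_const_seq count_predT size_iota iter_addr_0 mulr_natl.
  move=> i; rewrite mem_iota add0n => /andP[_ iJ].
  rewrite Rintegral_sum//; last by move=> j; apply: bmf_integrable => //; exact: bmfM.
  rewrite (bigD1_seq i) ?iota_uniq ?mem_iota ?add0n//=.
  rewrite big1_seq ?addr0.
    rewrite -(IW _ iJ); apply: eq_Rintegral => x _.
    by rewrite indicE; case: (_ \in _); rewrite ?mulr1 ?mulr0.
  move=> j /andP[ji]; rewrite mem_iota add0n => /andP[_ jJ].
  rewrite Rintegral_indicM//; last exact: WB.
  transitivity (\int[leb2]_(x in W i `&` W j) cst 1 x : R).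
    rewrite Rintegral_mkcondr; apply: eq_Rintegral => x _.
    by rewrite patchE indicE; case: (_ \in _).
  rewrite Rintegral_cst ?W0 ?mulr0// 1?eq_sym//; exact: measurableI.
lra.
Qed.

End TorusLower.

(** * Quantitative linear independence on a set of positive measure *)

Section TrigLower.
Context {R : realType}.
Variables (p q o : R * R).
Hypothesis fdet0 : fdet p q != 0.
Implicit Types (x : PT R) (k l m : int * int) (V : set (PT R)).
Implicit Types (a b : int * int -> R) (K : seq (int * int)).

Local Notation c := (ck p q o).
Local Notation s := (sk p q o).
Local Notation P := (Pcell p q o).
Local Notation en := (en p q o).
Local Notation reU := (reU p q o).
Local Notation imU := (imU p q o).

Lemma en_le K a b x : en K a b x <= 2 ^+ size K * nrm K a b.
Proof.
elim: K => [|k K ih].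
  by rewrite /nrm /Submission.en /Submission.reU /Submission.imU !big_nil; lra.
have N0 := nrm_ge0 K a b.
have e2 : 1 <= (2 : R) ^+ size K by rewrite exprn_ege1// ler1n.
have h0 : 0 <= a k ^+ 2 + b k ^+ 2 by rewrite addr_ge0// sqr_ge0.
have -> : nrm (k :: K) a b = (a k ^+ 2 + b k ^+ 2) + nrm K a b.
  by rewrite /nrm big_cons.
have : en (k :: K) a b x <= 2 * (a k ^+ 2 + b k ^+ 2) + 2 * en K a b x.
  have -> : a k ^+ 2 + b k ^+ 2 = (a k * c k x - b k * s k x) ^+ 2 +
      (a k * s k x + b k * c k x) ^+ 2.
    transitivity ((a k ^+ 2 + b k ^+ 2) * (c k x ^+ 2 + s k x ^+ 2)).
      by rewrite cos2Dsin2 mulr1.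
    by ring.
  rewrite /Submission.en /Submission.reU /Submission.imU !big_cons -/(reU K a b x) -/(imU K a b x).
  set u := a k * c k x - _; set v := a k * s k x + _.
  have := sqr_ge0 (u - reU K a b x); have := sqr_ge0 (v - imU K a b x).
  by rewrite !expr2; clear; nra.
rewrite /= (exprS 2 (size K)) => h; apply: le_trans h _.
move: ih N0 e2 h0; move: (2 ^+ size K) (nrm K a b) (en K a b x) (a k ^+ 2 + b k ^+ 2) => u v w t.
move=> wuv _ u1 t0; have tu : t <= u * t by rewrite ler_peMl.
by rewrite -mulrA mulrDr; lra.
Qed.

Lemma angkB k l (al be : R) : angk (k - l) al be = angk k al be - angk l al be.
Proof. by rewrite /angk /= !intrB; ring. Qed.

Lemma cos_neq1 (t : R) : t != 0 -> `|t| < pi -> cos t < 1.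
Proof.
move=> t0 tpi; rewrite lt_neqAle cos_le1 andbT; apply/eqP => ct.
have /eqP : sin t ^+ 2 = 0 by have := cos2Dsin2 t; rewrite ct expr1n; lra.
rewrite sqrf_eq0 => /eqP st.
have := @sin_gt0_pi _ `|t|; rewrite normr_gt0 t0 tpi => /(_ isT).
have [t1|t1] := leP 0 t; first by rewrite ger0_norm// st ltxx.
by rewrite ltr0_norm// sinN st oppr0 ltxx.
Qed.

(** The shift is a small multiple of (1, N + 1), where N bounds the coordinates of every m = k - k0.
    Then m.1 + m.2 (N + 1) is a nonzero integer, as in base N + 1, and [X] is so large that the
    phase stays below pi in absolute value for the first J multiples of the shift. *)
Lemma separating_shift k0 K (J : nat) : (0 < J)%N -> (forall k, k \in K -> k != k0) ->
  exists al be : R, [/\ J%:R * `|al| <= 1, J%:R * `|be| <= 1 &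
    forall d : nat, (0 < d <= J)%N -> forall k, k \in K ->
      cos (angk (k - k0) (d%:R * al) (d%:R * be)) < 1].
Proof.
move=> J0 Kk0.
have [N hN] := seq_nat_bound (fun k => (absz (k - k0)%R.1 + absz (k - k0)%R.2)%N) K.
pose n : R := N%:R; have n0 : 0 <= n by exact: ler0n.
have j0 : 0 < J%:R :> R by rewrite ltr0n.
pose X : R := 2 * (n + 2) ^+ 2.
have X0 : 0 < X by rewrite /X expr2; nra.
have jX0 : 0 < J%:R * X by exact: mulr_gt0.
exists (J%:R * X)^-1, ((n + 1) / (J%:R * X)); split.
- rewrite ger0_norm; last by rewrite invr_ge0 ltW.
  have -> : J%:R * (J%:R * X)^-1 = X^-1 by field; rewrite !gt_eqF.
  by rewrite invf_le1// /X expr2; clear -n0; nra.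
- rewrite ger0_norm; last by rewrite divr_ge0 ?ltW//; lra.
  have -> : J%:R * ((n + 1) / (J%:R * X)) = (n + 1) / X by field; rewrite !gt_eqF.
  by rewrite ler_pdivrMr// /X expr2; clear -n0; nra.
move=> d /andP[d0 dJ] k kK; set m := k - k0.
have m0 : m != 0 by rewrite subr_eq0 Kk0.
have dr0 : 0 < d%:R :> R by rewrite ltr0n.
have drJ : d%:R <= J%:R :> R by rewrite ler_nat.
pose w : int := m.1 + m.2 * (N.+1)%:Z.
have mN := hN _ kK; rewrite -/m in mN.
have w0 : w != 0.
  apply: contra_neq m0 => w0.
  have m2 : m.2 = 0.
    apply/eqP; rewrite -absz_eq0; apply: contraT; rewrite -lt0n => m2.
    move/eqP: w0; rewrite /w addr_eq0 => /eqP m1.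
    move: (leq_trans (leq_addr _ _) mN); rewrite m1 abszN abszM leqNgt.
    by rewrite (leq_trans _ (leq_pmull _ m2)).
  move: w0; rewrite /w m2 mul0r addr0 => m1.
  by rewrite (surjective_pairing m) m1 m2.
have Nn : (N.+1%:Z)%:~R = n + 1 :> R by rewrite /n natr1.
have angE : angk m (d%:R / (J%:R * X)) (d%:R * ((n + 1) / (J%:R * X))) =
    2 * pi * (d%:R / (J%:R * X) * w%:~R).
  rewrite /angk /w intrD intrM Nn.
  by field; rewrite !gt_eqF.
rewrite angE; apply: cos_neq1.
  have wr0 : w%:~R != 0 :> R by rewrite intr_eq0.
  apply: mulf_neq0; first by rewrite gt_eqF// mulr_gt0// pi_gt0.
  by apply: mulf_neq0 => //; rewrite gt_eqF// divr_gt0.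
have wX : `|w%:~R| < (n + 2) ^+ 2 :> R.
  rewrite /w intrD intrM Nn; apply: le_lt_trans (ler_normD _ _) _.
  rewrite normrM [`|n + 1|]ger0_norm; last by lra.
  rewrite -!intr_norm -!natr_absz.
  have : (`|m.1| <= N)%N by apply: leq_trans mN; exact: leq_addr.
  have : (`|m.2| <= N)%N by apply: leq_trans mN; exact: leq_addl.
  rewrite -!(ler_nat R) -/n.
  by move: (`|m.1|%N%:R : R) (`|m.2|%N%:R : R) => u v; rewrite expr2; nra.
rewrite normrM [`|2 * pi|]ger0_norm ?mulr_ge0 ?pi_ge0//.
rewrite mulrC mulrA -[ltRHS]mul1r ltr_pM2r ?pi_gt0//.
rewrite normrM ger0_norm ?divr_ge0 ?ltW//.
have dj : d%:R / (J%:R * X) <= X^-1.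
  have -> : d%:R / (J%:R * X) = d%:R / J%:R * X^-1 by field; rewrite !gt_eqF.
  by apply: ler_piMl; [rewrite invr_ge0 ltW|rewrite ler_pdivrMr// mul1r].
have X' : X^-1 * (n + 2) ^+ 2 = 2^-1 by rewrite /X; field; rewrite gt_eqF//; lra.
have : d%:R / (J%:R * X) * `|w%:~R| < 2^-1.
  rewrite -X'; apply: le_lt_trans (ler_wpM2r _ dj) _ => //.
  by rewrite ltr_pM2l ?invr_gt0.
by lra.
Qed.

(** Induction on the number of frequencies, for all V at once since V shrinks to its overlap V' with
    a translate. On V' the difference U(x + h) - e_{k0}(h) U(x) has lost the frequency k0, and its
    other coefficients are those of U times e_k(h) - e_{k0}(h), none of which vanishes. The
    induction hypothesis controls these coefficients, and the one of k0 follows by subtraction on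
    V. *)
Lemma trig_lower K : uniq K -> forall V, measurable V -> V `<=` P -> (0 < leb2 V)%E ->
  exists2 e, 0 < e & forall a b, e * nrm K a b <= \int[leb2]_(x in V) en K a b x.
Proof.
elim: K => [_ V mV VP V0|k0 K ih /= /andP[k0K uK] V mV VP V0].
  exists 1 => // a b; rewrite /nrm big_nil mulr0.
  by apply: Rintegral_ge0 => x _; exact: en_ge0.
have Voo := leb2_subP fdet0 mV VP.
have v0 : 0 < fine (leb2 V) by rewrite fine_gt0// V0.
have [J J0 hJ] := overlapping_translate fdet0 mV VP V0.
have [|al [be [Jal Jbe sep]]] := @separating_shift k0 K J J0.
  by move=> k kK; apply: contraNneq k0K => <-.
have [d dJ] := hJ _ _ Jal Jbe.
have := sep _ dJ; set al' := d%:R * al; set be' := d%:R * be => {}sep.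
set h := fvec p q al' be'; set V' := V `&` _ => V'0.
have mV' : measurable V' by apply: measurableI => //; exact: measurable_preshift2.
have [e e0 he] := ih uK _ mV' (subset_trans (@subIsetl _ _ _) VP) V'0.
(* [A k] + i [B k] is e_k(h) - e_{k0}(h), whose squared modulus is 2 - 2 cos of the phase of k -
   k0. *)
pose A k := cos (angk k al' be') - cos (angk k0 al' be').
pose B k := sin (angk k al' be') - sin (angk k0 al' be').
have [g g0 hg] : exists2 g, 0 < g & forall k, k \in K -> g <= A k ^+ 2 + B k ^+ 2.
  apply: seq_pos_bound => k /sep; rewrite angkB cosB /A /B => h1.
  have := cos2Dsin2 (angk k al' be'); have := cos2Dsin2 (angk k0 al' be').
  by move: h1; rewrite !expr2; lra.
(* [C1] bounds the coefficients over [K], because the squared difference integrates over V' to at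
   most 4 times the integral of |U|^2 over V. In [C] the first two terms account for the coefficient
   of [k0] and the last one for [K]. *)
pose C1 := 4 / (e * g); pose C := 2 / fine (leb2 V) + 2 ^+ (size K).+1 * C1 + C1.
have C10 : 0 < C1 by rewrite divr_gt0// mulr_gt0.
have C0 : 0 < C.
  have : 0 < 2 / fine (leb2 V) by rewrite divr_gt0.
  have : 0 < 2 ^+ (size K).+1 * C1 by rewrite mulr_gt0// exprn_gt0.
  by rewrite /C; lra.
exists C^-1; first by rewrite invr_gt0.
move=> a b; rewrite ler_pdivrMl//.
set E := \int[leb2]_(x in V) _.
have bE := bmf_en p q o (k0 :: K) a b.
have iE : leb2.-integrable V (EFin \o en (k0 :: K) a b) by exact: bmf_integrable.
pose a' k := a k * A k - b k * B k; pose b' k := a k * B k + b k * A k.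
have ptw x : en K a' b' x <= 2 * en (k0 :: K) a b (shift2 h x) + 2 * en (k0 :: K) a b x.
  pose c0 := cos (angk k0 al' be'); pose s0 := sin (angk k0 al' be').
  have csE : c0 ^+ 2 + s0 ^+ 2 = 1 by exact: cos2Dsin2.
  have [a0 b0] : a' k0 = 0 /\ b' k0 = 0 by rewrite /a' /b' /A /B !subrr; split; ring.
  have re : reU K a' b' x = reU (k0 :: K) a b (shift2 h x) -
      (c0 * reU (k0 :: K) a b x - s0 * imU (k0 :: K) a b x).
    transitivity (reU (k0 :: K) a' b' x).
      by rewrite /Submission.reU big_cons a0 b0; ring.
    rewrite /Submission.reU /Submission.imU !mulr_sumr -!sumrB; apply: eq_bigr => k _.
    rewrite /ck /sk phase_shift// cosD sinD /a' /b' /A /B /c0 /s0; ring.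
  have im : imU K a' b' x = imU (k0 :: K) a b (shift2 h x) -
      (c0 * imU (k0 :: K) a b x + s0 * reU (k0 :: K) a b x).
    transitivity (imU (k0 :: K) a' b' x).
      by rewrite /Submission.imU big_cons a0 b0; ring.
    rewrite /Submission.reU /Submission.imU !mulr_sumr -big_split -sumrB; apply: eq_bigr => k _ /=.
    rewrite /ck /sk phase_shift// cosD sinD /a' /b' /A /B /c0 /s0; ring.
  rewrite /Submission.en re im.
  move: (reU (k0 :: K) a b (shift2 h x)) (imU (k0 :: K) a b (shift2 h x)).
  move: (reU (k0 :: K) a b x) (imU (k0 :: K) a b x) => r i r1 i1.
  have -> : r ^+ 2 + i ^+ 2 = (c0 * r - s0 * i) ^+ 2 + (c0 * i + s0 * r) ^+ 2.
    transitivity ((c0 ^+ 2 + s0 ^+ 2) * (r ^+ 2 + i ^+ 2)); first by rewrite csE mul1r.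
    by ring.
  have := sqr_ge0 (r1 + (c0 * r - s0 * i)); have := sqr_ge0 (i1 + (c0 * i + s0 * r)).
  by rewrite !expr2; clear; lra.
have V'P : V' `<=` P by move=> x [/VP].
have V'oo : (leb2 V' < +oo)%E := leb2_subP fdet0 mV' V'P.
have step : \int[leb2]_(x in V') en K a' b' x <= 4 * E.
  have bEs := bmf_shift h bE.
  have mVs : measurable (shift2 h @^-1` V) by exact: measurable_preshift2.
  have iEs : leb2.-integrable (shift2 h @^-1` V) (EFin \o (fun x => en (k0 :: K) a b (shift2 h x))).
    by apply: bmf_integrable => //; rewrite leb2_translate.
  apply: (@le_trans _ _ (\int[leb2]_(x in V')
      (2 * en (k0 :: K) a b (shift2 h x) + 2 * en (k0 :: K) a b x))).
    apply: le_Rintegral => //; [exact: bmf_integrable (bmf_en _ _ _ _ _ _)|].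
    exact: bmf_integrable (bmfD (bmfZ _ bEs) (bmfZ _ bE)).
  rewrite RintegralD//; [|exact: bmf_integrable (bmfZ _ bEs)|
    exact: bmf_integrable (bmfZ _ bE)].
  rewrite !RintegralZl//; [|exact: bmf_integrable bE|exact: bmf_integrable bEs].
  have : \int[leb2]_(x in V') en (k0 :: K) a b x <= E.
    by apply: Rintegral_subset => //; [exact: subIsetl|move=> x; exact: en_ge0].
  have : \int[leb2]_(x in V') en (k0 :: K) a b (shift2 h x) <= E.
    rewrite /E -(Rintegral_shift h mV (bmf_meas bE) iE).
    by apply: Rintegral_subset => //; [exact: subIsetr|move=> x; exact: en_ge0].
  by lra.
have nK : nrm K a b <= C1 * E.
  rewrite /C1 mulrAC ler_pdivlMr ?mulr_gt0//; apply: le_trans step.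
  apply: le_trans (he a' b'); rewrite mulrC -mulrA ler_pM2l// mulrC.
  rewrite /nrm mulr_suml big_seq [leRHS]big_seq; apply: ler_sum => k kK.
  have -> : a' k ^+ 2 + b' k ^+ 2 = (a k ^+ 2 + b k ^+ 2) * (A k ^+ 2 + B k ^+ 2).
    by rewrite /a' /b'; ring.
  by apply: ler_wpM2l; [rewrite addr_ge0// sqr_ge0|exact: hg].
have h0 : fine (leb2 V) * (a k0 ^+ 2 + b k0 ^+ 2) <=
    2 * E + 2 * (2 ^+ size K * nrm K a b) * fine (leb2 V).
  have ptw0 x : a k0 ^+ 2 + b k0 ^+ 2 <=
      2 * en (k0 :: K) a b x + 2 * (2 ^+ size K * nrm K a b).
    have := en_le K a b x.
    have -> : a k0 ^+ 2 + b k0 ^+ 2 = (a k0 * c k0 x - b k0 * s k0 x) ^+ 2 +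
        (a k0 * s k0 x + b k0 * c k0 x) ^+ 2.
      transitivity ((a k0 ^+ 2 + b k0 ^+ 2) * (c k0 x ^+ 2 + s k0 x ^+ 2)).
        by rewrite cos2Dsin2 mulr1.
      by ring.
    rewrite /Submission.en /Submission.reU /Submission.imU !big_cons -/(reU K a b x) -/(imU K a b x).
    move: (_ - b k0 * s k0 x) (_ + b k0 * c k0 x) (reU K a b x) (imU K a b x) => u v r i.
    have := sqr_ge0 (u + 2 * r); have := sqr_ge0 (v + 2 * i).
    by rewrite !expr2; clear; lra.
  rewrite mulrC -Rintegral_cst//.
  have -> : 2 * E + 2 * (2 ^+ size K * nrm K a b) * fine (leb2 V) =
    \int[leb2]_(x in V) (2 * en (k0 :: K) a b x + 2 * (2 ^+ size K * nrm K a b)).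
    rewrite RintegralD//; [|exact: bmf_integrable (bmfZ _ bE)|exact: bmf_integrable (bmf_cst _)].
    by rewrite RintegralZl// Rintegral_cst.
  apply: le_Rintegral => //; [exact: bmf_integrable (bmf_cst _)|].
  exact: bmf_integrable (bmfD (bmfZ _ bE) (bmf_cst _)).
have -> : nrm (k0 :: K) a b = (a k0 ^+ 2 + b k0 ^+ 2) + nrm K a b by rewrite /nrm big_cons.
have : a k0 ^+ 2 + b k0 ^+ 2 <= 2 / fine (leb2 V) * E + 2 ^+ (size K).+1 * nrm K a b.
  rewrite -(ler_pM2l v0); apply: le_trans h0 _; rewrite exprS.
  rewrite le_eqVlt; apply/orP; left; apply/eqP; field; rewrite gt_eqF//.
have : 2 ^+ (size K).+1 * nrm K a b <= 2 ^+ (size K).+1 * (C1 * E).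
  by apply: ler_wpM2l => //; exact: exprn_ge0.
move: nK; rewrite /C; clear; lra.
Qed.

End TrigLower.

(** * Lattice frequencies on a circle *)

Section Circle.
Context {R : realType}.
Variables (p q : R * R).
Hypothesis fdet0 : fdet p q != 0.
Implicit Types k l m : int * int.

(** [fx] and [fy] are the Euclidean components of the frequency vector k.1 p + k.2 q; a wave of
    frequency [k] is an eigenfunction of the Laplacian with eigenvalue - (2 pi)^2 [fQ k]. *)
Definition fx k : R := k.1%:~R * p.1 + k.2%:~R * q.1.
Definition fy k : R := k.1%:~R * p.2 + k.2%:~R * q.2.
Definition fQ k : R := fx k ^+ 2 + fy k ^+ 2.

Lemma fxB k l : fx (k - l) = fx k - fx l.
Proof. by rewrite /fx /= !intrB; ring. Qed.

Lemma fyB k l : fy (k - l) = fy k - fy l.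
Proof. by rewrite /fy /= !intrB; ring. Qed.

Lemma fcoord k : (k.1%:~R = (fx k * q.2 - fy k * q.1) / fdet p q :> R) *
                 (k.2%:~R = (fy k * p.1 - fx k * p.2) / fdet p q :> R).
Proof. by move: fdet0; rewrite /fx /fy /fdet => h; split; field. Qed.

Lemma fxy_inj k l : (fx k, fy k) = (fx l, fy l) -> k = l.
Proof.
move=> [ex ey]; have := fcoord k; rewrite ex ey -!(fcoord l) => -[/intr_inj e1 /intr_inj e2].
by rewrite (surjective_pairing k) (surjective_pairing l) e1 e2.
Qed.

Lemma fxy_neq0 m : m != 0 -> (fx m, fy m) <> (0, 0).
Proof.
move=> m0 e; move: m0; rewrite (@fxy_inj m 0) ?eqxx// e.
by rewrite /fx /fy /=; congr pair; ring.
Qed.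

(** If l and l - m both lie on the circle then l.m = |m|^2 / 2, the equation of a line, which meets
    the circle at most twice. *)
Lemma circle_difference mu m l0 l1 l2 : m != 0 ->
  fQ l0 = mu -> fQ l1 = mu -> fQ l2 = mu ->
  fQ (l0 - m) = mu -> fQ (l1 - m) = mu -> fQ (l2 - m) = mu ->
  l0 = l1 \/ l0 = l2 \/ l1 = l2.
Proof.
move=> /fxy_neq0 m0 e0 e1 e2 d0 d1 d2.
have dot l : fQ l = mu -> fQ (l - m) = mu ->
    fx l * fx m + fy l * fy m = (fx m ^+ 2 + fy m ^+ 2) / 2.
  rewrite /fQ fxB fyB => f1 f2; apply: (@mulIf _ 2) => //.
  by rewrite divfK//; move: f1 f2; rewrite !expr2; clear; lra.
have n1 : fQ l1 = fQ l0 by rewrite e0.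
have n2 : fQ l2 = fQ l0 by rewrite e0.
have d1' : fx l1 * fx m + fy l1 * fy m = fx l0 * fx m + fy l0 * fy m.
  exact: etrans (dot _ e1 d1) (esym (dot _ e0 d0)).
have d2' : fx l2 * fx m + fy l2 * fy m = fx l0 * fx m + fy l0 * fy m.
  exact: etrans (dot _ e2 d2) (esym (dot _ e0 d0)).
have [/fxy_inj|[/fxy_inj|/fxy_inj]] := circle_line m0 n1 n2 d1' d2'.
- by left.
- by right; left.
- by right; right.
Qed.

(** Two chords determine the radius, so [mu0] is a bound over the finitely many pairs from [F].
    Beyond it, a frequency has at most one neighbour on its circle at a nonzero difference in
    [F]. *)
Lemma near_chords_bounded (F : seq (int * int)) : exists mu0 : R, forall k m m',
  m \in F -> m' \in F -> m != 0 -> m' != 0 -> m != m' ->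
  fQ (k - m) = fQ k -> fQ (k - m') = fQ k -> fQ k <= mu0.
Proof.
pose val (z : (int * int) * (int * int)) : R :=
  let x := fx z.1 in let y := fy z.1 in let x' := fx z.2 in let y' := fy z.2 in
  let D := 2 * (x * y' - x' * y) in
  let u := x ^+ 2 + y ^+ 2 in let u' := x' ^+ 2 + y' ^+ 2 in
  ((u * y' - u' * y) / D) ^+ 2 + ((x * u' - x' * u) / D) ^+ 2.
have [N hN] := seq_real_bound val [seq (m, m') | m <- F, m' <- F].
exists N => k m m' mF mF' m0 m0' mm' e1 e2.
apply: le_trans (hN (m, m') _); last by apply/allpairsP; exists (m, m').
rewrite le_eqVlt; apply/orP; left; apply/eqP.
apply: circle_two_chords; [exact: fxy_neq0|exact: fxy_neq0| | |].
- by move/fxy_inj => /= h; rewrite h eqxx in mm'.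
- by rewrite /= -fxB -fyB.
- by rewrite /= -fxB -fyB.
Qed.

Lemma disc_finite (B : R) : exists2 K0 : seq (int * int), uniq K0 &
  forall k, fQ k <= B -> k \in K0.
Proof.
pose C := (1 + B) * (`|p.1| + `|p.2| + `|q.1| + `|q.2|) / `|fdet p q|.
pose N := (Num.truncn C).+1.
pose I : seq int := [seq i%:Z - N%:Z | i <- iota 0 (2 * N).+1].
have memI (i : int) : `|i%:~R| <= C -> i \in I.
  move=> iC; have : `|i%:~R| < N%:R :> R by apply: le_lt_trans iC _; exact: truncnS_gt.
  rewrite -intr_norm -[N%:R]/((N%:Z)%:~R) ltr_int => iN.
  apply/mapP; exists (absz (i + N%:Z)).
    by rewrite mem_iota add0n /=; move: iN; clear; lia.
  by move: iN; clear; lia.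
have bound (X Y r1 r2 : R) : X ^+ 2 + Y ^+ 2 <= B ->
    `|r1| + `|r2| <= `|p.1| + `|p.2| + `|q.1| + `|q.2| ->
    `|(X * r1 - Y * r2) / fdet p q| <= C.
  move=> XYB rr; rewrite normrM normfV /C ler_pM2r ?invr_gt0 ?normr_gt0//.
  have B0 : 0 <= 1 + B by have := sqr_ge0 X; have := sqr_ge0 Y; lra.
  apply: (@le_trans _ _ ((1 + B) * (`|r1| + `|r2|))); last exact: ler_wpM2l.
  have n1 (Z : R) : Z ^+ 2 <= B -> `|Z| <= 1 + B.
    move=> ZB; have := sqr_ge0 (`|Z| - 1); rewrite -real_normK ?num_real// in ZB.
    by move: ZB; rewrite !expr2; nra.
  have X1 : `|X| <= 1 + B by apply: n1; have := sqr_ge0 Y; lra.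
  have Y1 : `|Y| <= 1 + B by apply: n1; have := sqr_ge0 X; lra.
  apply: le_trans (ler_normB _ _) _; rewrite !normrM mulrDr.
  by apply: lerD; apply: ler_wpM2r.
have [[[? ?] ?] ?] := (normr_ge0 p.1, normr_ge0 p.2, normr_ge0 q.1, normr_ge0 q.2).
exists (undup [seq (i, j) | i <- I, j <- I]); first exact: undup_uniq.
move=> k kB; rewrite mem_undup; apply/allpairsP; exists k; split.
- by apply: memI; rewrite (fcoord k).1; apply: bound => //; lra.
- by apply: memI; rewrite (fcoord k).2; apply: bound; [rewrite addrC|lra].
- exact: surjective_pairing.
Qed.

End Circle.

(** * The lower bound, uniform over all circles *)

Section TorusTheorem.
Context {R : realType}.
Variables (p q o : R * R).
Hypothesis fdet0 : fdet p q != 0.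
Implicit Types (x : PT R) (k l m : int * int) (V : set (PT R)).
Implicit Types (a b : int * int -> R) (K : seq (int * int)).

Local Notation P := (Pcell p q o).
Local Notation en := (en p q o).
Local Notation cV := (cV p q o).
Local Notation sV := (sV p q o).
Local Notation cross := (cross p q o).
Local Notation fQ := (fQ p q).

Variable V : set (PT R).
Hypotheses (mV : measurable V) (VP : V `<=` P) (V0 : (0 < leb2 V)%E).
Let v := fine (leb2 V).

Let Voo : (leb2 V < +oo)%E := leb2_subP fdet0 mV VP.
Let v0 : 0 < v. Proof. by rewrite fine_gt0// V0. Qed.

Definition tau2 m : R := cV V m ^+ 2 + sV V m ^+ 2.

Lemma tau2_ge0 m : 0 <= tau2 m. Proof. by rewrite addr_ge0// sqr_ge0. Qed.

Lemma cross_sq a b k l : cross V a b k l ^+ 2 <=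
  (a k ^+ 2 + b k ^+ 2) * (a l ^+ 2 + b l ^+ 2) * tau2 (k - l).
Proof.
rewrite /Submission.cross /tau2; move: (cV V _) (sV V _) => C S.
set u := a k * a l + b k * b l; set w := b k * a l - a k * b l.
have -> : (a k ^+ 2 + b k ^+ 2) * (a l ^+ 2 + b l ^+ 2) = u ^+ 2 + w ^+ 2.
  by rewrite /u /w; ring.
by have := sqr_ge0 (u * S + w * C); rewrite !expr2; lra.
Qed.

Lemma cross_diag a b k : cross V a b k k = (a k ^+ 2 + b k ^+ 2) * v.
Proof. by rewrite /Submission.cross subrr cV0// sV0// -/v; ring. Qed.

(** The case of two frequencies 0 and m in [trig_lower], tested on the coefficients (|tau(m)|, -
    conj(tau(m))). They form the eigenvector of the 2 x 2 block for the eigenvalue |V| - |tau(m)|,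
    which is thereby bounded below. *)
Lemma tau2_lt m : m != 0 -> exists2 e, 0 < e & tau2 m <= (v - e) ^+ 2 /\ e <= v.
Proof.
move=> m0; have um : uniq [:: 0; m] by rewrite /= inE eq_sym m0.
have [e e0 he] := trig_lower fdet0 um mV VP V0.
have [T0|T0] := eqVneq (tau2 m) 0.
  by exists v => //; rewrite T0 sqr_ge0.
have Tp : 0 < tau2 m by rewrite lt_def T0 tau2_ge0.
set r := Num.sqrt (tau2 m); have r0 : 0 < r by rewrite sqrtr_gt0.
have rE : r ^+ 2 = tau2 m by rewrite sqr_sqrtr// tau2_ge0.
pose a k := if k == 0 then r else - cV V m.
pose b k := if k == 0 then 0 else sV V m.
have := he a b; rewrite (Rintegral_en p q o mV Voo) /nrm !big_cons !big_nil !cross_diag.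
rewrite /Submission.cross /a /b eqxx (negbTE m0) subr0 sub0r cVN// sVN// !addr0.
move: rE; rewrite /tau2; move: (cV V m) (sV V m) => C S rE h.
have {}h : e * (2 * r ^+ 2) <= 2 * r ^+ 2 * v - 2 * r * (C ^+ 2 + S ^+ 2).
  by move: h; rewrite rE !expr2; lra.
rewrite -rE in h *; have h2 : 2 * r ^+ 2 * (e - (v - r)) <= 0.
  by move: h; rewrite !expr2; lra.
have er : e <= v - r.
  by rewrite -subr_le0 -(@pmulr_rle0 _ (2 * r ^+ 2))// mulr_gt0// exprn_gt0.
exists e => //; split; last by lra.
by apply: lerXn2r; rewrite ?nnegrE; move: v0; lra.
Qed.

(** By Bessel's inequality [tau2] is at most (v / 2)^2 outside a finite set; on that set the gaps
    given by [tau2_lt] have a positive minimum. *)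
Lemma tau2_uniform : exists2 e, 0 < e & e <= v /\ forall m, m != 0 -> tau2 m <= (v - e) ^+ 2.
Proof.
have v2 : 0 < (v / 2) ^+ 2 by rewrite exprn_gt0// divr_gt0.
have [F0 hF0] := summable_tail tau2_ge0 (fun F uF => bessel fdet0 mV VP V0 uF) v2.
have /choice [f hf] : forall m, exists e, 0 < e /\ (m != 0 -> tau2 m <= (v - e) ^+ 2 /\ e <= v).
  move=> m; have [->|m0] := eqVneq m 0; first by exists 1.
  by have [e e0 he] := tau2_lt m0; exists e.
have [g g0 hg] := @seq_pos_bound _ _ f F0 (fun m _ => (hf m).1).
exists (Num.min g (v / 2)); first by rewrite lt_min g0 divr_gt0.
have mv : Num.min g (v / 2) <= v / 2 by rewrite ge_min lexx orbT.
split; first by apply: le_trans mv _; have := v0; lra.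
move=> m m0; have [mF|mF] := boolP (m \in F0).
  have [_ /(_ m0) [h1 h2]] := hf m; apply: le_trans h1 _.
  have gf : Num.min g (v / 2) <= f m by rewrite ge_min hg.
  by apply: lerXn2r; rewrite ?nnegrE; move: v0; lra.
have := hF0 [:: m] isT; rewrite big_cons big_nil addr0 => /(_ _) h.
apply: le_trans (h _) _; first by move=> i; rewrite inE => /eqP ->.
by apply: lerXn2r; rewrite ?nnegrE; move: v0; lra.
Qed.

Lemma torus_lower : exists2 dl, 0 < dl & forall mu K a b, uniq K ->
  (forall k, k \in K -> fQ k = mu) -> dl * nrm K a b <= \int[leb2]_(x in V) en K a b x.
Proof.
have [c0 c00 [c0v hc0]] := tau2_uniform.
(* With A the sum of the squared coefficients, the diagonal contributes v A, near pairs cost at most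
   (v - c0) A and far pairs at most 3 / 2 eps A = c0 / 2 A. What remains is c0 / 2 A. *)
pose eps := c0 / 3; have eps0 : 0 < eps by rewrite divr_gt0.
have eta0 : 0 < eps ^+ 2 by rewrite exprn_gt0.
have [F0 hF0] := summable_tail tau2_ge0 (fun F uF => bessel fdet0 mV VP V0 uF) eta0.
(* Made symmetric because near pairs are counted both by rows and by columns. *)
pose F := F0 ++ map -%R F0.
have [mu0 hmu0] := near_chords_bounded fdet0 F.
have [K0 uK0 hK0] := disc_finite fdet0 mu0.
have [c1 c10 hc1] := trig_lower fdet0 uK0 mV VP V0.
exists (Num.min c1 (c0 / 2)); first by rewrite lt_min c10 divr_gt0.
move=> mu K a b uK Kmu; have N0 := nrm_ge0 K a b.
have [small|large] := leP mu mu0.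
  have KK0 : {subset K <= K0} by move=> k /Kmu kmu; apply: hK0; rewrite kmu.
  (* Extending the coefficients by zero to the fixed set [K0] lets the single constant [c1] serve
     all small circles. *)
  pose a' k := if k \in K then a k else 0; pose b' k := if k \in K then b k else 0.
  have ext (G : (int * int) -> R) :
      \sum_(k <- K0) (if k \in K then G k else 0) = \sum_(k <- K) G k.
    rewrite -big_mkcond -big_filter; apply: perm_big; apply: uniq_perm => //.
      by rewrite filter_uniq.
    by move=> k; rewrite mem_filter; have [/KK0 ->|] := boolP (k \in K).
  have nE : nrm K0 a' b' = nrm K a b.
    rewrite /nrm -ext; apply: eq_bigr => k _; rewrite /a' /b'.
    by case: ifP => // _; rewrite expr0n /= addr0.
  have eE x : en K0 a' b' x = en K a b x.
    rewrite /Submission.en /Submission.reU /Submission.imU -!ext; congr (_ ^+ 2 + _ ^+ 2);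
      by apply: eq_bigr => k _; rewrite /a' /b'; case: ifP => // _; rewrite !mul0r ?addr0 ?subr0.
  apply: (@le_trans _ _ (c1 * nrm K a b)); first by apply: ler_wpM2r; rewrite // ge_min lexx.
  by rewrite -nE; under eq_Rintegral do rewrite -eE; exact: hc1.
apply: (@le_trans _ _ (c0 / 2 * nrm K a b)).
  by apply: ler_wpM2r; rewrite // ge_min lexx orbT.
have [Nz|Nnz] := eqVneq (nrm K a b) 0.
  by rewrite Nz mulr0; exact: int_en_ge0.
have A0 : 0 < nrm K a b by rewrite lt_def Nnz.
set A := nrm K a b in N0 A0 Nnz *.
pose n k := a k ^+ 2 + b k ^+ 2.
have n0 k : 0 <= n k by rewrite addr_ge0// sqr_ge0.
pose near k l := (k != l) && (k - l \in F0); pose far k l := (k != l) && (k - l \notin F0).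
(* The weight of the arithmetic-geometric splitting of far terms: it balances e A^2 = eps A against
   2 eps^2 / e = 2 eps A. *)
pose e := eps / A; have e0 : 0 < e by rewrite divr_gt0.
have inF z : z \in F0 -> (z \in F) && (- z \in F).
  by move=> zF; rewrite !mem_cat zF /= map_f ?orbT.
have nearP k l l' : k \in K -> l \in K -> l' \in K -> k != l -> k != l' ->
    k - l \in F -> k - l' \in F -> l = l'.
  move=> kK lK l'K kl kl' klF kl'F; apply/eqP; apply: contraT => ll'.
  have mm : k - l != k - l' by apply: contra_neq ll' => /addrI /oppr_inj.
  have := hmu0 k _ _ klF kl'F; rewrite !subKr !Kmu// !subr_eq0.
  by move=> /(_ kl kl' mm erefl erefl); rewrite leNgt large.
have lower k l : k \in K -> l \in K -> (k == l)%:R * (n k * v)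
    - (near k l)%:R * ((v - c0) / 2 * (n k + n l))
    - (far k l)%:R * ((e * (n k * n l) + tau2 (k - l) / e) / 2) <= cross V a b k l.
  move=> kK lK; rewrite /near /far; have [->|kl] := eqVneq k l.
    by rewrite cross_diag mul1r !mul0r !subr0.
  have [klF|klF] /= := boolP (k - l \in F0); rewrite !mul0r !mul1r ?subr0 sub0r.
    have t0 : tau2 (k - l) <= (v - c0) ^+ 2 by rewrite hc0// subr_eq0.
    have /amgm_lower : cross V a b k l ^+ 2 <= (n k * (v - c0)) * (n l * (v - c0)).
      apply: le_trans (cross_sq _ _ _ _) _.
      rewrite -/(n k) -/(n l) mulrACA -expr2; apply: ler_wpM2l t0; exact: mulr_ge0.
    rewrite !mulr_ge0 ?subr_ge0// => /(_ isT isT).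
    by lra.
  have /amgm_lower : cross V a b k l ^+ 2 <= (e * (n k * n l)) * (tau2 (k - l) / e).
    apply: le_trans (cross_sq _ _ _ _) _.
    by rewrite -/(n k) -/(n l) mulrACA [e * _]mulrC [X in _ <= X]mulrACA divff ?gt_eqF// mulr1 mulrC.
  move=> /(_ (mulr_ge0 (ltW e0) (mulr_ge0 (n0 k) (n0 l)))).
  by move=> /(_ (divr_ge0 (tau2_ge0 _) (ltW e0))); lra.
rewrite (Rintegral_en p q o mV Voo).
have : \sum_(k <- K) \sum_(l <- K) ((k == l)%:R * (n k * v)
    - (near k l)%:R * ((v - c0) / 2 * (n k + n l))
    - (far k l)%:R * ((e * (n k * n l) + tau2 (k - l) / e) / 2)) <=
    \sum_(k <- K) \sum_(l <- K) cross V a b k l.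
  rewrite big_seq [leRHS]big_seq; apply: ler_sum => k kK.
  rewrite big_seq [leRHS]big_seq; apply: ler_sum => l lK; exact: lower.
apply: le_trans.
under eq_bigr do rewrite 2!sumrB; rewrite 2!sumrB.
have D1 : \sum_(k <- K) \sum_(l <- K) (k == l)%:R * (n k * v) = A * v.
  rewrite /A /nrm mulr_suml; apply: eq_big_seq => k kK.
  rewrite (bigD1_seq k)//= eqxx mul1r big1 ?addr0// => l /negbTE lk.
  by rewrite eq_sym lk mul0r.
have cntE (r : pred (int * int)) (t : seq (int * int)) :
    \sum_(l <- t) (r l)%:R = (count r t)%:R :> R.
  by elim: t => [|l t ih]; rewrite ?big_nil ?big_cons//= ih natrD.
have row (r : rel (int * int)) (G : (int * int) -> R) : (forall k, 0 <= G k) ->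
    (forall k l l', k \in K -> l \in K -> l' \in K -> r k l -> r k l' -> l = l') ->
    \sum_(k <- K) \sum_(l <- K) (r k l)%:R * G k <= \sum_(k <- K) G k.
  move=> G0 rP; rewrite big_seq [leRHS]big_seq; apply: ler_sum => k kK.
  rewrite -mulr_suml ler_piMl// cntE -[1]/(1%:R) ler_nat.
  by apply: count_le1 => // l l' lK l'K; exact: rP.
have D2 : \sum_(k <- K) \sum_(l <- K) (near k l)%:R * ((v - c0) / 2 * (n k + n l)) <=
    (v - c0) * A.
  have -> : \sum_(k <- K) \sum_(l <- K) (near k l)%:R * ((v - c0) / 2 * (n k + n l)) =
      (v - c0) / 2 * (\sum_(k <- K) \sum_(l <- K) (near k l)%:R * n k +
                      \sum_(l <- K) \sum_(k <- K) (near k l)%:R * n l).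
    rewrite [X in _ = _ * (_ + X)]exchange_big -big_split mulr_sumr; apply: eq_bigr => k _ /=.
    rewrite -big_split mulr_sumr; apply: eq_bigr => l _ /=; ring.
  have r1 := row near n n0 _; have r2 := row (fun l k => near k l) n n0 _.
  have vc : 0 <= (v - c0) / 2 by rewrite divr_ge0// subr_ge0.
  have -> : (v - c0) * A = (v - c0) / 2 * (A + A) by field.
  apply: ler_wpM2l => //; apply: lerD.
    apply: r1 => k l l' kK lK l'K /andP[kl /inF/andP[klF _]] /andP[kl' /inF/andP[kl'F _]].
    exact: (nearP k).
  apply: r2 => k l l' kK lK l'K /andP[kl /inF/andP[_ klF]] /andP[kl' /inF/andP[_ kl'F]].
  by apply: (nearP k); rewrite // 1?eq_sym // -opprB.
pose L := [seq z <- [seq (k, l) | k <- K, l <- K] | far z.1 z.2].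
have uL : uniq L by rewrite filter_uniq// allpairs_uniq// => -[? ?] [? ?] _ _ [-> ->].
have LP z : z \in L -> [/\ z.1 \in K, z.2 \in K & far z.1 z.2].
  by rewrite mem_filter => /andP[fz /allpairsP[y [y1 y2 zy]]]; rewrite zy in fz *.
have farsum : \sum_(z <- L) tau2 (z.1 - z.2) <= 2%:R * eps ^+ 2.
  apply: (@sum_fiber_le _ _ _ (fun z => z.1 - z.2) tau2 L 2 _ tau2_ge0).
    move=> j; apply: count_le2 => // x y z /LP[x1 x2 /andP[xx _]] /LP[y1 y2 _] /LP[z1 z2 _].
    move=> /eqP xj /eqP yj /eqP zj.
    have j0 : j != 0 by rewrite -xj subr_eq0.
    have sub2 (w : (int * int) * (int * int)) : w.1 - w.2 = j -> w.2 = w.1 - j.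
      by move=> <-; rewrite subKr.
    have inj (w w' : (int * int) * (int * int)) : w.1 - w.2 = j -> w'.1 - w'.2 = j ->
        w.1 = w'.1 -> w = w'.
      move=> wj wj' ww; rewrite (surjective_pairing w) (surjective_pairing w').
      by rewrite (sub2 _ wj) (sub2 _ wj') ww.
    have [||||||E|[E|E]] := @circle_difference _ _ _ fdet0 mu j x.1 y.1 z.1 j0;
      rewrite -?sub2 ?Kmu//.
    - by left; exact: inj.
    - by right; left; exact: inj.
    - by right; right; exact: inj.
  apply: hF0; first exact: undup_uniq.
  move=> i; rewrite mem_undup => /mapP[z /LP[_ _ /andP[_ zF]] ->]; exact: zF.
have D3 : \sum_(k <- K) \sum_(l <- K)
    (far k l)%:R * ((e * (n k * n l) + tau2 (k - l) / e) / 2) <= 3 / 2 * eps * A.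
  apply: (@le_trans _ _ (\sum_(k <- K) \sum_(l <- K)
      (e / 2 * (n k * n l) + (2 * e)^-1 * ((far k l)%:R * tau2 (k - l))))).
    apply: ler_sum => k _; apply: ler_sum => l _.
    have -> : (far k l)%:R * ((e * (n k * n l) + tau2 (k - l) / e) / 2) =
      (far k l)%:R * (e / 2 * (n k * n l)) + (2 * e)^-1 * ((far k l)%:R * tau2 (k - l)).
      by field; rewrite gt_eqF.
    rewrite lerD2r; case: (far k l); rewrite ?mul1r// mul0r.
    apply: mulr_ge0; last exact: mulr_ge0.
    by rewrite divr_ge0// ltW.
  under eq_bigr do rewrite big_split /= -!mulr_sumr.
  rewrite big_split /= -!mulr_sumr -mulr_suml -[\sum_(k <- K) n k]/A.
  have -> : \sum_(k <- K) \sum_(l <- K) (far k l)%:R * tau2 (k - l) =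
      \sum_(z <- L) tau2 (z.1 - z.2).
    rewrite [RHS]big_filter [RHS]big_mkcond [RHS]big_allpairs_dep /=; apply: eq_bigr => k _.
    by apply: eq_bigr => l _; case: (far k l); rewrite ?mul1r ?mul0r.
  have -> : 3 / 2 * eps * A = e / 2 * (A * A) + (2 * e)^-1 * (2%:R * eps ^+ 2).
    by rewrite /e; field; rewrite Nnz gt_eqF.
  rewrite lerD2l; apply: ler_wpM2l => //.
  by rewrite invr_ge0 mulr_ge0// ltW.
rewrite D1; move: D2 D3; rewrite /eps; lra.
Qed.

End TorusTheorem.

(** * Completeness of the alternating exponentials *)

Section Convergence.
Context {R : realType}.

Lemma Rintegral_dct (D : set (PT R)) (F : nat -> PT R -> R) (f G : PT R -> R) :
  measurable D -> (forall n, measurable_fun D (F n)) -> measurable_fun D f ->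
  (forall x, D x -> F n x @[n --> \oo] --> f x) ->
  leb2.-integrable D (EFin \o G) -> (forall n x, D x -> `|F n x| <= G x) ->
  \int[leb2]_(x in D) F n x @[n --> \oo] --> \int[leb2]_(x in D) f x.
Proof.
move=> mD mF mf Ff iG FG.
have mEF n : measurable_fun D (fun x => (F n x)%:E) by apply/measurable_EFinP.
have mEf : measurable_fun D (EFin \o f) by apply/measurable_EFinP.
have EFf : {ae leb2, forall x, D x -> (F n x)%:E @[n --> \oo] --> (EFin \o f) x}.
  by apply: aeW => x Dx; apply: cvg_EFin; [exact: nearW|exact: Ff].
have EFG : {ae leb2, forall x n, D x -> (`|(F n x)%:E| <= (EFin \o G) x)%E}.
  by apply: aeW => x n Dx; rewrite lee_fin; exact: FG.
have [fi _ cv] := dominated_convergence mD mEF mEf EFf iG EFG.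
rewrite /Rintegral; apply: fine_cvg; rewrite fineK; first exact: cv.
exact: integrable_fin_num.
Qed.

Lemma bernoulli_ineq (x : R) n : -1 <= x -> 1 + n%:R * x <= (1 + x) ^+ n.
Proof.
move=> x1; elim: n => [|n ih]; first by rewrite mul0r addr0 expr0.
rewrite exprS -natr1; apply: le_trans (ler_wpM2l _ ih); last by lra.
have := mulr_ge0 (ler0n R n) (sqr_ge0 x); rewrite expr2; move: (n%:R : R) => m; lra.
Qed.

(** With r = s^2, Bernoulli's inequality bounds n s^n, and the remaining factor s^n tends to 0. *)
Lemma cvg_mulnX (r : R) : 0 <= r < 1 -> n%:R * r ^+ n @[n --> \oo] --> (0 : R).
Proof.
move=> /andP[r0 r1]; have [->|rn0] := eqVneq r 0.
  apply: cvg_near_cst; exists 1%N => // n /= n1.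
  by rewrite expr0n gtn_eqF// mulr0.
pose s := Num.sqrt r; have sp : 0 < s by rewrite sqrtr_gt0 lt_def rn0.
have s1 : s < 1 by rewrite -sqrtr1 ltr_sqrt.
pose h := s^-1 - 1; have h0 : 0 < h by rewrite subr_gt0 invf_gt1.
have b n : n%:R * s ^+ n <= h^-1.
  rewrite -[X in _ * X ^+ _](invrK s) exprVn ler_pdivrMr ?exprn_gt0 ?invr_gt0//.
  rewrite ler_pdivlMl//.
  have -> : s^-1 = 1 + h by rewrite /h; lra.
  by apply: le_trans (bernoulli_ineq n _); lra.
apply: (squeeze_cvgr (f := fun=> 0) (h := fun n => h^-1 * s ^+ n)).
- apply: nearW => n; rewrite mulr_ge0 ?exprn_ge0//=.
  have -> : r ^+ n = s ^+ n * s ^+ n by rewrite -exprMn -expr2 sqr_sqrtr.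
  by rewrite mulrA; apply: ler_wpM2r => //; rewrite exprn_ge0// ltW.
- exact: cvg_cst.
- rewrite -[X in _ --> X](mulr0 h^-1); apply: cvgMr.
  by apply: cvg_expr; rewrite gtr0_norm.
Qed.

(** Polynomials in [s] converging on [0, 1] to the indicator of s < 1 / 2, as in elementary proofs
    of the Weierstrass theorem. The factor [n] in the exponent forces the limit 0 at s = 1 / 2,
    where the exponent 2 ^ n alone would give 1 / e. *)
Definition stepn (n : nat) (s : R) : R := (1 - s ^+ n) ^+ (n * 2 ^ n).

Lemma stepn_itv n s : 0 <= s <= 1 -> 0 <= stepn n s <= 1.
Proof.
move=> /andP[s0 s1]; have p0 : 0 <= s ^+ n by exact: exprn_ge0.
have p1 : s ^+ n <= 1 by exact: exprn_ile1.
by rewrite /stepn exprn_ge0 ?exprn_ile1 ?subr_ge0//; lra.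
Qed.

Lemma cvg_stepn s : 0 <= s <= 1 -> stepn n s @[n --> \oo] --> ((s < 2^-1)%R%:R : R).
Proof.
move=> s01; have /andP[s0 s1] := s01; have [sh|sh] := ltP s 2^-1.
  apply: (squeeze_cvgr (f := fun n => 1 - n%:R * (2 * s) ^+ n) (h := fun=> 1)).
  - apply: nearW => n; have /andP[_ ->] := stepn_itv n s01; rewrite andbT.
    have p1 : s ^+ n <= 1 by exact: exprn_ile1.
    have := @bernoulli_ineq (- s ^+ n) (n * 2 ^ n); rewrite lerN2 => /(_ p1).
    by apply: le_trans; rewrite natrM natrX exprMn; lra.
  - rewrite -[X in _ --> X](subr0 1); apply: cvgB; first exact: cvg_cst.
    by apply: cvg_mulnX; apply/andP; split; lra.
  - exact: cvg_cst.
apply: (squeeze_cvgr (f := fun=> 0) (h := harmonic)).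
- apply: nearW => n; have /andP[-> _] := stepn_itv n s01; rewrite /=.
  have p1 : s ^+ n <= 1 by exact: exprn_ile1.
  have p0 : 0 <= s ^+ n by exact: exprn_ge0.
  (* Since (1 - s^n) (1 + s^n) <= 1, this lower bound for the power of 1 + s^n bounds [stepn] by 1 /
     (1 + n). *)
  have big : 1 + n%:R <= (1 + s ^+ n) ^+ (n * 2 ^ n).
    apply: le_trans (bernoulli_ineq _ _); last by lra.
    rewrite lerD2l natrM natrX -mulrA ler_peMr// -exprMn; apply: exprn_ege1; lra.
  rewrite /harmonic /= -[leRHS]mul1r ler_pdivlMr// -natr1 addrC.
  apply: le_trans (_ : stepn n s * (1 + s ^+ n) ^+ (n * 2 ^ n) <= _).
    by apply: ler_wpM2l => //; have /andP[] := stepn_itv n s01.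
  rewrite /stepn -exprMn; apply: exprn_ile1; last first.
    by have := sqr_ge0 (s ^+ n); rewrite expr2; lra.
  by rewrite mulr_ge0//; lra.
- exact: cvg_cst.
- exact: cvg_harmonic.
Qed.

Definition fpart (s : R) : R := s - (Num.floor s)%:~R.

Lemma fpart_itv s : 0 <= fpart s < 1.
Proof.
have /andP[] := floor_itv s; rewrite /fpart intrD.
by move=> ? ?; apply/andP; split; lra.
Qed.

Lemma fpart_id s : 0 <= s < 1 -> fpart s = s.
Proof. by move=> s01; rewrite /fpart (@floor_def _ _ 0) ?subr0// add0r. Qed.

Lemma cosD2pin (t : R) (n : nat) : cos (t + 2 * pi * n%:R) = cos t.
Proof.
elim: n => [|n <-]; first by rewrite mulr0 addr0.
have -> : t + 2 * pi * n.+1%:R = t + 2 * pi * n%:R + pi + pi by rewrite -natr1; ring.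
by rewrite !cosDpi opprK.
Qed.

Lemma cosD2pi_int (t : R) (n : int) : cos (t + 2 * pi * n%:~R) = cos t.
Proof.
case: n => n; first exact: cosD2pin.
rewrite -[LHS](cosD2pin _ n.+1); congr cos.
by rewrite NegzE mulrNz -[(n.+1)%:~R]/(n.+1%:R); ring.
Qed.

(* The arcs [c < fpart s] of the circle are level sets of shifted cosines. *)
Lemma fpart_arc (c s : R) : 0 <= c < 1 ->
  (cos (pi * (1 - c)) < cos (2 * pi * (s - (c + 1) / 2))) = (c < fpart s).
Proof.
move=> /andP[c0 c1]; have p0 := pi_gt0 R; have /andP[f0 f1] := fpart_itv s.
have -> : cos (2 * pi * (s - (c + 1) / 2)) = cos (pi * (2 * fpart s - (c + 1))).
  rewrite -[RHS](cosD2pi_int _ (Num.floor s)); congr cos.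
  by rewrite /fpart; field.
move: (fpart s) f0 f1 => u u0 u1.
have inI (t : R) : 0 <= t <= 1 -> pi * t \in `[0, pi].
  by move=> /andP[t0 t1]; rewrite in_itv /= mulr_ge0 ?ler_piMr// ltW.
have cI := inI (1 - c); have {}cI : pi * (1 - c) \in `[0, pi] by apply: cI; lra.
have mono (t : R) : 0 <= t <= 1 ->
    (cos (pi * (1 - c)) < cos (pi * t)) = (t < 1 - c).
  by move=> t01; rewrite (ltr_cos (inI _ t01) cI) ltr_pM2l.
have [h|h] := leP 0 (2 * u - (c + 1)).
  rewrite mono; last by lra.
  by apply/idP/idP; lra.
have -> : cos (pi * (2 * u - (c + 1))) = cos (pi * - (2 * u - (c + 1))).
  by rewrite mulrN cosN.
have [h1|h1] := leP (- (2 * u - (c + 1))) 1.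
  rewrite mono; last by lra.
  by apply/idP/idP; lra.
have -> : cos (pi * - (2 * u - (c + 1))) = cos (pi * (2 + (2 * u - (c + 1)))).
  by rewrite mulrN cosN -[LHS](cosD2pin _ 1); congr cos; ring.
rewrite mono; last by lra.
by apply/idP/idP; lra.
Qed.

End Convergence.

Notation intmx := ((int * int) * (int * int))%type.

(** * Multipliers of the alternating pairing *)

Section Completeness.
Context {R : realType}.
Variables (p q o : R * R).
Hypothesis fdet0 : fdet p q != 0.
Implicit Types (x y z : PT R) (k l : int * int) (w : intmx) (g h m : PT R -> R).

Local Notation fs := (fs p o).
Local Notation ft := (ft q o).
Local Notation ck := (ck p q o).
Local Notation sk := (sk p q o).

Definition wact w y : PT R := (w.1.1%:~R * y.1 + w.1.2%:~R * y.2,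
                               w.2.1%:~R * y.1 + w.2.2%:~R * y.2).
Definition wdet w : int := w.1.1 * w.2.2 - w.1.2 * w.2.1.
(** The transposed action on frequencies: k.(w y) = (kact w k).y. A matrix is the pair of its
    rows. *)
Definition kact w k : int * int := (k.1 * w.1.1 + k.2 * w.2.1, k.1 * w.1.2 + k.2 * w.2.2).
Definition idmx : intmx := ((1, 0), (0, 1)).

Definition sig x : PT R := (fs x, ft x).
Definition anti (W : seq intmx) g x : R := \sum_(w <- W) (wdet w)%:~R * g (wact w (sig x)).
Definition tc k y : R := cos (angk k y.1 y.2).
Definition ts k y : R := sin (angk k y.1 y.2).

Lemma angk_wact k w y : angk k (wact w y).1 (wact w y).2 = angk (kact w k) y.1 y.2.
Proof. by rewrite /angk /wact /kact /= !intrD !intrM; ring. Qed.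

Lemma anti_tc W k x : anti W (tc k) x = \sum_(w <- W) (wdet w)%:~R * ck (kact w k) x.
Proof. by apply: eq_bigr => w _; rewrite /tc angk_wact. Qed.

Lemma anti_ts W k x : anti W (ts k) x = \sum_(w <- W) (wdet w)%:~R * sk (kact w k) x.
Proof. by apply: eq_bigr => w _; rewrite /ts angk_wact. Qed.

Lemma measurable_lin (c d : R) : measurable_fun setT (fun y : PT R => c * y.1 + d * y.2).
Proof. by apply: measurable_funD; apply: measurable_funM. Qed.

Lemma measurable_wact w : measurable_fun setT (wact w).
Proof. by apply/measurable_fun_pairP; split; exact: measurable_lin. Qed.

Lemma measurable_sig : measurable_fun setT sig.
Proof.
by apply/measurable_fun_pairP; split; [exact: measurable_fs|exact: measurable_ft].
Qed.

Lemma bmf_pre (F : PT R -> PT R) g : measurable_fun setT F -> bmf g -> bmf (fun x => g (F x)).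
Proof. by move=> mF [mg [M gM]]; split; [exact: (measurableT_comp mg)|exists M]. Qed.

Lemma bmf_anti W g : bmf g -> bmf (anti W g).
Proof.
move=> bg; apply: bmf_sum => w; apply: bmfZ; apply: bmf_pre bg.
exact: measurableT_comp (measurable_wact w) measurable_sig.
Qed.

Lemma bmf_trig (F : R -> R) k : F = @cos R \/ F = @sin R ->
  bmf (fun y => F (angk k y.1 y.2)).
Proof.
have ma : measurable_fun setT (fun y : PT R => angk k y.1 y.2).
  by apply: measurable_funM => //; exact: measurable_lin.
move=> [->|->].
  apply: (bmf_comp (M := 1)) ma; last exact: cos_max.
  by apply: continuous_measurable_fun; exact: continuous_cos.
apply: (bmf_comp (M := 1)) ma; last exact: sin_max.
by apply: continuous_measurable_fun; exact: continuous_sin.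
Qed.

Lemma bmf_tc k : bmf (tc k). Proof. by apply: bmf_trig; left. Qed.
Lemma bmf_ts k : bmf (ts k). Proof. by apply: bmf_trig; right. Qed.

Variables (Om : set (PT R)) (W : seq intmx) (f : PT R -> R).
Hypotheses (mOm : measurable Om) (fi : leb2.-integrable Om (EFin \o f)).

Definition pairing g : R := \int[leb2]_(x in Om) (f x * anti W g x).

Lemma integrable_pairing g : bmf g -> leb2.-integrable Om (EFin \o (fun x => f x * anti W g x)).
Proof. by move=> /bmf_anti ba; exact: integrable_bmfM. Qed.

Lemma pairingD g h : bmf g -> bmf h -> pairing (fun y => g y + h y) = pairing g + pairing h.
Proof.
move=> bg bh; rewrite /pairing -RintegralD//; [|exact: integrable_pairing..].
apply: eq_Rintegral => x _; rewrite /anti -mulrDr -big_split; congr (_ * _).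
by apply: eq_bigr => w _ /=; rewrite mulrDr.
Qed.

Lemma pairingZ c g : bmf g -> pairing (fun y => c * g y) = c * pairing g.
Proof.
move=> bg; rewrite /pairing -RintegralZl//; last exact: integrable_pairing.
apply: eq_Rintegral => x _; rewrite mulrCA; congr (_ * _); rewrite /anti mulr_sumr.
by apply: eq_bigr => w _; rewrite mulrCA.
Qed.

Lemma pairing_lim (G : nat -> PT R -> R) g M : (forall n, bmf (G n)) -> bmf g ->
  (forall n y, `|G n y| <= M) -> (forall y, G n y @[n --> \oo] --> g y) ->
  (forall n, pairing (G n) = 0) -> pairing g = 0.
Proof.
move=> bG bg GM Gg G0.
have M0 : 0 <= M by apply: le_trans (GM 0%N (0, 0)).
pose c : R := \sum_(w <- W) `|(wdet w)%:~R| * M.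
have aM n x : `|anti W (G n) x| <= c.
  apply: le_trans (ler_norm_sum _ _ _) _; apply: ler_sum => w _.
  by rewrite normrM; apply: ler_wpM2l.
have : pairing (G n) @[n --> \oo] --> pairing g.
  apply: (@Rintegral_dct _ _ _ _ (fun x => c * `|f x|)) => //.
  - by move=> n; apply/measurable_EFinP; exact: measurable_int (integrable_pairing (bG n)).
  - by apply/measurable_EFinP; exact: measurable_int (integrable_pairing bg).
  - move=> x _; apply: cvgMr; rewrite /anti.
    elim: W => [|w r ih].
      by under eq_fun do rewrite big_nil; rewrite big_nil; exact: cvg_cst.
    under eq_fun do rewrite big_cons; rewrite big_cons.
    by apply: cvgD ih; apply: cvgMr; exact: Gg.
  - apply: (integrableZl mOm c (f := fun x => `|f x|%:E)).
    exact: integrable_norm fi.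
  - by move=> n x _; rewrite normrM mulrC; apply: ler_wpM2r.
under eq_fun do rewrite G0.
by move=> /cvg_lim <- //; rewrite lim_cst.
Qed.

(** Antisymmetrization is linear but not multiplicative, so products are taken before it: every
    trigonometric multiple of [g] must pair to zero with [f]. The functions that preserve this
    property form an algebra, and dominated convergence closes it under bounded pointwise limits. *)
Definition nullf g := bmf g /\
  forall k, pairing (fun y => g y * tc k y) = 0 /\ pairing (fun y => g y * ts k y) = 0.
Definition multf m := bmf m /\ forall g, nullf g -> nullf (fun y => m y * g y).

Lemma multf_cst c : multf (fun=> c).
Proof.
split; first exact: bmf_cst.
move=> g [bg g0]; split; first exact: bmfZ.
move=> k; have [c0 s0] := g0 k.
split; under [X in pairing X]eq_fun do rewrite -mulrA; rewrite pairingZ ?c0 ?s0 ?mulr0//.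
  exact: bmfM bg (bmf_tc _).
exact: bmfM bg (bmf_ts _).
Qed.

Lemma multfD m1 m2 : multf m1 -> multf m2 -> multf (fun y => m1 y + m2 y).
Proof.
move=> [b1 h1] [b2 h2]; split; first exact: bmfD.
move=> g ng; have [bg1 g1] := h1 _ ng; have [bg2 g2] := h2 _ ng.
have -> : (fun y => (m1 y + m2 y) * g y) = (fun y => m1 y * g y + m2 y * g y).
  by apply/funext => y; rewrite mulrDl.
split; first exact: bmfD.
move=> k; have [c1 s1] := g1 k; have [c2 s2] := g2 k.
split; under [X in pairing X]eq_fun do rewrite mulrDl.
  by rewrite pairingD ?c1 ?c2 ?addr0//; apply: bmfM => //; exact: bmf_tc.
by rewrite pairingD ?s1 ?s2 ?addr0//; apply: bmfM => //; exact: bmf_ts.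
Qed.

Lemma multfM m1 m2 : multf m1 -> multf m2 -> multf (fun y => m1 y * m2 y).
Proof.
move=> [b1 h1] [b2 h2]; split; first exact: bmfM.
move=> g ng; have -> : (fun y => m1 y * m2 y * g y) = (fun y => m1 y * (m2 y * g y)).
  by apply/funext => y; rewrite mulrA.
by apply: h1; exact: h2.
Qed.

Lemma multfZ c m : multf m -> multf (fun y => c * m y).
Proof. by apply: multfM; exact: multf_cst. Qed.

Lemma multfX m n : multf m -> multf (fun y => m y ^+ n).
Proof.
move=> hm; elim: n => [|n ih]; first exact: multf_cst.
by under eq_fun do rewrite exprS; exact: multfM.
Qed.

Lemma multf_lim (G : nat -> PT R -> R) m M : (forall n, multf (G n)) -> bmf m ->
  (forall n y, `|G n y| <= M) -> (forall y, G n y @[n --> \oo] --> m y) -> multf m.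
Proof.
move=> hG bm GM Gm; split=> // g [bg g0]; split; first exact: bmfM.
have [mg [N gN]] := bg.
have main (T : PT R -> R) : bmf T -> (forall y, `|T y| <= 1) ->
    (forall n, pairing (fun y => G n y * g y * T y) = 0) ->
    pairing (fun y => m y * g y * T y) = 0.
  move=> bT T1 h0; apply: (@pairing_lim (fun n y => G n y * g y * T y) _ (M * N * 1)) => //.
  - by move=> n; apply: bmfM bT; apply: bmfM bg; case: (hG n).
  - by apply: bmfM bT; exact: bmfM.
  - by move=> n y; rewrite !normrM; apply: ler_pM => //; apply: ler_pM.
  - by move=> y; apply: cvgMl; apply: cvgMl.
move=> k; split; apply: main.
- exact: bmf_tc.
- by move=> y; exact: cos_max.
- by move=> n; have [_ /(_ g (conj bg g0))[_ /(_ k)[]]] := hG n.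
- exact: bmf_ts.
- by move=> y; exact: sin_max.
- by move=> n; have [_ /(_ g (conj bg g0))[_ /(_ k)[]]] := hG n.
Qed.

(** Product-to-sum formulas rewrite a product of frequencies j and k as a combination of the
    frequencies j + k and j - k. *)
Lemma multf_trig j : multf (tc j) /\ multf (ts j).
Proof.
have half g k (e1 e2 : R) T : nullf g -> bmf T ->
    (exists T1 T2, [/\ T1 = tc (j + k) \/ T1 = ts (j + k), T2 = tc (j - k) \/ T2 = ts (j - k) &
      forall y, T y = e1 * T1 y + e2 * T2 y]) ->
    pairing (fun y => g y * T y) = 0.
  move=> [bg g0] bT [T1 [T2 [h1 h2 TE]]].
  have b1 : bmf T1 by case: h1 => ->; [exact: bmf_tc|exact: bmf_ts].
  have b2 : bmf T2 by case: h2 => ->; [exact: bmf_tc|exact: bmf_ts].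
  have -> : (fun y => g y * T y) = (fun y => e1 * (g y * T1 y) + e2 * (g y * T2 y)).
    by apply/funext => y; rewrite TE; ring.
  rewrite pairingD; [|exact: bmfZ (bmfM bg b1)|exact: bmfZ (bmfM bg b2)].
  rewrite !pairingZ; [|exact: bmfM bg b2|exact: bmfM bg b1].
  have [c1 s1] := g0 (j + k); have [c2 s2] := g0 (j - k).
  by case: h1 => ->; case: h2 => ->; rewrite ?c1 ?s1 ?c2 ?s2 !mulr0 addr0.
have angD k y : angk (j + k) y.1 y.2 = angk j y.1 y.2 + angk k y.1 y.2.
  by rewrite /angk /= !intrD; ring.
have angB k y : angk (j - k) y.1 y.2 = angk j y.1 y.2 - angk k y.1 y.2.
  by rewrite /angk /= !intrB; ring.
split; split; [exact: bmf_tc| |exact: bmf_ts|] => g ng; have [bg g0] := ng.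
- split; first exact: bmfM (bmf_tc _) bg.
  move=> k; split; under [X in pairing X]eq_fun do rewrite [_ * g _]mulrC -mulrA.
  + apply: (half g k 2^-1 2^-1) => //; first exact: bmfM (bmf_tc _) (bmf_tc _).
    exists (tc (j + k)), (tc (j - k)); split; [by left|by left|move=> y].
    by rewrite /tc angD angB cosD cosB; field.
  + apply: (half g k 2^-1 (- 2^-1)) => //; first exact: bmfM (bmf_tc _) (bmf_ts _).
    exists (ts (j + k)), (ts (j - k)); split; [by right|by right|move=> y].
    by rewrite /tc /ts angD angB sinD sinB; field.
- split; first exact: bmfM (bmf_ts _) bg.
  move=> k; split; under [X in pairing X]eq_fun do rewrite [_ * g _]mulrC -mulrA.
  + apply: (half g k 2^-1 2^-1) => //; first exact: bmfM (bmf_ts _) (bmf_tc _).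
    exists (ts (j + k)), (ts (j - k)); split; [by right|by right|move=> y].
    by rewrite /tc /ts angD angB sinD sinB; field.
  + apply: (half g k (- 2^-1) 2^-1) => //; first exact: bmfM (bmf_ts _) (bmf_ts _).
    exists (tc (j + k)), (tc (j - k)); split; [by left|by left|move=> y].
    by rewrite /tc /ts angD angB cosD cosB; field.
Qed.

Definition multset (A : set (PT R)) := measurable A /\ multf \1_A.

Lemma multset_level m c : multf m -> (forall y, `|m y| <= 1) -> -1 <= c <= 1 ->
  multset [set y | c < m y].
Proof.
move=> hm m1 c1; have [[mm _] _] := hm.
have mA : measurable [set y | c < m y].
  rewrite (_ : mkset _ = setT `&` m @^-1` `]c, +oo[%classic); first exact: mm.
  by apply/seteqP; split => y /=; rewrite in_itv /= andbT; [split|case].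
(* As |m - c| <= 2, the values of [s] lie in [0, 1], and s < 1 / 2 exactly when c < m. Hence
   [stepn n] of [s], a polynomial in [m], tends to the indicator. *)
split=> //; pose s y := 2^-1 - (m y - c) / 4.
have s01 y : 0 <= s y <= 1.
  by have := m1 y; rewrite ler_norml /s; move: c1 => /andP[? ?] /andP[? ?]; apply/andP; split; lra.
apply: (@multf_lim (fun n y => stepn n (s y)) _ 1).
- move=> n; rewrite /stepn; apply: multfX.
  apply: multfD; first exact: multf_cst.
  under eq_fun do rewrite -mulN1r; apply: multfZ; apply: multfX.
  rewrite (_ : s = fun y => 2^-1 + c / 4 + (- 4^-1) * m y).
    by apply: multfD; [exact: multf_cst|exact: multfZ].
  by apply/funext => y; rewrite /s; field.
- exact: bmf_indic.
- by move=> n y; have /andP[? ?] := stepn_itv n (s01 y); rewrite ger0_norm.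
- move=> y; have -> : \1_[set y0 | c < m y0] y = ((s y < 2^-1)%R%:R : R).
    rewrite indicE; suff -> : (y \in [set y0 | c < m y0]) = (s y < 2^-1) by [].
    by apply/idP/idP => [/set_mem /=|h]; [|apply/mem_set => /=; move: h]; rewrite /s; lra.
  exact: cvg_stepn.
Qed.

Lemma multsetC A : multset A -> multset (~` A).
Proof.
move=> [mA hA]; split; first exact: measurableC.
have -> : \1_(~` A) = (fun y => 1 + (-1) * \1_A y) :> (PT R -> R).
  apply/funext => y; rewrite !indicE in_setC.
  by case: (y \in A) => /=; ring.
by apply: multfD; [exact: multf_cst|exact: multfZ].
Qed.

Lemma multsetI A B : multset A -> multset B -> multset (A `&` B).
Proof.
move=> [mA hA] [mB hB]; split; first exact: measurableI.
by rewrite indicI; exact: multfM.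
Qed.

Lemma multsetT : multset setT.
Proof.
split; first exact: measurableT.
have -> : \1_setT = (fun=> 1) :> (PT R -> R) by apply/funext => y; rewrite indicT.
exact: multf_cst.
Qed.

Lemma multset_bigcap (A : nat -> set (PT R)) : (forall n, multset (A n)) ->
  multset (\bigcap_n A n).
Proof.
move=> hA; have mA : measurable (\bigcap_n A n).
  by apply: bigcapT_measurable => n; case: (hA n).
split=> //; pose B n := \big[setI/setT]_(i < n) A i.
have hB n : multset (B n).
  rewrite /B; elim: n => [|n ih]; first by rewrite big_ord0; exact: multsetT.
  by rewrite big_ord_recr; exact: multsetI.
apply: (@multf_lim (fun n => \1_(B n)) _ 1).
- by move=> n; case: (hB n).
- exact: bmf_indic.
- by move=> n y; rewrite indicE; case: (_ \in _); rewrite ?normr1 ?normr0.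
- move=> y; apply: cvg_near_cst; rewrite indicE.
  have BP n : B n y <-> forall i, (i < n)%N -> A i y.
    elim: n => [|n ih]; rewrite /B ?big_ord0 ?big_ord_recr//=; split=> [[/ih hn An] i|h].
      by rewrite ltnS leq_eqVlt => /orP[/eqP ->|/hn].
    by split; [apply/ih => i ni; apply: h; exact: ltnW|exact: h].
  have [yA|/existsNP[i iA]] := pselect (forall i, A i y).
    have yb : (\bigcap_n A n) y by move=> i _; exact: yA.
    rewrite (mem_set yb); exists 0%N => // n _ /=.
    have yn : B n y by apply/BP.
    by rewrite indicE (mem_set yn).
  have yb : ~ (\bigcap_n A n) y by move=> h; apply: iA; exact: h.
  rewrite (memNset yb).
  exists i.+1 => // n /= ni.
  have yn : ~ B n y by move/BP/(_ i ni).
  by rewrite indicE (memNset yn).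
Qed.

(** The sets [C] with this property form a sigma-algebra, so rays suffice. For a ray, [fpart_arc]
    turns the condition into a level set of a shifted cosine, which is a multiplier. *)
Lemma multset_frac (i : bool) (C : set (measurableTypeR R)) : measurable C ->
  multset [set y : PT R | C (fpart (if i then y.1 else y.2 : R))].
Proof.
pose cor (y : PT R) : R := if i then y.1 else y.2.
pose G := [set C : set (measurableTypeR R) | multset [set y | C (fpart (cor y))]].
have sG : sigma_algebra setT G.
  split.
  - rewrite /G /= (_ : mkset _ = ~` setT); last by rewrite setCT.
    by apply: multsetC; exact: multsetT.
  - by move=> A hA; rewrite /G setTD; exact: multsetC.
  - move=> A hA; rewrite /G /= (_ : mkset _ = ~` \bigcap_n ~` [set y | A n (fpart (cor y))]).
      by apply: multsetC; apply: multset_bigcap => n; apply: multsetC; exact: hA.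
    apply/seteqP; split => y /=; first by move=> [n _ Any] h; exact: h n I Any.
    by move=> /existsNP[n /not_implyP[_ /contrapT h]]; exists n.
rewrite (RGenOInfty.measurableE R) => mC.
apply: (smallest_sub sG _ mC) => _ [c ->]; rewrite /G /=.
have -> : [set y | `]c, +oo[%classic (fpart (cor y))] = [set y | c < fpart (cor y)].
  by apply/seteqP; split => y /=; rewrite in_itv /= andbT.
have [c0|c0] := ltP c 0.
  rewrite (_ : mkset _ = setT); first exact: multsetT.
  apply/seteqP; split => // y _ /=; apply: lt_le_trans c0 _.
  by have /andP[] := fpart_itv (cor y).
have [c1|c1] := leP 1 c.
  rewrite (_ : mkset _ = ~` setT); first by apply: multsetC; exact: multsetT.
  rewrite setCT; apply/seteqP; split => // y /= h.
  by have /andP[_] := fpart_itv (cor y); rewrite ltNge => /negP; apply; apply: le_trans c1 (ltW h).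
have c01 : 0 <= c < 1 by rewrite c0 c1.
pose j : int * int := if i then (1, 0) else (0, 1).
pose b : R := 2 * pi * ((c + 1) / 2).
pose m y := cos b * tc j y + sin b * ts j y.
have mE y : m y = cos (2 * pi * (cor y - (c + 1) / 2)).
  rewrite mulrBr cosB -/b /m /tc /ts; have -> : angk j y.1 y.2 = 2 * pi * cor y.
    by rewrite /angk /j /cor; case: (i) => /=; ring.
  by ring.
have -> : [set y | c < fpart (cor y)] = [set y | cos (pi * (1 - c)) < m y].
  by apply/seteqP; split => y /=; rewrite mE fpart_arc.
apply: multset_level.
- by have [h1 h2] := multf_trig j; apply: multfD; exact: multfZ.
- by move=> y; rewrite mE; exact: cos_max.
- by rewrite cos_geN1 cos_le1.
Qed.

Lemma multset_fracs (C : set (PT R)) : measurable C ->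
  multset [set y : PT R | C (fpart (y.1 : R), fpart (y.2 : R))].
Proof.
pose G := [set C : set (PT R) | multset [set y : PT R | C (fpart (y.1 : R), fpart (y.2 : R))]].
have sG : sigma_algebra setT G.
  split.
  - rewrite /G /= (_ : mkset _ = ~` setT); last by rewrite setCT.
    by apply: multsetC; exact: multsetT.
  - by move=> A hA; rewrite /G setTD; exact: multsetC.
  - move=> A hA; rewrite /G /= (_ : mkset _ = ~` \bigcap_n ~` [set y | A n (fpart y.1, fpart y.2)]).
      by apply: multsetC; apply: multset_bigcap => n; apply: multsetC; exact: hA.
    apply/seteqP; split => y /=; first by move=> [n _ Any] h; exact: h n I Any.
    by move=> /existsNP[n /not_implyP[_ /contrapT h]]; exists n.
rewrite measurable_prod_measurableType => mC.
apply: (smallest_sub sG _ mC) => _ [A mA [B mB <-]]; rewrite /G /=.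
exact: multsetI (multset_frac true mA) (multset_frac false mB).
Qed.

Hypothesis uW : uniq W.
Hypothesis idW : idmx \in W.
Hypothesis OmP : forall x, Om x -> 0 <= fs x < 1 /\ 0 <= ft x < 1.
(* No two distinct points of [Om] are equivalent under [W] and integer translations. *)
Hypothesis fund : forall w x x' (n : int * int), w \in W -> Om x -> Om x' ->
  (wact w (sig x)).1 = fs x' + n.1%:~R -> (wact w (sig x)).2 = ft x' + n.2%:~R -> w = idmx.
Hypothesis f0 : forall k,
  \int[leb2]_(x in Om) (f x * \sum_(w <- W) (wdet w)%:~R * ck (kact w k) x) = 0 /\
  \int[leb2]_(x in Om) (f x * \sum_(w <- W) (wdet w)%:~R * sk (kact w k) x) = 0.

Lemma nullf1 : nullf (fun=> 1).
Proof.
split; first exact: bmf_cst.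
move=> k; have [c0 s0] := f0 k; split.
  rewrite -[RHS]c0; apply: eq_Rintegral => x _; congr (_ * _).
  by rewrite -anti_tc; apply: eq_bigr => w _; rewrite mul1r.
rewrite -[RHS]s0; apply: eq_Rintegral => x _; congr (_ * _).
by rewrite -anti_ts; apply: eq_bigr => w _; rewrite mul1r.
Qed.

(** The points whose fractional parts lie in the chart image of E form a multiplier set, so its
    indicator pairs to zero with [f]. At a point of [Om] only the identity term of the alternating
    sum survives, by [fund], and that term is the indicator of E. *)
Lemma Rintegral_null (E : set (PT R)) : measurable E -> E `<=` Om ->
  \int[leb2]_(x in E) f x = 0.
Proof.
move=> mE EOm.
pose inv (y : PT R) : PT R := (((y.1 - o.1) * q.2 - (y.2 - o.2) * p.2) / fdet p q,
                               ((y.2 - o.2) * p.1 - (y.1 - o.1) * q.1) / fdet p q).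
have minv : measurable_fun setT inv.
  apply/measurable_fun_pairP; split; rewrite /inv /comp /=;
    apply: measurable_funM => //; apply: measurable_funB; apply: measurable_funM => //;
    exact: measurable_funB.
have mC : measurable (inv @^-1` E).
  by rewrite -[X in measurable X]setTI; exact: minv.
have [_ hg] := multset_fracs mC; set g := \1_ _ in hg.
have ng : nullf g.
  have := hg.2 _ nullf1; congr nullf; apply/funext => y; exact: mulr1.
have [c0 _] := ng.2 0.
rewrite -(Rintegral_indicM _ mOm EOm) -[RHS]c0; apply: eq_Rintegral => x /set_mem Omx.
rewrite mulrC; congr (_ * _).
have invE z : inv (sig z) = z by rewrite /inv /sig /= -(frameE o fdet0).
have fracE z : Om z -> (fpart (fs z), fpart (ft z)) = sig z.
  by move=> /OmP[h1 h2]; rewrite /sig !fpart_id.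
have tc0 y : tc 0 y = 1 by rewrite /tc /angk !mul0r addr0 mulr0 cos0.
rewrite /anti (bigD1_seq idmx)//= big1_seq ?addr0.
  have -> : wact idmx (sig x) = sig x.
    by rewrite /wact /sig /=; congr pair; ring.
  rewrite tc0 mulr1 (_ : wdet idmx = 1)// mul1r /g !indicE.
  suff -> : (sig x \in [set y : PT R | (inv @^-1` E) (fpart (y.1 : R), fpart (y.2 : R))]) =
    (x \in E) by [].
  have xx : inv (fpart (sig x).1, fpart (sig x).2) = x by rewrite /= fracE.
  by apply/idP/idP => /set_mem h; apply/mem_set; move: h; rewrite /= xx.
move=> w /andP[wid wW]; rewrite tc0 mulr1 /g indicE memNset ?mulr0//= => h.
set u := fpart _ in h; set v := fpart _ in h.
case/negP: wid; apply/eqP.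
have sigi : fs (inv (u, v)) = u /\ ft (inv (u, v)) = v.
  by move: fdet0; rewrite /Submission.fs /Submission.ft /inv /fdet /= => h0; split; field.
apply: (fund (n := (Num.floor (wact w (sig x)).1, Num.floor (wact w (sig x)).2)) wW Omx (EOm _ h)).
  by rewrite sigi.1 /u /fpart /= subrK.
by rewrite sigi.2 /v /fpart /= subrK.
Qed.

Lemma ae_null : ae_eq leb2 Om (EFin \o f) (cst 0%E).
Proof.
apply: integral_ae_eq => //.
move=> E EOm mE; rewrite integral0.
have := Rintegral_null mE EOm; rewrite /Rintegral => /eqP.
have iE : leb2.-integrable E (EFin \o f) by exact: integrableS mOm mE EOm fi.
have := integrable_fin_num mE iE; case: (\int[leb2]_(x in E) _)%E => // r _ /=.
by move=> /eqP ->.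
Qed.

End Completeness.

(** * Smooth trigonometric and flat functions *)

Section Smooth.
Context {R : realType}.

(** The powers of 1 / t are included so that the linear span of the family is closed under
    differentiation. *)
Definition flat (n : nat) (t : R) : R := if 0 < t then t^-1 ^+ n * expR (- t^-1) else 0.

Lemma flat_ge0 n t : 0 <= flat n t.
Proof.
rewrite /flat; case: ifPn => // t0.
by rewrite mulr_ge0 ?expR_ge0// exprn_ge0// invr_ge0 ltW.
Qed.

Lemma flat_le n m t : flat n t <= (n + m).+1`!%:R * `|t| ^+ m.+1.
Proof.
rewrite /flat; case: ifPn => [t0|_]; last by rewrite mulr_ge0 ?exprn_ge0.
have u0 : 0 < t^-1 by rewrite invr_gt0.
rewrite gtr0_norm// expRN ler_pdivrMr ?expR_gt0//.
have f0 : 0 < (n + m).+1`!%:R :> R by rewrite ltr0n fact_gt0.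
have := @expR_ge1Dxn _ (t^-1) (n + m) (ltW u0).
set E := expR _ => h; have {}h : t^-1 ^+ (n + m).+1 <= (n + m).+1`!%:R * E.
  by rewrite -ler_pdivrMl// mulrC; lra.
rewrite mulrAC -ler_pdivrMr ?exprn_gt0//; apply: le_trans h.
by rewrite -exprVn -exprD addnS.
Qed.

(** At 0 the quadratic bound from [flat_le] sends the difference quotient to 0; elsewhere the
    function is locally zero or elementary. *)
Lemma is_derive_flat n (t : R) : is_derive t (1 : R) (flat n) (flat n.+2 t - n%:R * flat n.+1 t).
Proof.
have [t0|t0|t0] := ltgtP 0 t; last first.
- rewrite -t0; have [d0 d1] : derivable (flat n) 0 1 /\ 'D_1 (flat n) 0 = 0.
    have cv : h^-1 *: (flat n (h *: 1 + 0) - flat n 0) @[h --> 0^'] --> (0 : R).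
      pose C : R := (n + 1).+1`!%:R.
      have zero k : flat k 0 = 0 :> R by rewrite /flat ltxx.
      apply: norm_cvg0; apply: (squeeze_cvgr (f := fun=> 0) (h := fun h : R => C * `|h|)).
      + near=> h; have h0 : h != 0 by near: h; exact: nbhs_dnbhs_neq.
        rewrite normr_ge0 /= zero subr0 addr0 /GRing.scale /= mulr1 normrM.
        rewrite (ger0_norm (flat_ge0 _ _)) normfV ler_pdivrMl ?normr_gt0//.
        by apply: le_trans (flat_le n 1 h) _; rewrite -/C expr2 mulrCA.
      + exact: cvg_cst.
      + rewrite -[X in _ --> X](mulr0 C); apply: cvgMr.
        rewrite -[X in _ --> X](@normr0 _ R); apply: cvg_norm.
        exact: cvg_within.
    by split; [apply/cvg_ex; exists 0|exact: cvg_lim cv].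
  rewrite /flat ltxx mulr0 subr0; apply: DeriveDef => //.
- apply: (@near_eq_is_derive _ _ _ (cst 0)).
    near=> u; rewrite /flat ifF//; apply/negbTE; rewrite -leNgt ltW//.
    by near: u; exact: (lt_nbhsl t0).
  have zero k : flat k t = 0 by rewrite /flat ifF//; apply/negbTE; rewrite -leNgt ltW.
  by rewrite !zero mulr0 subr0; exact: is_derive_cst.
- apply: (@near_eq_is_derive _ _ _ (fun u : R => u^-1 ^+ n * expR (- u^-1) : R)).
    near=> u; rewrite /flat ifT//.
    by near: u; exact: lt_nbhsr.
  have tn : t != 0 by rewrite gt_eqF.
  have dV : is_derive t 1 (fun u : R => u^-1) (- t ^- 2).
    by have := @is_deriveV R id t 1 1 tn (is_derive_id _ _); rewrite scaler1.
  have dX : is_derive t 1 (fun u : R => u^-1 ^+ n) ((n%:R * t^-1 ^+ n.-1) * - t ^- 2).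
    have -> : (fun u : R => u^-1 ^+ n) = (fun u : R => u^-1) ^+ n by rewrite exprfctE.
    exact: (@is_deriveX _ _ (fun u : R => u^-1) n t 1 _ dV).
  have dE : is_derive t 1 (fun u : R => expR (- u^-1)) (expR (- t^-1) * t ^- 2).
    have dN : is_derive t 1 (fun u : R => - u^-1) (t ^- 2).
      by have := is_deriveN dV; rewrite opprK.
    exact: (@is_derive1_comp _ expR (fun u => - u^-1) t _ _ (is_derive_expR _) dN).
  have -> : (fun u : R => u^-1 ^+ n * expR (- u^-1)) =
    (fun u : R => u^-1 ^+ n) * (fun u : R => expR (- u^-1)) by [].
  apply: (is_derive_eq (is_deriveM dX dE)).
  have tV2 : t ^- 2 = t^-1 * t^-1 by rewrite -exprVn expr2.
  rewrite /flat t0 /GRing.scale /= tV2 !exprS; case: n {dX} => [|n] /=.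
    by rewrite expr0; ring.
  by rewrite exprS; ring.
Unshelve. all: by end_near. Qed.

Definition aff (l : (R * R) * R) (x : plane R) : R := l.1.1 * x.1 + l.1.2 * x.2 + l.2.
Definition lin (v : R * R) (x : plane R) : R := v.1 * x.1 + v.2 * x.2.

Lemma diff_aff l (x : plane R) :
  differentiable (aff l : plane R -> R^o) x /\ 'd (aff l : plane R -> R^o) x = lin l.1 :> (_ -> _).
Proof.
have lin_is : linear (lin l.1 : plane R -> R^o).
  by move=> c u v; rewrite /lin /GRing.scale /=; rewrite /GRing.scale /=; ring.
pose L := HB.pack_for {linear plane R -> R^o} (lin l.1 : plane R -> R^o)
  (GRing.isLinear.Build _ _ _ _ _ lin_is).
have cL : continuous L.
  move=> y; apply: cvgD; apply: cvgMr; [exact: cvg_fst|exact: cvg_snd].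
have dL : is_diff x (L : plane R -> R^o) L.
  by apply: DiffDef; [exact: linear_differentiable|exact: diff_lin].
have dA : is_diff x (aff l : plane R -> R^o) L.
  have -> : (aff l : plane R -> R^o) = (L : plane R -> R^o) + cst (l.2 : R^o) by [].
  by apply: (is_diff_eq (is_diffD dL (is_diff_cst (l.2 : R^o) x))); rewrite addr0.
by split; [exact: ex_diff|rewrite diff_val].
Qed.

Lemma diff_comp_aff (F : R -> R) (dF : R) l (x v : plane R) : is_derive (aff l x) 1 F dF ->
  differentiable (fun y => F (aff l y)) x /\ 'D_v (fun y => F (aff l y)) x = dF * lin l.1 v.
Proof.
move=> [dF1 dF2]; have [da dE] := diff_aff l x.
have dF' : differentiable (F : R^o -> R^o) (aff l x) by exact/derivable1_diffP.
have dc : differentiable (fun y => F (aff l y)) x.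
  exact: (differentiable_comp da dF').
split=> //; rewrite deriveE// -[X in 'd X x](_ : (F : R^o -> R^o) \o aff l = _)//.
by rewrite diff_comp//= dE diff1E//= derive1E dF2 mulrC.
Qed.

(* An algebra of functions closed under directional derivatives, in which smoothness
   can be read off. *)
Inductive SM : (plane R -> R) -> Prop :=
| SM_cst c : SM (fun=> c)
| SM_cos l : SM (fun x => cos (aff l x))
| SM_sin l : SM (fun x => sin (aff l x))
| SM_flat n l : SM (fun x => flat n (aff l x))
| SM_add f g : SM f -> SM g -> SM (fun x => f x + g x)
| SM_mul f g : SM f -> SM g -> SM (fun x => f x * g x).

Lemma SM_scale c f : SM f -> SM (fun x => c * f x).
Proof. by move=> hf; apply: SM_mul hf; exact: SM_cst. Qed.

Lemma SM_sum (I : Type) (r : seq I) (F : I -> plane R -> R) : (forall i, SM (F i)) ->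
  SM (fun x => \sum_(i <- r) F i x).
Proof.
move=> hF; elim: r => [|i r ih]; first by under eq_fun do rewrite big_nil; exact: SM_cst.
by under eq_fun do rewrite big_cons; exact: SM_add.
Qed.

Lemma SM_diff_derive f : SM f -> (forall x, differentiable f x) /\
  forall v, exists2 g, SM g & forall x, 'D_v f x = g x.
Proof.
elim=> {f} [c|l|l|n l|f g _ [df Df] _ [dg Dg]|f g hf [df Df] hg [dg Dg]].
- split=> [x|v]; first exact: differentiable_cst.
  by exists (fun=> 0); [exact: SM_cst|move=> x; exact: derive_cst].
- split=> [x|v]; first by have [] := diff_comp_aff x (is_derive_cos (aff l x)).
  exists (fun x => lin l.1 v * (- 1 * sin (aff l x))).
    by do 2 apply: SM_scale; exact: SM_sin.
  by move=> x; have [_ ->] := diff_comp_aff v (is_derive_cos (aff l x)); ring.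
- split=> [x|v]; first by have [] := diff_comp_aff x (is_derive_sin (aff l x)).
  exists (fun x => lin l.1 v * cos (aff l x)); first by apply: SM_scale; exact: SM_cos.
  by move=> x; have [_ ->] := diff_comp_aff v (is_derive_sin (aff l x)); ring.
- split=> [x|v]; first by have [] := diff_comp_aff x (is_derive_flat n (aff l x)).
  exists (fun x => lin l.1 v * (flat n.+2 (aff l x) + - n%:R * flat n.+1 (aff l x))).
    by apply: SM_scale; apply: SM_add; [exact: SM_flat|apply: SM_scale; exact: SM_flat].
  by move=> x; have [_ ->] := diff_comp_aff v (is_derive_flat n (aff l x)); ring.
- split=> [x|v]; first exact: differentiableD.
  have [f' hf' f'E] := Df v; have [g' hg' g'E] := Dg v.
  exists (fun x => f' x + g' x); first exact: SM_add.
  by move=> x; rewrite -f'E -g'E; apply: deriveD; exact: diff_derivable.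
- split=> [x|v]; first exact: differentiableM.
  have [f' hf' f'E] := Df v; have [g' hg' g'E] := Dg v.
  exists (fun x => f x * g' x + g x * f' x); first by apply: SM_add; apply: SM_mul.
  by move=> x; rewrite -f'E -g'E; apply: deriveM; exact: diff_derivable.
Qed.

Lemma SM_smooth f : SM f -> smooth f.
Proof.
move=> hf s x; suff /SM_diff_derive[] : SM (foldr (fun b k => fun y =>
  'D_(if b then e1 else e2) k y) f s) by [].
elim: s => [//|b s /SM_diff_derive[_ /(_ (if b then e1 else e2))[g hg gE]]] /=.
by rewrite (_ : (fun y => _) = g)//; apply/funext.
Qed.

End Smooth.

(** * Weak derivatives and the Dirichlet form *)

Section Parts.
Context {R : realType}.
Implicit Types (f g : plane R -> R) (x v : plane R) (Om K : set (plane R)).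

Definition sq (M : R) : set (plane R) := [set x | `|x.1| <= M /\ `|x.2| <= M].

Lemma sqE (M : R) : sq M = `[- M, M]%classic `*` `[- M, M]%classic.
Proof. by apply/seteqP; split => x; rewrite /sq /= !in_itv /= !ler_norml. Qed.

Lemma compact_sq (M : R) : compact (sq M).
Proof. by rewrite sqE; apply: compact_setX; exact: segment_compact. Qed.

Lemma measurable_sq (M : R) : measurable (sq M : set (PT R)).
Proof. by rewrite sqE; exact: measurableX. Qed.

Lemma leb2_sq (M : R) : (leb2 (sq M) < +oo)%E.
Proof.
rewrite sqE [X in (X < _)%E](_ : _ = (lebesgue_measure (`[(- M)%R, M]%classic : set R) *
  lebesgue_measure (`[(- M)%R, M]%classic : set R))%E); last exact: product_measure1E.
rewrite lebesgue_measure_itv /=.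
by case: ifP => _; rewrite ?mule0// -EFinD -EFinM ltry.
Qed.

Lemma compact_sub_sq K : compact K -> exists M, K `<=` sq M.
Proof.
move=> /compact_bounded[M [_ hM]]; exists (M + 1) => x /hM h.
have {h} : `|x| <= M + 1 by apply: h; rewrite ltrDl.
by rewrite /sq /= prod_normE ge_max => /andP[].
Qed.

Lemma continuous_bounded_supp f M : continuous f -> (forall x, ~ sq M x -> f x = 0) ->
  exists2 C, 0 <= C & forall x, `|f x| <= C.
Proof.
move=> cf f0; have /compact_bounded[C [_ hC]] : compact [set f x | x in sq M].
  by apply: continuous_compact (@compact_sq M); exact: continuous_subspaceT.
exists `|C + 1| => // x; have [xM|/f0 ->] := pselect (sq M x); last by rewrite normr0.
by apply: le_trans (ler_norm _); apply: hC; [rewrite ltrDl|exists x].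
Qed.

Lemma differentiable_is_derive_line f x v (t : R) : (forall y, differentiable f y) ->
  is_derive t (1 : R) (fun s : R => f (s *: v + x)) ('D_v f (t *: v + x)).
Proof.
move=> df; have dv : derivable f (t *: v + x) v by exact: diff_derivable.
have E : (fun h : R => h^-1 *: (((fun s : R => f (s *: v + x)) \o shift t) (h *: (1 : R)) -
    f (t *: v + x))) = (fun h => h^-1 *: ((f \o shift (t *: v + x)) (h *: v) - f (t *: v + x))).
  apply/funext => h; rewrite /= /shift /=; congr (_ *: (f _ - _)).
  by rewrite scalerDl addrA /GRing.scale /= mulr1.
apply: DeriveDef; first by rewrite /derivable E.
by rewrite /derive E.
Qed.

Lemma difference_quotient_bound f x v C (h : R) : (forall y, differentiable f y) ->
  (forall y, `|'D_v f y| <= C) -> 0 < h -> `|h^-1 * (f (h *: v + x) - f x)| <= C.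
Proof.
move=> df fC h0; pose g (s : R) := f (s *: v + x).
have dg (t : R) : is_derive t (1 : R) g ('D_v f (t *: v + x)).
  exact: differentiable_is_derive_line.
have cg : {within `[0, h], continuous g}.
  apply: continuous_subspaceT => t; apply: differentiable_continuous.
  by apply/derivable1_diffP; exact: ex_derive.
have [t _] := MVT_segment (ltW h0) (fun t _ => dg t) cg.
rewrite /g scale0r add0r subr0 => ->.
by rewrite mulrCA mulVf ?mulr1 ?gt_eqF.
Qed.

Lemma diff_continuousT f : (forall y, differentiable f y) -> continuous f.
Proof. by move=> df y; exact: differentiable_continuous. Qed.

(* The integral of a difference quotient vanishes by translation invariance. *)
Lemma Rintegral_derive0 f v M : (forall y, differentiable f y) ->
  continuous (fun y => 'D_v f y) -> `|v.1| <= 1 -> `|v.2| <= 1 ->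
  (forall x, ~ sq M x -> f x = 0) -> (forall x, ~ sq M x -> 'D_v f x = 0) ->
  \int[leb2]_(x in setT) 'D_v f x = 0.
Proof.
move=> df cD v1 v2 f0 Df0; have cf := diff_continuousT df.
have [C C0 hC] := continuous_bounded_supp cD Df0.
have [Cf Cf0 hCf] := continuous_bounded_supp cf f0.
have mf := continuous_plane_measurable cf; have mD := continuous_plane_measurable cD.
have bf : bmf (f : PT R -> R) by split=> //; exists Cf.
pose hn n : R := n.+1%:R^-1.
have hn0 n : 0 < hn n by rewrite invr_gt0.
have hn1 n : hn n <= 1 by rewrite invf_le1// ler1n.
pose dir n : R * R := (hn n * v.1, hn n * v.2).
pose F n (x : PT R) : R := (hn n)^-1 * (f (shift2 (dir n) x) - f x).
have FE n (x : PT R) : F n x = (hn n)^-1 * (f (hn n *: v + x) - f x).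
  rewrite /F; congr (_ * (f _ - _)); case: x => a b.
  by rewrite /shift2 /dir /=; congr pair; rewrite addrC.
have mF n : measurable_fun setT (F n).
  apply: measurable_funM => //; apply: measurable_funB => //.
  by apply: (measurableT_comp mf); exact: measurable_shift2.
have iF0 : leb2.-integrable setT (EFin \o (f : PT R -> R)).
  have -> : EFin \o f = (EFin \o f) \_ (sq M) :> (PT R -> \bar R).
    apply/funext => x; rewrite patchE; case: ifPn => // /negP h.
    by rewrite /= f0// => /mem_set.
  by apply/(integrable_mkcond _ (measurable_sq M)); apply: bmf_integrable => //;
    [exact: measurable_sq|exact: leb2_sq].
have IF n : \int[leb2]_(x in setT) F n x = 0.
  have sT : shift2 (dir n) @^-1` setT = setT by [].
  have mEf : measurable_fun setT (EFin \o (f : PT R -> R)) by apply/measurable_EFinP.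
  have iS := integrable_shift (dir n) measurableT mEf iF0; rewrite sT in iS.
  rewrite RintegralZl//; last exact: (integrableB measurableT iS iF0).
  rewrite RintegralB//.
  have := Rintegral_shift (dir n) measurableT mf iF0; rewrite sT => ->.
  by rewrite subrr mulr0.
have cv : \int[leb2]_(x in setT) F n x @[n --> \oo] --> \int[leb2]_(x in setT) 'D_v f x.
  (* The shifts move each coordinate by at most 1, so all difference quotients vanish off
     [sq (M + 1)], and the mean value theorem bounds them by [C]. *)
  apply: (@Rintegral_dct _ _ _ _ (fun x => C * \1_(sq (M + 1)) x)) => //.
  - move=> x _; under eq_fun do rewrite FE.
    have dv : derivable f x v by exact: diff_derivable.
    have /cvgr_dnbhsP : (fun h : R => h^-1 *: ((f \o shift x) (h *: v) - f x)) h @[h --> 0^'] -->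
        'D_v f x by exact: dv.
    apply; split; first by move=> n; rewrite gt_eqF.
    exact: cvg_harmonic.
  - have iI : leb2.-integrable setT (EFin \o (\1_(sq (M + 1)) : PT R -> R)).
      have -> : EFin \o (\1_(sq (M + 1)) : PT R -> R) = (EFin \o cst (1 : R)) \_ (sq (M + 1)).
        by apply/funext => x; rewrite patchE /= indicE; case: (_ \in _).
      apply/(integrable_mkcond _ (measurable_sq _)).
      by apply: bmf_integrable (bmf_cst _); [exact: measurable_sq|exact: leb2_sq].
    exact: (integrableZl measurableT C iI).
  - move=> n x _; rewrite FE indicE; case: (boolP (x \in _)) => [_|xM].
      by rewrite mulr1; exact: difference_quotient_bound.
    have nM : ~ sq (M + 1) x by move/mem_set; apply/negP.
    have fx0 : f x = 0 by apply: f0 => -[? ?]; apply: nM; split; lra.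
    rewrite fx0 f0 ?subrr ?mulr0 ?normr0// => -[h1 h2]; apply: nM.
    have small (a b : R) : `|a| <= 1 -> `|hn n * a + b| <= M -> `|b| <= M + 1.
      move=> a1 ab; have -> : b = (hn n * a + b) - hn n * a by ring.
      apply: le_trans (ler_normB _ _) _; apply: lerD => //.
      rewrite normrM gtr0_norm//; apply: mulr_ile1 => //; exact: ltW.
    by split; [exact: (small v.1)|exact: (small v.2)].
move: cv; under eq_fun do rewrite IF.
by move=> /(cvg_lim (@Rhausdorff R)) <-; rewrite lim_cst.
Qed.

End Parts.

Section ComplexParts.
Context {R : realType}.
Local Open Scope complex_scope.
Local Notation Re := complex.Re.
Local Notation Im := complex.Im.
Implicit Types z w : R[i].

Lemma Re_mul z w : Re (z * w) = Re z * Re w - Im z * Im w.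
Proof. by case: z; case: w. Qed.
Lemma Im_mul z w : Im (z * w) = Re z * Im w + Im z * Re w.
Proof. by case: z; case: w. Qed.
Lemma Re_add z w : Re (z + w) = Re z + Re w. Proof. by case: z; case: w. Qed.
Lemma Im_add z w : Im (z + w) = Im z + Im w. Proof. by case: z; case: w. Qed.
Lemma Re_opp z : Re (- z) = - Re z. Proof. by case: z. Qed.
Lemma Im_opp z : Im (- z) = - Im z. Proof. by case: z. Qed.
Lemma Re_conj z : Re z^* = Re z. Proof. by case: z. Qed.
Lemma Im_conj z : Im z^* = - Im z. Proof. by case: z. Qed.
Lemma normc_sq z : Normc.normc z ^+ 2 = Re z ^+ 2 + Im z ^+ 2.
Proof. by case: z => a b; rewrite sqr_sqrtr// addr_ge0// sqr_ge0. Qed.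
Lemma cx_inj z w : Re z = Re w -> Im z = Im w -> z = w.
Proof. by case: z => a b; case: w => c d /= -> ->. Qed.

Definition cx (f : plane R -> R) : plane R -> R[i] := fun x => (f x)%:C.

Lemma Re_cr (a : R) : Re a%:C = a. Proof. by []. Qed.
Lemma Im_cr (a : R) : Im a%:C = 0. Proof. by []. Qed.
Lemma Re_cx f x : Re (cx f x) = f x. Proof. by []. Qed.
Lemma Im_cx f x : Im (cx f x) = 0. Proof. by []. Qed.
Lemma ReCint (D : set (plane R)) (F : plane R -> R[i]) :
  Re (Cintegral D F) = \int[leb2]_(x in D) Re (F x).
Proof. by []. Qed.
Lemma ImCint (D : set (plane R)) (F : plane R -> R[i]) :
  Im (Cintegral D F) = \int[leb2]_(x in D) Im (F x).
Proof. by []. Qed.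

Lemma partial_cx e f x : partial e (cx f) x = ('D_e f x)%:C.
Proof. by rewrite /partial /cx /= derive_cst. Qed.

End ComplexParts.

Section WeakCalculus.
Context {R : realType}.
Local Open Scope complex_scope.
Local Notation Re := complex.Re.
Local Notation Im := complex.Im.
Implicit Types (f g r : plane R -> R) (x v : plane R) (K : set (plane R)).
Implicit Types (phi u : plane R -> R[i]).

Definition ev (b : bool) : plane R := if b then e1 else e2.

Lemma ev_le1 b : `|(ev b).1| <= 1 /\ `|(ev b).2| <= 1.
Proof. by case: b; rewrite /= normr1 normr0. Qed.

Lemma smooth_diff r : smooth r -> forall x, differentiable r x.
Proof. by move=> sr x; exact: sr [::] x. Qed.

Lemma smooth_derive_diff r b : smooth r -> forall x, differentiable (fun y => 'D_(ev b) r y) x.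
Proof. by move=> sr x; exact: sr [:: b] x. Qed.

Lemma derive_off_closed r K v : closed K -> (forall x, ~ K x -> r x = 0) ->
  forall x, ~ K x -> 'D_v r x = 0.
Proof.
move=> cK r0 x Kx; rewrite -(derive_cst (0 : R) x v); apply: near_eq_derive.
have : nbhs x (~` K) by apply: open_nbhs_nbhs; split=> //; exact: closed_openC.
by apply: filterS => y /r0.
Qed.

(** Real test functions, with the closed support replaced by any compact set off which the function
    vanishes. *)
Definition supported (Om : set (plane R)) r := smooth r /\
  exists K, [/\ compact K, K `<=` Om & forall x, ~ K x -> r x = 0].

Lemma compact_closed_plane K : compact K -> closed K.
Proof. by apply: compact_closed; exact: norm_hausdorff. Qed.

Lemma test_function_parts Om phi : test_function Om phi ->
  supported Om (fun x => Re (phi x)) /\ supported Om (fun x => Im (phi x)).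
Proof.
move=> [s1 s2 cK KO].
have h x : ~ closure [set x | phi x != 0] x -> phi x = 0.
  by move=> xK; apply/eqP; apply: contrapT => /negP p0; apply: xK; exact: subset_closure.
by split; split=> //; exists (closure [set x | phi x != 0]); split=> // x /h ->.
Qed.

Lemma test_function_cx Om r : supported Om r -> test_function Om (cx r).
Proof.
move=> [sr [K [cK KO r0]]].
have cl : closure [set x | cx r x != 0] `<=` K.
  rewrite (closure_id K).1; last exact: compact_closed_plane.
  apply: closure_subset => x /= rx; apply: contrapT => /r0 e.
  by move: rx; rewrite /cx e eqxx.
split => //; last exact: subset_trans cl KO.
  by apply: SM_smooth; exact: SM_cst.
by apply: subclosed_compact cK cl; exact: closed_closure.
Qed.

Lemma supported_bmf Om r : supported Om r -> bmf (r : PT R -> R) /\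
  forall b, bmf ((fun x => 'D_(ev b) r x) : PT R -> R).
Proof.
move=> [sr [K [cK KO r0]]]; have [M KM] := compact_sub_sq cK.
have off f : (forall x, ~ K x -> f x = 0) -> forall x, ~ sq M x -> f x = 0.
  by move=> f0 x xM; apply: f0 => /KM.
have cr := diff_continuousT (smooth_diff sr); split.
  have [C _ hC] := continuous_bounded_supp cr (off _ r0).
  by split; [exact: continuous_plane_measurable|exists C].
move=> b; have cD := diff_continuousT (smooth_derive_diff b sr).
have D0 := derive_off_closed (ev b) (compact_closed_plane cK) r0.
have [C _ hC] := continuous_bounded_supp cD (off _ D0).
by split; [exact: continuous_plane_measurable|exists C].
Qed.

Lemma flat_le_fact n (t : R) : `|flat n t| <= n`!%:R.
Proof.
rewrite ger0_norm ?flat_ge0// /flat; case: ifPn => // t0.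
have u0 : 0 < t^-1 by rewrite invr_gt0.
rewrite expRN ler_pdivrMr ?expR_gt0//; case: n => [|n].
  by rewrite expr0 mul1r; have := expR_ge1Dx (t^-1); lra.
have f0 : 0 < n.+1`!%:R :> R by rewrite ltr0n fact_gt0.
have := @expR_ge1Dxn _ (t^-1) n (ltW u0).
by rewrite -ler_pdivrMl// mulrC; lra.
Qed.

Lemma SM_bmf f : SM f -> bmf (f : PT R -> R).
Proof.
move=> hf; split.
  apply: continuous_plane_measurable; apply: diff_continuousT.
  by case: (SM_diff_derive hf).
elim: hf => [c|l|l|n l|f1 f2 _ [M1 h1] _ [M2 h2]|f1 f2 _ [M1 h1] _ [M2 h2]].
- by exists `|c|.
- by exists 1 => x; exact: cos_max.
- by exists 1 => x; exact: sin_max.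
- by exists n`!%:R => x; exact: flat_le_fact.
- by exists (M1 + M2) => x; apply: le_trans (ler_normD _ _) _; exact: lerD.
- by exists (M1 * M2) => x; rewrite normrM; exact: ler_pM.
Qed.

Lemma SM_deriveP f v : SM f -> SM (fun x => 'D_v f x).
Proof.
move=> /SM_diff_derive[_ /(_ v)[g hg gE]].
by rewrite (_ : (fun x => _) = g)//; apply/funext.
Qed.

Lemma Rintegral_supp (Om : set (PT R)) (f : PT R -> R) : (forall x, ~ Om x -> f x = 0) ->
  \int[leb2]_(x in Om) f x = \int[leb2]_(x in setT) f x.
Proof.
move=> f0; rewrite [LHS]Rintegral_mkcond [RHS]Rintegral_mkcond; apply: eq_Rintegral => x _.
rewrite !patchE in_setT; case: ifPn => // /negP xO; rewrite f0//.
by move=> xOm; apply: xO; exact: mem_set.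
Qed.

Variable Om : set (PT R).
Hypotheses (mOm : measurable Om) (Omoo : (leb2 Om < +oo)%E).

(** The product of [g] and [r] vanishes off a compact subset of [Om], so the integral of its
    derivative is zero. *)
Lemma parts_supported g r b : SM g -> supported Om r ->
  \int[leb2]_(x in Om) (g x * 'D_(ev b) r x) = - \int[leb2]_(x in Om) ('D_(ev b) g x * r x).
Proof.
move=> hg sr; have [br bD] := supported_bmf sr; have bg := SM_bmf hg.
have bDg := SM_bmf (SM_deriveP (ev b) hg).
have [sm [K [cK KO r0]]] := sr; have [M KM] := compact_sub_sq cK.
have [dg _] := SM_diff_derive hg; have dr := smooth_diff sm.
have D0 := derive_off_closed (ev b) (compact_closed_plane cK) r0.
have dgr x : differentiable (g * r) x by exact: differentiableM.
have DE x : 'D_(ev b) (g * r) x = g x * 'D_(ev b) r x + 'D_(ev b) g x * r x.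
  rewrite deriveM; [|exact: diff_derivable..].
  by rewrite /GRing.scale /= [r x * _]mulrC.
have [v1 v2] := ev_le1 b.
have cD : continuous (fun y => 'D_(ev b) (g * r) y).
  have cr := diff_continuousT dr; have cg := diff_continuousT dg.
  have cDr := diff_continuousT (smooth_derive_diff b sm).
  have cDg := diff_continuousT (SM_diff_derive (SM_deriveP (ev b) hg)).1.
  rewrite (_ : (fun y => 'D_(ev b) (g * r) y) =
      fun y => g y * 'D_(ev b) r y + 'D_(ev b) g y * r y); last exact/funext.
  by move=> y; apply: cvgD; apply: cvgM; [exact: cg|exact: cDr|exact: cDg|exact: cr].
have gr0 x : ~ sq M x -> (g * r) x = 0.
  move=> xM; transitivity (g x * r x); first by [].
  by rewrite r0 ?mulr0// => /KM.
have Dgr0 x : ~ sq M x -> 'D_(ev b) (g * r) x = 0.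
  by move=> xM; rewrite DE r0 ?D0 ?mulr0 ?addr0// => /KM.
have := Rintegral_derive0 dgr cD v1 v2 gr0 Dgr0.
rewrite -(@Rintegral_supp Om); last first.
  by move=> x xO; rewrite DE r0 ?D0 ?mulr0 ?addr0// => /KO.
under eq_Rintegral do rewrite DE.
rewrite RintegralD//; last 2 first.
- exact: bmf_integrable (bmfM bg (bD b)).
- exact: bmf_integrable (bmfM bDg br).
by move/eqP; rewrite addr_eq0 => /eqP.
Qed.

Lemma weak_partial_SM f b : SM f -> weak_partial Om (ev b) (cx f) (cx (fun x => 'D_(ev b) f x)).
Proof.
move=> hf phi /test_function_parts[s1 s2]; apply: cx_inj.
  rewrite Re_opp !ReCint.
  under eq_Rintegral do rewrite Re_mul Re_cx Im_cx mul0r subr0.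
  rewrite (parts_supported b hf s1); congr (- _); apply: eq_Rintegral => x _.
  by rewrite Re_mul Re_cx Im_cx mul0r subr0.
rewrite Im_opp !ImCint.
under eq_Rintegral do rewrite Im_mul Re_cx Im_cx mul0r addr0.
rewrite (parts_supported b hf s2); congr (- _); apply: eq_Rintegral => x _.
by rewrite Im_mul Re_cx Im_cx mul0r addr0.
Qed.

Lemma L2_SM f : SM f -> L2 Om (cx f).
Proof.
move=> hf; have bf := SM_bmf hf; split => /=.
- exact: measurable_funTS (bmf_meas bf).
- exact: measurable_cst.
- have -> : (fun x => (Normc.normc (cx f x) ^+ 2)%:E) = EFin \o (fun x => f x ^+ 2).
    by apply/funext => x; rewrite normc_sq /= expr0n addr0.
  exact: bmf_integrable (bmfX 2 bf).
Qed.

Lemma weak_grad_SM f : SM f ->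
  weak_grad Om (cx f) (cx (fun x => 'D_e1 f x), cx (fun x => 'D_e2 f x)).
Proof.
move=> hf; split => /=.
- by apply: L2_SM; exact: SM_deriveP.
- by apply: L2_SM; exact: SM_deriveP.
- exact: (weak_partial_SM true).
- exact: (weak_partial_SM false).
Qed.

Lemma weak_partial_real e u (u' : plane R -> R[i]) r : weak_partial Om e u u' -> supported Om r ->
  \int[leb2]_(x in Om) (Re (u x) * 'D_e r x) = - (\int[leb2]_(x in Om) (Re (u' x) * r x)) /\
  \int[leb2]_(x in Om) (Im (u x) * 'D_e r x) = - \int[leb2]_(x in Om) (Im (u' x) * r x).
Proof.
move=> wp /test_function_cx/wp h; split.
  have := congr1 (@complex.Re R) h; rewrite Re_opp !ReCint.
  under eq_Rintegral do rewrite partial_cx Re_mul Re_cr Im_cr mulr0 subr0.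
  move=> ->; congr (- _); apply: eq_Rintegral => x _.
  by rewrite Re_mul Re_cx Im_cx mulr0 subr0.
have := congr1 (@complex.Im R) h; rewrite Im_opp !ImCint.
under eq_Rintegral do rewrite partial_cx Im_mul Re_cr Im_cr mulr0 add0r.
move=> ->; congr (- _); apply: eq_Rintegral => x _.
by rewrite Im_mul Re_cx Im_cx mulr0 add0r.
Qed.

Lemma L2_integrable u : L2 Om u -> leb2.-integrable Om (EFin \o (fun x => Re (u x))) /\
  leb2.-integrable Om (EFin \o (fun x => Im (u x))).
Proof.
move=> [m1 m2 i2].
have i1 : leb2.-integrable Om (EFin \o (fun x => 1 + Normc.normc (u x) ^+ 2)).
  exact: (integrableD mOm (bmf_integrable mOm Omoo (bmf_cst 1)) i2).
have key (h : PT R -> R) : measurable_fun Om h ->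
    (forall x, h x ^+ 2 <= Normc.normc (u x) ^+ 2) -> leb2.-integrable Om (EFin \o h).
  move=> mh hu; apply: le_integrable i1 => //; first exact/measurable_EFinP.
  move=> x _ /=; rewrite lee_fin.
  have := sqr_ge0 (`|h x| - 1); have := hu x; rewrite -(real_normK (num_real (h x))).
  rewrite [`|1 + _|]ger0_norm ?addr_ge0 ?sqr_ge0// !expr2; nra.
split; apply: key => // x; rewrite normc_sq.
  by rewrite lerDl sqr_ge0.
by rewrite lerDr sqr_ge0.
Qed.

End WeakCalculus.

(** * Cutoffs at the walls of a convex polygon *)

Section Cutoff.
Context {R : realType}.
Local Notation Re := complex.Re.
Local Notation Im := complex.Im.
Implicit Types (l : (R * R) * R) (r : seq ((R * R) * R)) (x v : plane R) (f phi : plane R -> R).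

Definition walls r : set (plane R) := [set x | forall l, l \in r -> 0 < aff l x].

(** The term - 1 makes [flat] vanish wherever the form is at most 1 / (n + 1), which keeps the
    support of the cutoff away from the wall. *)
Definition scl (n : nat) l : (R * R) * R :=
  ((n.+1%:R * l.1.1, n.+1%:R * l.1.2), n.+1%:R * l.2 - 1).

Lemma aff_scl n l x : aff (scl n l) x = n.+1%:R * aff l x - 1.
Proof. by rewrite /aff /scl /=; ring. Qed.

Lemma lin_scl n l v : lin (scl n l).1 v = n.+1%:R * lin l.1 v.
Proof. by rewrite /lin /scl /=; ring. Qed.

Fixpoint wallcut r (n : nat) x : R :=
  if r is l :: r' then flat 0 (aff (scl n l) x) * wallcut r' n x else 1.

Lemma SM_cut r n : SM (wallcut r n).
Proof.
elim: r => [|l r ih]; first exact: SM_cst.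
by apply: SM_mul ih; exact: SM_flat.
Qed.

Lemma flat0_le1 (t : R) : flat 0 t <= 1.
Proof. by have := flat_le_fact 0 t; rewrite fact0 ger0_norm ?flat_ge0. Qed.

Lemma cut_itv r n x : 0 <= wallcut r n x <= 1.
Proof.
elim: r => [|l r /andP[c0 c1]] /=; first by rewrite ler01 lexx.
by rewrite mulr_ge0 ?flat_ge0//= mulr_ile1 ?flat_ge0// flat0_le1.
Qed.

Lemma mul_flatS n (t : R) : t * flat n.+1 t = flat n t.
Proof.
rewrite /flat; case: ifPn => [t0|_]; last by rewrite mulr0.
by rewrite exprS !mulrA divff ?mul1r// gt_eqF.
Qed.

(* [flat 2 t = O(1 / (t + 1)^2)] makes the gradient of the cutoff harmless against a
   function that vanishes linearly on the wall. *)
Lemma flat2_bounds (t : R) : -1 < t -> (t + 1) * flat 2 t <= 3 /\ (t + 1) * flat 2 t <= 5 / (t + 1).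
Proof.
move=> t1; have f0 := flat0_le1 t.
have f1 : flat 1 t <= 1.
  by have := flat_le_fact 1 t; rewrite ger0_norm ?flat_ge0.
have f2 : flat 2 t <= 2.
  by have := flat_le_fact 2 t; rewrite ger0_norm ?flat_ge0.
have e1 := mul_flatS 0 t; have e2 := mul_flatS 1 t.
split; first by lra.
rewrite ler_pdivlMr; last by lra.
have -> : (t + 1) * flat 2 t * (t + 1) = flat 0 t + 2 * flat 1 t + flat 2 t.
  by rewrite -e1 -e2; ring.
by lra.
Qed.

Lemma flat0_ge (t : R) : -1 < t -> 1 - 2 / (t + 1) <= flat 0 t.
Proof.
move=> t1; have tp : 0 < t + 1 by lra.
rewrite lerBlDr -lerBlDl ler_pdivlMr// /flat; case: ifPn => [t0|]; last first.
  by rewrite -leNgt; lra.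
rewrite expr0 mul1r; set E := expR _.
have E1 : 1 - t^-1 <= E by exact: expR_ge1Dx.
have E0 : 0 <= E by exact: expR_ge0.
have : t * (1 - E) <= 1.
  by rewrite -[leRHS](@divff _ t) ?gt_eqF//; apply: ler_wpM2l; [exact: ltW|lra].
by lra.
Qed.

Lemma cvg_inv_scale (c d : R) : c / (n.+1%:R * d) @[n --> \oo] --> (0 : R).
Proof.
have -> : (fun n : nat => c / (n.+1%:R * d)) = (fun n => c / d * harmonic n).
  by apply/funext => n; rewrite /harmonic /= invfM mulrA mulrAC.
rewrite -[X in _ --> X](mulr0 (c / d)); apply: cvgMr.
exact: cvg_harmonic.
Qed.

Lemma scl_gtN1 n l x : 0 < aff l x -> -1 < aff (scl n l) x.
Proof. by move=> l0; rewrite aff_scl ltrDr mulr_gt0. Qed.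

Lemma cvg_cut r x : walls r x -> wallcut r n x @[n --> \oo] --> (1 : R).
Proof.
elim: r => [|l r ih] xr; first exact: cvg_cst.
rewrite /= -[X in _ --> X](mulr1 1); apply: cvgM; last first.
  by apply: ih => l' l'r; apply: xr; rewrite inE l'r orbT.
have l0 := xr l (mem_head _ _).
apply: (squeeze_cvgr (f := fun n : nat => 1 - 2 / (n.+1%:R * aff l x)) (h := fun=> 1)).
- apply: nearW => n; rewrite flat0_le1 andbT.
  by have := flat0_ge (scl_gtN1 n l0); rewrite [X in _ / (X + 1)]aff_scl subrK.
- by rewrite -[X in _ --> X](subr0 1); apply: cvgB; [exact: cvg_cst|exact: cvg_inv_scale].
- exact: cvg_cst.
Qed.

(** The slope of a cutoff factor grows like n + 1, while |f| <= C (t + 1) / (n + 1) with t the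
    argument of [flat]. Their product is at most a constant times (t + 1) flat 2 t, which
    [flat2_bounds] both bounds and sends to 0; this is what dominated convergence asks for. *)
Lemma cut_derive r f (C : R) v : 0 <= C -> exists C', forall x, walls r x ->
  (forall l, l \in r -> `|f x| <= C * aff l x) ->
  (forall n, `|f x * 'D_v (wallcut r n) x| <= C') /\
  (f x * 'D_v (wallcut r n) x @[n --> \oo] --> (0 : R)).
Proof.
move=> C0; elim: r => [|l r [C' ih]].
  exists 0 => x _ _; have D0 n : f x * 'D_v (wallcut [::] n) x = 0.
    by rewrite derive_cst mulr0.
  by split=> [n|]; [rewrite D0 normr0|under eq_fun do rewrite D0; exact: cvg_cst].
exists (C' + C * `|lin l.1 v| * 3) => x xr fx.
have [l0 fl] := (xr l (mem_head _ _), fx l (mem_head _ _)).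
have [] := ih x.
- by move=> l' l'r; apply: xr; rewrite inE l'r orbT.
- by move=> l' l'r; apply: fx; rewrite inE l'r orbT.
move=> bnd cv.
pose t n := aff (scl n l) x.
have DE n : f x * 'D_v (wallcut (l :: r) n) x = flat 0 (t n) * (f x * 'D_v (wallcut r n) x) +
    wallcut r n x * (f x * (n.+1%:R * lin l.1 v * flat 2 (t n))).
  have [da Da] := diff_comp_aff v (is_derive_flat 0 (aff (scl n l) x)).
  have dc := (SM_diff_derive (SM_cut r n)).1 x.
  have -> : wallcut (l :: r) n = (fun y => flat 0 (aff (scl n l) y)) * wallcut r n by [].
  rewrite deriveM; [|exact: diff_derivable..].
  by rewrite Da /GRing.scale /= lin_scl mul0r subr0 -/(t n); ring.
have tN n : -1 < t n by exact: scl_gtN1.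
have tE n : t n + 1 = n.+1%:R * aff l x by rewrite /t aff_scl subrK.
have key n : `|f x * (n.+1%:R * lin l.1 v * flat 2 (t n))| <=
    C * `|lin l.1 v| * ((t n + 1) * flat 2 (t n)).
  rewrite !normrM (ger0_norm (flat_ge0 _ _)) normr_nat tE.
  have := ler_wpM2r (mulr_ge0 (mulr_ge0 (ler0n R n.+1) (normr_ge0 (lin l.1 v))) (flat_ge0 2 (t n))) fl.
  by congr (_ <= _); ring.
have Cl0 : 0 <= C * `|lin l.1 v| by exact: mulr_ge0.
have key0 n (c : R) : (t n + 1) * flat 2 (t n) <= c ->
    `|wallcut r n x * (f x * (n.+1%:R * lin l.1 v * flat 2 (t n)))| <= C * `|lin l.1 v| * c.
  move=> tc; have /andP[c0 c1] := cut_itv r n x.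
  rewrite normrM (ger0_norm c0); apply: le_trans (ler_piMl (normr_ge0 _) c1) _.
  by apply: le_trans (key n) _; exact: ler_wpM2l.
split=> [n|].
  rewrite DE; apply: le_trans (ler_normD _ _) _; apply: lerD; last first.
    by apply: key0; have [] := flat2_bounds (tN n).
  rewrite normrM (ger0_norm (flat_ge0 _ _)); apply: le_trans (bnd n).
  by apply: ler_piMl (flat0_le1 _).
rewrite (_ : (fun n => _) = (fun n => flat 0 (t n) * (f x * 'D_v (wallcut r n) x) +
    wallcut r n x * (f x * (n.+1%:R * lin l.1 v * flat 2 (t n))))); last exact/funext.
rewrite -[X in _ --> X](addr0 0); apply: cvgD.
  apply: norm_cvg0.
  apply: (squeeze_cvgr (f := fun=> 0) (h := fun n => `|f x * 'D_v (wallcut r n) x|)).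
  - apply: nearW => n; rewrite normr_ge0 /= normrM (ger0_norm (flat_ge0 _ _)).
    by apply: ler_piMl (flat0_le1 _).
  - exact: cvg_cst.
  - by rewrite -[X in _ --> X](@normr0 _ R); apply: cvg_norm.
apply: norm_cvg0.
apply: (squeeze_cvgr (f := fun=> 0)
  (h := fun n : nat => C * `|lin l.1 v| * (5 / (n.+1%:R * aff l x)))).
- apply: nearW => n; rewrite normr_ge0 /=; apply: key0.
  by rewrite -tE; have [] := flat2_bounds (tN n).
- exact: cvg_cst.
- by rewrite -[X in _ --> X](mulr0 (C * `|lin l.1 v|)); apply: cvgMr; exact: cvg_inv_scale.
Qed.

Lemma measurable_walls r : measurable (walls r : set (PT R)).
Proof.
elim: r => [|l r ih].
  by rewrite (_ : walls [::] = setT)//; apply/seteqP; split.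
rewrite (_ : walls (l :: r) = [set x | 0 < aff l x] `&` walls r).
  apply: measurableI => //.
  have ma : measurable_fun setT (aff l : PT R -> R).
    by apply: measurable_funD => //; exact: measurable_lin.
  rewrite (_ : mkset _ = setT `&` (aff l : PT R -> R) @^-1` `]0, +oo[%classic); first exact: ma.
  by apply/seteqP; split => x /=; rewrite in_itv /= andbT; [split|case].
apply/seteqP; split => x /= h.
  by split; [exact: h (mem_head _ _)|move=> l' l'r; apply: h; rewrite inE l'r orbT].
by move=> l'; rewrite inE => /orP[/eqP ->|/h.2//]; exact: h.1.
Qed.

Lemma closed_ge1 r n : closed [set x | forall l, l \in r -> 0 <= aff (scl n l) x].
Proof.
elim: r => [|l r ih].
  by rewrite (_ : mkset _ = setT); [exact: closedT|apply/seteqP; split].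
rewrite (_ : mkset _ = [set x | 0 <= aff (scl n l) x] `&`
    [set x | forall l, l \in r -> 0 <= aff (scl n l) x]).
  apply: closedI => //.
  rewrite (_ : mkset _ = (aff (scl n l) : plane R -> R) @^-1` [set y | 0 <= y])//.
  apply: closed_comp; last exact: closed_ge.
  by move=> x _; apply: differentiable_continuous; case: (diff_aff (scl n l) x).
apply/seteqP; split => x /= h.
  by split; [exact: h (mem_head _ _)|move=> l' l'r; apply: h; rewrite inE l'r orbT].
by move=> l'; rewrite inE => /orP[/eqP ->|/h.2//]; exact: h.1.
Qed.

Lemma cut_supported r n f M : walls r `<=` sq M -> SM f ->
  supported (walls r) (fun x => wallcut r n x * f x).
Proof.
move=> rM hf; split; first by apply: SM_smooth; apply: SM_mul hf; exact: SM_cut.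
pose K := [set x | forall l, l \in r -> 0 <= aff (scl n l) x].
have KO : K `<=` walls r.
  move=> x xK l /xK; rewrite aff_scl subr_ge0 => h.
  have : 0 < n.+1%:R * aff l x by apply: lt_le_trans h.
  by rewrite pmulr_rgt0.
have KM : K `<=` sq M by exact: subset_trans KO rM.
have cK : compact K.
  by apply: subclosed_compact KM; [exact: closed_ge1|exact: compact_sq].
exists K; split=> //.
move=> x /existsNP[l /not_implyP[lr /negP]]; rewrite -ltNge => lx.
suff -> : wallcut r n x = 0 by rewrite mul0r.
elim: r lr {rM K KO KM cK} => [//|l' r ih]; rewrite inE => /orP[/eqP <-|/ih] /=.
  by rewrite {1}/flat ltNge (ltW lx)/= mul0r.
by move=> ->; rewrite mulr0.
Qed.

End Cutoff.

(** * Uniqueness of weak gradients and membership in H^1_0 *)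

Section DirichletSpace.
Context {R : realType}.
Local Notation Re := complex.Re.
Local Notation Im := complex.Im.
Variables (p q o : R * R) (r : seq ((R * R) * R)) (M : R).
Hypothesis fdet0 : fdet p q != 0.
Local Notation Om := (walls r).
Hypothesis OmM : Om `<=` sq M.
Hypothesis Omcell : forall x, Om x -> 0 <= fs p o x < 1 /\ 0 <= ft q o x < 1.
Implicit Types (x v : plane R) (f phi : plane R -> R) (u : plane R -> R[i]).

Let mOm : measurable (Om : set (PT R)) := measurable_walls r.

Lemma walls_finite : (leb2 Om < +oo)%E.
Proof.
apply: le_lt_trans (leb2_sq M); apply: le_measure; rewrite ?inE//.
exact: measurable_sq.
Qed.
Let Omoo := walls_finite.

Lemma SM_phase_trig k : SM (ck p q o k : plane R -> R) /\ SM (sk p q o k : plane R -> R).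
Proof.
pose l : (R * R) * R := ((2 * pi * (k.1%:~R * p.1 + k.2%:~R * q.1),
  2 * pi * (k.1%:~R * p.2 + k.2%:~R * q.2)), 2 * pi * (k.1%:~R * o.1 + k.2%:~R * o.2)).
have E x : phase p q o k x = aff l x.
  by rewrite /phase /angk /fs /ft /aff /l /=; ring.
split.
  by rewrite (_ : ck p q o k = fun x => cos (aff l x));
    [exact: SM_cos|apply/funext => x; rewrite -E].
by rewrite (_ : sk p q o k = fun x => sin (aff l x));
  [exact: SM_sin|apply/funext => x; rewrite -E].
Qed.

(** The lemma of du Bois-Reymond. A cutoff times a trigonometric function is a test function, so [g]
    times the cutoff is orthogonal to all trigonometric functions, and completeness for the trivial
    group makes it null. The cutoffs tend to 1, so [g] itself is null. *)
Lemma supported_dense (g : PT R -> R) : leb2.-integrable Om (EFin \o g) ->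
  (forall h, supported Om h -> \int[leb2]_(x in Om) (g x * h x) = 0) ->
  ae_eq leb2 Om (EFin \o g) (cst 0%E).
Proof.
move=> ig g0.
have z n : ae_eq leb2 Om (EFin \o (fun x => g x * wallcut r n x)) (cst 0%E).
  have bc := SM_bmf (SM_cut r n).
  apply: (@ae_null R p q o fdet0 Om [:: idmx] _ mOm).
  - exact: integrable_bmfM.
  - by [].
  - by rewrite mem_head.
  - exact: Omcell.
  - by move=> w x x' m; rewrite inE => /eqP.
  - have one (T : plane R -> R) : SM T ->
        \int[leb2]_(x in Om) (g x * wallcut r n x * (1%:~R * T x)) = 0.
      move=> hT; rewrite -[RHS](g0 _ (cut_supported n OmM hT)).
      by apply: eq_Rintegral => x _; rewrite mul1r mulrA.
    move=> k; have kk : kact idmx k = k.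
      by rewrite /kact /= !mulr1 !mulr0 addr0 add0r -surjective_pairing.
    have [h1 h2] := SM_phase_trig k.
    split; [rewrite -[RHS](one _ h1)|rewrite -[RHS](one _ h2)];
      by apply: eq_Rintegral => x _; rewrite big_seq1 kk.
have := ae_foralln z; apply: filterS => x zx Omx.
have /cvgr0_norm_lt : (fun n => 1 - wallcut r n x) @ \oo --> (0 : R).
  rewrite -[X in _ --> X](subrr 1); apply: cvgB; first exact: cvg_cst.
  exact: cvg_cut.
move=> /(_ 1 ltr01)[n _ /(_ n (leqnn _))] /=; rewrite ltr_norml => /andP[_ h].
have c0 : wallcut r n x != 0 by rewrite gt_eqF//; lra.
have [/eqP] := zx n Omx; rewrite mulf_eq0 (negbTE c0) orbF => /eqP ->.
by [].
Qed.

(** [H10] quantifies over every weak gradient, so an arbitrary one has to be identified with the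
    classical derivative. *)
Lemma weak_partial_unique f b (g : plane R -> R[i]) : SM f -> L2 Om g ->
  weak_partial Om (ev b) (cx f) g ->
  {ae leb2, forall x : PT R, Om x -> Re (g x) = 'D_(ev b) f x /\ Im (g x) = 0}.
Proof.
move=> hf Lg wp; have [i1 i2] := L2_integrable mOm Omoo Lg.
have bD := SM_bmf (SM_deriveP (ev b) hf).
have iD := bmf_integrable mOm Omoo bD.
have h1 : ae_eq leb2 Om (EFin \o (fun x => Re (g x) - 'D_(ev b) f x)) (cst 0%E).
  apply: supported_dense; first exact: (integrableB mOm i1 iD).
  move=> h sh; have [e1 _] := weak_partial_real wp sh.
  have bh := (supported_bmf sh).1.
  under eq_Rintegral do rewrite mulrBl.
  rewrite RintegralB//; [|exact: integrable_bmfM|exact: integrable_bmfM].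
  apply/eqP; rewrite subr_eq0; apply/eqP; apply: oppr_inj; rewrite -e1.
  exact: parts_supported.
have h2 : ae_eq leb2 Om (EFin \o (fun x => Im (g x))) (cst 0%E).
  apply: supported_dense => // h sh; have [_ e2] := weak_partial_real wp sh.
  apply: oppr_inj; rewrite -e2 oppr0; under eq_Rintegral do rewrite Im_cx mul0r.
  by rewrite Rintegral_cst// mul0r.
apply: filterS2 h1 h2 => x h1 h2 Omx; split.
  by have [/eqP] := h1 Omx; rewrite subr_eq0 => /eqP.
by have [] := h2 Omx.
Qed.

Lemma L2norm_ae_real (g : plane R -> R[i]) (a : plane R -> R) :
  measurable_fun Om (fun x : PT R => Re (g x) : R) ->
  measurable_fun Om (fun x : PT R => Im (g x) : R) -> bmf (a : PT R -> R) ->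
  {ae leb2, forall x : PT R, Om x -> Re (g x) = a x /\ Im (g x) = 0} ->
  L2norm Om g ^+ 2 = \int[leb2]_(x in Om) (a x ^+ 2).
Proof.
move=> m1 m2 ba h; rewrite /L2norm sqr_sqrtr; last first.
  by apply: Rintegral_ge0 => x _; exact: sqr_ge0.
have hae : ae_eq leb2 Om (fun x => (Normc.normc (g x) ^+ 2)%:E) (fun x => (a x ^+ 2)%:E).
  apply: filterS h => x h Omx; congr EFin.
  by rewrite normc_sq; have [-> ->] := h Omx; rewrite expr0n addr0.
rewrite /Rintegral; congr fine; apply: ae_eq_integral => //.
- apply/measurable_EFinP.
  rewrite (_ : (fun x => _) = fun x => Re (g x) ^+ 2 + Im (g x) ^+ 2); last first.
    by apply/funext => x; rewrite normc_sq.
  by apply: measurable_funD; apply: measurable_funX.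
- apply/measurable_EFinP; apply: measurable_funTS; exact: bmf_meas (bmfX 2 ba).
Qed.

Lemma Rintegral_sq_lim (F : nat -> plane R -> R) (C : R) : (forall n, bmf (F n : PT R -> R)) ->
  (forall n x, Om x -> `|F n x| <= C) -> (forall x, Om x -> F n x @[n --> \oo] --> (0 : R)) ->
  \int[leb2]_(x in Om) (F n x ^+ 2) @[n --> \oo] --> (0 : R).
Proof.
move=> bF FC F0; have -> : (0 : R) = \int[leb2]_(x in Om) (0 : R).
  by rewrite Rintegral_cst// mul0r.
apply: (@Rintegral_dct _ _ _ _ (fun=> C ^+ 2)) => //.
- by move=> n; apply: measurable_funTS; exact: bmf_meas (bmfX 2 (bF n)).
- move=> x Omx; rewrite -[X in _ --> X](mulr0 0); under eq_fun do rewrite expr2.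
  by apply: cvgM; exact: F0.
- exact: bmf_integrable (bmf_cst _).
- move=> n x Omx; rewrite normrX; have := FC n x Omx => h.
  by apply: lerXn2r; rewrite ?nnegrE//; exact: le_trans h.
Qed.

Lemma cut_H1_approx phi : SM phi ->
  (forall l, l \in r -> exists C, forall x, Om x -> `|phi x| <= C * aff l x) ->
  [/\ \int[leb2]_(x in Om) ((phi x - wallcut r n x * phi x) ^+ 2) @[n --> \oo] --> (0 : R) &
    forall v, \int[leb2]_(x in Om) (('D_v phi x - 'D_v (fun y => wallcut r n y * phi y) x) ^+ 2)
      @[n --> \oo] --> (0 : R)].
Proof.
move=> hphi hC.
have [C C0 {}hC] : exists2 C, 0 <= C & forall x, Om x -> forall l, l \in r ->
    `|phi x| <= C * aff l x.
  have : forall l, exists C, l \in r -> forall x, Om x -> `|phi x| <= C * aff l x.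
    move=> l; have [/hC[C h]|] := boolP (l \in r); first by exists C.
    by exists 0.
  move=> /choice[c hc]; have [N hN] := seq_real_bound c r.
  exists `|N| => // x Omx l lr; apply: le_trans (hc l lr x Omx) _.
  apply: ler_wpM2r; first by apply/ltW/Omx.
  by apply: le_trans (hN l lr) (ler_norm _).
have [_ [Mp hMp]] := SM_bmf hphi.
split.
  apply: (@Rintegral_sq_lim _ Mp) => [n|n x Omx|x Omx].
  - by apply: bmfB; [exact: SM_bmf|exact: SM_bmf (SM_mul (SM_cut r n) hphi)].
  - have /andP[c0 c1] := cut_itv r n x.
    have -> : phi x - wallcut r n x * phi x = (1 - wallcut r n x) * phi x by ring.
    rewrite normrM ger0_norm ?subr_ge0//; apply: le_trans (hMp x).
    by apply: ler_piMl => //; lra.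
  - rewrite -[X in _ --> X](subrr (phi x)); apply: cvgB; first exact: cvg_cst.
    rewrite -[X in _ --> X](mul1r (phi x)); apply: cvgMl; exact: cvg_cut.
move=> v; have [_ [Md hMd]] := SM_bmf (SM_deriveP v hphi).
have [C' hC'] := cut_derive r phi v C0.
have E n x : 'D_v phi x - 'D_v (fun y => wallcut r n y * phi y) x =
    (1 - wallcut r n x) * 'D_v phi x - phi x * 'D_v (wallcut r n) x.
  have -> : (fun y => wallcut r n y * phi y) = wallcut r n * phi by [].
  have dc := (SM_diff_derive (SM_cut r n)).1 x; have dp := (SM_diff_derive hphi).1 x.
  rewrite deriveM; [|exact: diff_derivable..].
  by rewrite /GRing.scale /=; ring.
apply: (@Rintegral_sq_lim _ (Md + C')) => [n|n x Omx|x Omx].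
- apply: bmfB; first exact: SM_bmf (SM_deriveP v hphi).
  exact: SM_bmf (SM_deriveP v (SM_mul (SM_cut r n) hphi)).
- rewrite E; apply: le_trans (ler_normB _ _) _; apply: lerD; last first.
    by have [] := hC' x Omx (hC x Omx).
  have /andP[c0 c1] := cut_itv r n x.
  rewrite normrM ger0_norm ?subr_ge0//; apply: le_trans (hMd x).
  by apply: ler_piMl => //; lra.
- rewrite (_ : (fun n => _) = fun n => (1 - wallcut r n x) * 'D_v phi x - phi x * 'D_v (wallcut r n) x);
    last by apply/funext => n.
  rewrite -[X in _ --> X](subrr 0); apply: cvgB; last by have [] := hC' x Omx (hC x Omx).
  rewrite -[X in _ --> X](mul0r ('D_v phi x)); apply: cvgMl.
  rewrite -[X in _ --> X](subrr 1); apply: cvgB; [exact: cvg_cst|exact: cvg_cut].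
Qed.

Lemma H10_SM phi : SM phi ->
  (forall l, l \in r -> exists C, forall x, Om x -> `|phi x| <= C * aff l x) ->
  H10 Om (cx phi).
Proof.
move=> hphi hC; split.
  split; first exact: (L2_SM mOm Omoo).
  by eexists; exact: (weak_grad_SM mOm Omoo).
move=> g [L1 L2' w1 w2] eps eps0.
have [c0 cD] := cut_H1_approx hphi hC.
have := cvgD (cvgD c0 (cD (ev true))) (cD (ev false)); rewrite !addr0.
have e20 : 0 < eps ^+ 2 by rewrite exprn_gt0.
have FF : Filter (nbhs \oo) by exact: _.
move=> /(_ FF FF) /cvgr0_norm_lt hcv.
have [n _ /(_ n (leqnn _)) /= hn] := hcv _ e20.
pose psi := fun x => wallcut r n x * phi x.
have hpsi : SM psi by exact: SM_mul (SM_cut r n) hphi.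
exists (cx psi); first by apply: test_function_cx; exact: cut_supported OmM hphi.
have key b (h : plane R -> R[i]) : L2 Om h -> weak_partial Om (ev b) (cx phi) h ->
    L2norm Om (fun x => h x - partial (ev b) (cx psi) x) ^+ 2 =
    \int[leb2]_(x in Om) (('D_(ev b) phi x - 'D_(ev b) psi x) ^+ 2).
  move=> Lh wh; have [mh1 mh2 _] := Lh.
  have bd := SM_bmf (SM_deriveP (ev b) hphi); have bs := SM_bmf (SM_deriveP (ev b) hpsi).
  have RE x : Re (h x - partial (ev b) (cx psi) x) = Re (h x) - 'D_(ev b) psi x.
    by rewrite Re_add Re_opp partial_cx.
  have IE x : Im (h x - partial (ev b) (cx psi) x) = Im (h x).
    by rewrite Im_add Im_opp partial_cx /= oppr0 addr0.
  apply: L2norm_ae_real.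
  - under eq_fun do rewrite RE; apply: measurable_funB => //.
    exact: measurable_funTS (bmf_meas bs).
  - by under eq_fun do rewrite IE.
  - exact: bmfB.
  - have := weak_partial_unique hphi Lh wh; apply: filterS => x hx Omx.
    by rewrite RE IE; have [-> ->] := hx Omx.
have k1 : L2norm Om (fun x => g.1 x - partial e1 (cx psi) x) ^+ 2 = _ := key true _ L1 w1.
have k2 : L2norm Om (fun x => g.2 x - partial e2 (cx psi) x) ^+ 2 = _ := key false _ L2' w2.
have k0 : L2norm Om (fun x => cx phi x - cx psi x) ^+ 2 =
    \int[leb2]_(x in Om) ((phi x - psi x) ^+ 2).
  apply: L2norm_ae_real.
  - under eq_fun do rewrite Re_add Re_opp /=.
    by apply: measurable_funTS; apply: bmf_meas; apply: bmfB; exact: SM_bmf.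
  - under eq_fun do rewrite Im_add Im_opp /= oppr0 addr0; exact: measurable_cst.
  - by apply: bmfB; exact: SM_bmf.
  - by apply: aeW => x _; rewrite Re_add Re_opp Im_add Im_opp /= oppr0 addr0.
have SE (a b c a' b' c' : R) : a = a' -> b = b' -> c = c' ->
    Num.sqrt (a' + b' + c') < eps -> Num.sqrt (a + b + c) < eps by move=> -> -> ->.
apply: (SE _ _ _ _ _ _ k0 k1 k2).
rewrite -[ltRHS](@ger0_norm _ eps) ?ltW// -sqrtr_sqr ltr_sqrt//.
exact: le_lt_trans (ler_norm _) hn.
Qed.

End DirichletSpace.

(** * Green's identity on H^1_0 *)

Section Green.
Context {R : realType}.
Local Notation Re := complex.Re.
Local Notation Im := complex.Im.
Implicit Types (x v : plane R) (f phi : plane R -> R) (u : plane R -> R[i]%C).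

Definition part (b : bool) (z : R[i]%C) : R := if b then Re z else Im z.

Lemma partB b z w : part b (z - w) = part b z - part b w.
Proof. by case: b; rewrite /part ?Re_add ?Re_opp ?Im_add ?Im_opp. Qed.

Lemma part_sq b z : part b z ^+ 2 <= Normc.normc z ^+ 2.
Proof. by rewrite normc_sq; case: b; rewrite /part ?lerDl ?lerDr sqr_ge0. Qed.

Lemma small_eq0 (C y : R) : (forall eps, 0 < eps -> `|y| <= C * eps) -> y = 0.
Proof.
move=> h; apply/eqP; rewrite -normr_le0 leNgt; apply/negP => y0.
have C1 : 0 < `|C| + 1 by have := normr_ge0 C; lra.
have e0 : 0 < `|y| / (2 * (`|C| + 1)) by rewrite divr_gt0// mulr_gt0.
have := h _ e0; apply/negP; rewrite -ltNge.
apply: (@le_lt_trans _ _ (`|C| * (`|y| / (2 * (`|C| + 1))))).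
  by apply: ler_wpM2r; [exact: ltW|exact: ler_norm].
rewrite mulrA ltr_pdivrMr ?mulr_gt0// mulrC.
by have := normr_ge0 C; move: (`|C|) (`|y|) y0 => c t; nra.
Qed.

Lemma norm_combination (mu z0 z1 z2 m0 m1 m2 c eps : R) : `|z0| <= m0 * c * eps ->
  `|z1| <= m1 * c * eps -> `|z2| <= m2 * c * eps ->
  `|z1 + z2 - mu * z0| <= (m1 + m2 + `|mu| * m0) * c * eps.
Proof.
move=> d0 d1 d2; apply: le_trans (ler_normB _ _) _; rewrite normrM.
have := ler_wpM2l (normr_ge0 mu) d0; have := ler_normD z1 z2.
by lra.
Qed.

Variable Om : set (PT R).
Hypotheses (mOm : measurable Om) (Omoo : (leb2 Om < +oo)%E).

(** Takes the place of the Cauchy-Schwarz inequality: pointwise |h| <= (eps + N / eps) / 2, and both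
    terms integrate to order [eps]. *)
Lemma Rintegral_mul_small (h N F : PT R -> R) (eps Mf : R) :
  leb2.-integrable Om (EFin \o h) -> leb2.-integrable Om (EFin \o N) -> bmf F ->
  (forall x, `|F x| <= Mf) -> (forall x, h x ^+ 2 <= N x) -> 0 < eps ->
  \int[leb2]_(x in Om) N x <= eps ^+ 2 ->
  `|\int[leb2]_(x in Om) (h x * F x)| <= Mf / 2 * (fine (leb2 Om) + 1) * eps.
Proof.
move=> ih iN bF FM hN e0 Ne.
have M0 : 0 <= Mf by apply: le_trans (FM (0, 0)).
have ihF : leb2.-integrable Om (EFin \o (fun x => h x * F x)) by exact: integrable_bmfM.
have iB : leb2.-integrable Om (EFin \o (fun x => Mf / 2 * eps + Mf / (2 * eps) * N x)).
  have i1 := bmf_integrable mOm Omoo (bmf_cst (Mf / 2 * eps)).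
  exact: (integrableD mOm i1 (integrableZl mOm (Mf / (2 * eps)) iN)).
apply: le_trans (le_normr_Rintegral mOm ihF) _.
apply: (@le_trans _ _ (\int[leb2]_(x in Om) (Mf / 2 * eps + Mf / (2 * eps) * N x))).
  apply: le_Rintegral => //; first exact: integrable_norm ihF.
  move=> x _; rewrite normrM mulrC.
  apply: (@le_trans _ _ (Mf * `|h x|)); first exact: ler_wpM2r.
  have -> : Mf / 2 * eps + Mf / (2 * eps) * N x = Mf * ((eps + N x / eps) / 2).
    by field; rewrite gt_eqF.
  apply: ler_wpM2l => //; rewrite ler_pdivlMr//.
  have : `|h x| ^+ 2 <= N x / eps * eps by rewrite divfK ?gt_eqF// real_normK ?num_real.
  have : 0 <= N x / eps.
    by rewrite divr_ge0 ?(ltW e0)//; apply: le_trans (hN x); exact: sqr_ge0.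
  move: (N x / eps) (`|h x|) (normr_ge0 (h x)) => n t t0 n0 tn.
  have := @amgm_lower _ (- t) n eps n0 (ltW e0).
  by rewrite sqrrN => /(_ tn); lra.
rewrite RintegralD//; [|exact: bmf_integrable (bmf_cst _)|
  exact: (integrableZl mOm (Mf / (2 * eps)) iN)].
rewrite Rintegral_cst// RintegralZl//.
have : Mf / (2 * eps) * \int[leb2]_(x in Om) N x <= Mf / (2 * eps) * eps ^+ 2.
  by apply: ler_wpM2l => //; rewrite divr_ge0// mulr_ge0// ltW.
have -> : Mf / (2 * eps) * eps ^+ 2 = Mf / 2 * eps by field; rewrite gt_eqF.
by lra.
Qed.

Lemma L2_sub_bmf u (w : plane R -> R[i]%C) : L2 Om u -> bmf ((fun x => Re (w x)) : PT R -> R) ->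
  bmf ((fun x => Im (w x)) : PT R -> R) -> L2 Om (fun x => u x - w x).
Proof.
move=> [m1 m2 iu] b1 b2.
have mR : measurable_fun Om ((fun x => Re (u x - w x)) : PT R -> R).
  under eq_fun do rewrite Re_add Re_opp; apply: measurable_funB => //.
  exact: measurable_funTS (bmf_meas b1).
have mI : measurable_fun Om ((fun x => Im (u x - w x)) : PT R -> R).
  under eq_fun do rewrite Im_add Im_opp; apply: measurable_funB => //.
  exact: measurable_funTS (bmf_meas b2).
split => //.
have iB : leb2.-integrable Om (EFin \o (fun x => 2 * Normc.normc (u x) ^+ 2 +
    2 * (Re (w x) ^+ 2 + Im (w x) ^+ 2))).
  have i2 := bmf_integrable mOm Omoo (bmfZ 2 (bmfD (bmfX 2 b1) (bmfX 2 b2))).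
  exact: (integrableD mOm (integrableZl mOm 2 iu) i2).
apply: le_integrable iB => //.
  apply/measurable_EFinP; rewrite (_ : (fun x => _) = fun x => Re (u x - w x) ^+ 2 +
      Im (u x - w x) ^+ 2); last by apply/funext => x; rewrite normc_sq.
  by apply: measurable_funD; exact: measurable_funX.
move=> x _ /=; rewrite lee_fin !ger0_norm ?sqr_ge0//; last first.
  by rewrite addr_ge0// mulr_ge0// ?addr_ge0 ?sqr_ge0.
rewrite !normc_sq Re_add Re_opp Im_add Im_opp.
move: (Re (u x)) (Im (u x)) (Re (w x)) (Im (w x)) => a b c d.
have := sqr_ge0 (a + c); have := sqr_ge0 (b + d).
by rewrite !expr2; lra.
Qed.

Lemma green_test r phi mu : supported Om r -> SM phi ->
  (forall x, 'D_e1 (fun y => 'D_e1 phi y) x + 'D_e2 (fun y => 'D_e2 phi y) x = - mu * phi x) ->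
  \int[leb2]_(x in Om) ('D_e1 r x * 'D_e1 phi x) + \int[leb2]_(x in Om) ('D_e2 r x * 'D_e2 phi x)
  = mu * \int[leb2]_(x in Om) (r x * phi x).
Proof.
move=> sr hphi hmu; have [br _] := supported_bmf sr.
have h b : \int[leb2]_(x in Om) ('D_(ev b) r x * 'D_(ev b) phi x) =
    - \int[leb2]_(x in Om) ('D_(ev b) (fun y => 'D_(ev b) phi y) x * r x).
  rewrite -(parts_supported mOm Omoo b (SM_deriveP (ev b) hphi) sr).
  by apply: eq_Rintegral => x _; rewrite mulrC.
have -> : \int[leb2]_(x in Om) ('D_e1 r x * 'D_e1 phi x) = _ := h true.
have -> : \int[leb2]_(x in Om) ('D_e2 r x * 'D_e2 phi x) = _ := h false.
rewrite -opprD.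
have bb b := bmfM (SM_bmf (SM_deriveP (ev b) (SM_deriveP (ev b) hphi))) br.
rewrite -RintegralD//; [|exact: bmf_integrable (bb _)..].
rewrite -RintegralZl//; last exact: bmf_integrable (bmfM br (SM_bmf hphi)).
rewrite -[LHS]mulN1r -RintegralZl//; last first.
  exact: bmf_integrable (bmfD (bb true) (bb false)).
by apply: eq_Rintegral => x _; rewrite -mulrDl hmu; ring.
Qed.

(** The identity is exact for test functions. Replacing [u] by a test function that is [eps]-close
    to it in H^1 changes each of the three integrals by at most a constant times [eps], so the two
    sides are equal. *)
Lemma green u gu phi mu b : H10 Om u -> weak_grad Om u gu -> SM phi ->
  (forall x, 'D_e1 (fun y => 'D_e1 phi y) x + 'D_e2 (fun y => 'D_e2 phi y) x = - mu * phi x) ->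
  \int[leb2]_(x in Om) (part b (gu.1 x) * 'D_e1 phi x) +
  \int[leb2]_(x in Om) (part b (gu.2 x) * 'D_e2 phi x)
  = mu * \int[leb2]_(x in Om) (part b (u x) * phi x).
Proof.
move=> [[Lu _] hu] wg hphi hmu; have [L1 L2' _ _] := wg.
have bphi := SM_bmf hphi.
have b1 := SM_bmf (SM_deriveP e1 hphi); have b2 := SM_bmf (SM_deriveP e2 hphi).
have [_ [M0 hM0]] := bphi; have [_ [M1 hM1]] := b1; have [_ [M2 hM2]] := b2.
set X1 := \int[leb2]_(x in Om) _; set X2 := \int[leb2]_(x in Om) _; set X0 := \int[leb2]_(x in Om) _.
pose c := (fine (leb2 Om) + 1) / 2.
apply/eqP; rewrite -subr_eq0; apply/eqP.
apply: (@small_eq0 ((M1 + M2 + `|mu| * M0) * c)) => eps e0.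
have [psi tpsi] := hu gu wg eps e0.
set S := (X in Num.sqrt X < _) => hS.
have S0 : 0 <= S by rewrite /S !addr_ge0// sqr_ge0.
have {}hS : S <= eps ^+ 2.
  rewrite -(sqr_sqrtr S0); apply: lerXn2r; rewrite ?nnegrE ?sqrtr_ge0// ltW//.
have [s1 s2] := test_function_parts tpsi.
pose r x := part b (psi x).
have sr : supported Om r by rewrite /r; case: (b).
have [br bDr] := supported_bmf sr.
have bRe := (supported_bmf s1); have bIm := (supported_bmf s2).
have partial_part e x : part b (partial e psi x) = 'D_e r x by rewrite /r; case: (b).
have diff (w : plane R -> R[i]%C) (z : plane R -> R[i]%C) (F : PT R -> R) Mf : L2 Om w ->
    bmf ((fun x => Re (z x)) : PT R -> R) -> bmf ((fun x => Im (z x)) : PT R -> R) ->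
    L2norm Om (fun x => w x - z x) ^+ 2 <= S ->
    bmf F -> (forall x, `|F x| <= Mf) ->
    `|\int[leb2]_(x in Om) (part b (w x) * F x) - \int[leb2]_(x in Om) (part b (z x) * F x)|
    <= Mf * c * eps.
  move=> Lw bz1 bz2 nS bF FM; have Ld := L2_sub_bmf Lw bz1 bz2.
  have [_ _ iN] := Ld.
  have ip (t : plane R -> R[i]%C) : L2 Om t -> leb2.-integrable Om (EFin \o (fun x => part b (t x))).
    by move=> /(L2_integrable mOm Omoo)[]; rewrite /part; case: (b).
  have iz : leb2.-integrable Om (EFin \o (fun x => part b (z x))).
    by rewrite /part; case: (b); exact: bmf_integrable.
  rewrite -RintegralB//; [|exact: integrable_bmfM (ip _ Lw) bF|exact: integrable_bmfM iz bF].
  rewrite (_ : Mf * c * eps = Mf / 2 * (fine (leb2 Om) + 1) * eps); last by rewrite /c; field.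
  under eq_Rintegral do rewrite -mulrBl -partB.
  apply: (Rintegral_mul_small (N := fun x => Normc.normc (w x - z x) ^+ 2)) => //.
  - exact: ip.
  - by move=> x; exact: part_sq.
  - apply: le_trans hS; apply: le_trans nS; rewrite /L2norm sqr_sqrtr//.
    by apply: Rintegral_ge0 => x _; exact: sqr_ge0.
have sq3 (i j k : R) : i ^+ 2 <= i ^+ 2 + j ^+ 2 + k ^+ 2 /\ j ^+ 2 <= i ^+ 2 + j ^+ 2 + k ^+ 2 /\
    k ^+ 2 <= i ^+ 2 + j ^+ 2 + k ^+ 2.
  by have := sqr_ge0 i; have := sqr_ge0 j; have := sqr_ge0 k; split; [|split]; lra.
have [q0 [q1 q2]] := sq3 (L2norm Om (fun x => u x - psi x))
  (L2norm Om (fun x => gu.1 x - partial e1 psi x)) (L2norm Om (fun x => gu.2 x - partial e2 psi x)).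
have d0 := diff u psi phi M0 Lu bRe.1 bIm.1 q0 bphi hM0.
have d1 := diff gu.1 (partial e1 psi) _ M1 L1 (bRe.2 true) (bIm.2 true) q1 b1 hM1.
have d2 := diff gu.2 (partial e2 psi) _ M2 L2' (bRe.2 false) (bIm.2 false) q2 b2 hM2.
have gt := green_test sr hphi hmu.
rewrite -/X0 in d0; rewrite -/X1 in d1; rewrite -/X2 in d2.
have E1 : \int[leb2]_(x in Om) (part b (partial e1 psi x) * 'D_e1 phi x) =
    \int[leb2]_(x in Om) ('D_e1 r x * 'D_e1 phi x).
  by apply: eq_Rintegral => x _; rewrite partial_part.
have E2 : \int[leb2]_(x in Om) (part b (partial e2 psi x) * 'D_e2 phi x) =
    \int[leb2]_(x in Om) ('D_e2 r x * 'D_e2 phi x).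
  by apply: eq_Rintegral => x _; rewrite partial_part.
rewrite E1 in d1; rewrite E2 in d2.
set Y1 := \int[leb2]_(x in Om) _ in d1 gt; set Y2 := \int[leb2]_(x in Om) _ in d2 gt.
set Y0 := \int[leb2]_(x in Om) _ in d0.
have {}gt : Y1 + Y2 = mu * Y0 by exact: gt.
have -> : X1 + X2 - mu * X0 = (X1 - Y1) + (X2 - Y2) - mu * (X0 - Y0).
  by rewrite mulrBr -gt; ring.
exact: norm_combination d0 d1 d2.
Qed.

End Green.

(** * Eigenfunctions as trigonometric polynomials *)

Section Projection.
Context {R : realType} (I : eqType) (E : I -> PT R -> R).
Variable Om : set (PT R).
Hypotheses (mOm : measurable Om) (Omoo : (leb2 Om < +oo)%E).
Hypothesis bE : forall i, bmf (E i).

Inductive lspan (s : seq I) : (PT R -> R) -> Prop :=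
| lspan0 : lspan s (fun=> 0)
| lspanD i c g : i \in s -> lspan s g -> lspan s (fun x => c * E i x + g x).

Lemma lspan_add s g h : lspan s g -> lspan s h -> lspan s (fun x => g x + h x).
Proof.
move=> hg hh; elim: hg => [|i c g' si _ ih].
  by under eq_fun do rewrite add0r.
by under eq_fun do rewrite -addrA; exact: lspanD.
Qed.

Lemma lspan_scale s c g : lspan s g -> lspan s (fun x => c * g x).
Proof.
elim=> [|i d g' si _ ih]; first by under eq_fun do rewrite mulr0; exact: lspan0.
by under eq_fun do rewrite mulrDr mulrA; exact: lspanD.
Qed.

Lemma lspan_mono s s' g : {subset s <= s'} -> lspan s g -> lspan s' g.
Proof. by move=> ss; elim=> [|i c g' /ss si _ ih]; [exact: lspan0|exact: lspanD]. Qed.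

Lemma lspan_bmf s g : lspan s g -> bmf g.
Proof. by elim=> [|i c g' _ _ ih]; [exact: bmf_cst|apply: bmfD => //; exact: bmfZ]. Qed.

Lemma Rintegral_mul_null (h g : PT R -> R) : leb2.-integrable Om (EFin \o h) -> bmf g ->
  \int[leb2]_(x in Om) (g x * g x) = 0 -> \int[leb2]_(x in Om) (h x * g x) = 0.
Proof.
move=> ih bg g0; have bgg := bmfM bg bg; have igg := bmf_integrable mOm Omoo bgg.
have mg : measurable_fun Om (EFin \o (fun x => g x * g x)) by exact: measurable_int igg.
have z : ae_eq leb2 Om (EFin \o (fun x => g x * g x)) (cst 0%E).
  apply/(ae_eq_integral_abs leb2 mOm mg).
  have -> : (\int[leb2]_(x in Om) `|(EFin \o (fun x => (g x * g x)%R)) x| =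
      \int[leb2]_(x in Om) (EFin \o (fun x => (g x * g x)%R)) x)%E.
    by apply: eq_integral => x _; rewrite /= ger0_norm// -expr2 sqr_ge0.
  by move: g0; rewrite /Rintegral => g0; rewrite -(fineK (integrable_fin_num mOm igg)) g0.
have ihg := integrable_bmfM mOm ih bg.
rewrite /Rintegral (ae_eq_integral (cst 0%E)) ?integral0//; first exact: (measurable_int _ ihg).
apply: filterS z => x zx Omx; have [/eqP] := zx Omx.
by rewrite mulf_eq0 orbb => /eqP /= ->; rewrite mulr0.
Qed.

Lemma lspan_orth s (f g : PT R -> R) : leb2.-integrable Om (EFin \o f) -> lspan s g ->
  (forall i, i \in s -> \int[leb2]_(x in Om) (f x * E i x) = 0) ->
  \int[leb2]_(x in Om) (f x * g x) = 0.
Proof.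
move=> fi hg f0; elim: hg => [|i c g' si hg' ih].
  under eq_Rintegral do rewrite mulr0.
  by rewrite Rintegral_cst// mul0r.
have i1 := integrable_bmfM mOm fi (bE i); have i2 := integrable_bmfM mOm fi (lspan_bmf hg').
transitivity (\int[leb2]_(x in Om) (c * (f x * E i x) + f x * g' x)).
  by apply: eq_Rintegral => x _; ring.
rewrite RintegralD//; last exact: (integrableZl mOm c i1).
by rewrite RintegralZl// f0// ih mulr0 addr0.
Qed.

(** Gram-Schmidt, one generator at a time: [psi] is the new generator minus its projection onto the
    others. If [psi] has norm zero it is discarded, a case that does occur because alternating modes
    may vanish or be dependent. *)
Lemma projection s (h : PT R -> R) : leb2.-integrable Om (EFin \o h) ->
  exists2 g, lspan s g & forall i, i \in s -> \int[leb2]_(x in Om) ((h x - g x) * E i x) = 0.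
Proof.
elim: s h => [h _|i s ih h hi]; first by exists (fun=> 0); [exact: lspan0|].
have sub : {subset s <= i :: s} by move=> j js; rewrite inE js orbT.
have [g1 s1 o1] := ih _ (bmf_integrable mOm Omoo (bE i)).
have [g2 s2 o2] := ih _ hi.
pose psi x := E i x - g1 x; have bpsi : bmf psi by apply: bmfB => //; exact: lspan_bmf s1.
have id2 : leb2.-integrable Om (EFin \o (fun x => h x - g2 x)).
  exact: (integrableB mOm hi (bmf_integrable mOm Omoo (lspan_bmf s2))).
have ipsi := bmf_integrable mOm Omoo bpsi.
have split_E (f : PT R -> R) : leb2.-integrable Om (EFin \o f) ->
    (forall j, j \in s -> \int[leb2]_(x in Om) (f x * E j x) = 0) ->
    \int[leb2]_(x in Om) (f x * E i x) = \int[leb2]_(x in Om) (f x * psi x).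
  move=> fi f0.
  transitivity (\int[leb2]_(x in Om) (f x * psi x + f x * g1 x)).
    by apply: eq_Rintegral => x _; rewrite /psi; ring.
  rewrite RintegralD//; [|exact: integrable_bmfM|exact: integrable_bmfM fi (lspan_bmf s1)].
  by rewrite (lspan_orth fi s1 f0) addr0.
have [n0|n0] := eqVneq (\int[leb2]_(x in Om) (psi x * psi x)) 0.
  exists g2; first exact: lspan_mono s2.
  move=> j; rewrite inE => /orP[/eqP ->|/o2//].
  by rewrite split_E//; exact: Rintegral_mul_null.
pose c := \int[leb2]_(x in Om) ((h x - g2 x) * psi x) / \int[leb2]_(x in Om) (psi x * psi x).
have sg : lspan (i :: s) (fun x => g2 x + c * psi x).
  apply: lspan_add; first exact: lspan_mono s2.
  apply: lspan_scale.
  have -> : psi = fun x => 1 * E i x + (-1) * g1 x by apply/funext => x; rewrite /psi; ring.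
  by apply: lspanD; [rewrite mem_head|apply: lspan_scale; exact: lspan_mono s1].
exists (fun x => g2 x + c * psi x) => //.
have split_f (j : PT R -> R) : bmf j -> \int[leb2]_(x in Om) ((h x - (g2 x + c * psi x)) * j x) =
    \int[leb2]_(x in Om) ((h x - g2 x) * j x) - c * \int[leb2]_(x in Om) (psi x * j x).
  move=> bj; have i1 := integrable_bmfM mOm id2 bj.
  have i2 := integrable_bmfM mOm ipsi bj.
  rewrite -RintegralZl// -RintegralB//; last exact: (integrableZl mOm c i2).
  by apply: eq_Rintegral => x _; ring.
have o3 j : j \in s -> \int[leb2]_(x in Om) ((h x - (g2 x + c * psi x)) * E j x) = 0.
  by move=> js; rewrite split_f// o2// /psi o1// mulr0 subr0.
move=> j; rewrite inE => /orP[/eqP ->|]; last exact: o3.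
rewrite split_E//; last exact: (integrableB mOm hi (bmf_integrable mOm Omoo (lspan_bmf sg))).
by rewrite split_f// /c divfK// subrr.
Qed.

End Projection.

Section Laplacian.
Context {R : realType}.
Implicit Types (x : plane R) (f g : plane R -> R).

Definition Lap f x : R := 'D_e1 (fun y => 'D_e1 f y) x + 'D_e2 (fun y => 'D_e2 f y) x.

Lemma SM_deriveD f g v : SM f -> SM g ->
  (fun x => 'D_v (fun y => f y + g y) x) = (fun x => 'D_v f x + 'D_v g x).
Proof.
move=> hf hg; apply/funext => x; have df := (SM_diff_derive hf).1 x.
have dg := (SM_diff_derive hg).1 x.
by rewrite -[fun y => f y + g y]/(f + g) deriveD//; exact: diff_derivable.
Qed.

Lemma SM_deriveZ c f v : SM f -> (fun x => 'D_v (fun y => c * f y) x) = (fun x => c * 'D_v f x).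
Proof.
move=> hf; apply/funext => x; have df := (SM_diff_derive hf).1 x.
rewrite -[fun y => c * f y]/(cst c * f) deriveM; [|exact: derivable_cst|exact: diff_derivable].
by rewrite derive_cst scaler0 addr0.
Qed.

Lemma LapD f g x : SM f -> SM g -> Lap (fun y => f y + g y) x = Lap f x + Lap g x.
Proof.
move=> hf hg; have h v : 'D_v (fun y => 'D_v (fun z => f z + g z) y) x =
    'D_v (fun y => 'D_v f y) x + 'D_v (fun y => 'D_v g y) x.
  rewrite (SM_deriveD v hf hg).
  exact: (congr1 (fun F => F x) (SM_deriveD v (SM_deriveP v hf) (SM_deriveP v hg))).
exact: (etrans (f_equal2 +%R (h e1) (h e2)) (addrACA _ _ _ _)).
Qed.

Lemma LapZ c f x : SM f -> Lap (fun y => c * f y) x = c * Lap f x.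
Proof.
move=> hf; have h := fun v => etrans (congr1 (fun F : plane R -> R => 'D_v F x) (SM_deriveZ c v hf))
  (congr1 (fun F : plane R -> R => F x) (SM_deriveZ c v (SM_deriveP v hf))).
exact: (etrans (f_equal2 +%R (h e1) (h e2)) (esym (mulrDr _ _ _))).
Qed.

Lemma Lap_cos_aff l x : Lap (fun y => cos (aff l y)) x =
  - (l.1.1 ^+ 2 + l.1.2 ^+ 2) * cos (aff l x).
Proof.
have h v : 'D_v (fun y => 'D_v (fun z => cos (aff l z)) y) x = - (lin l.1 v ^+ 2) * cos (aff l x).
  have -> : (fun y => 'D_v (fun z => cos (aff l z)) y) = fun y => - lin l.1 v * sin (aff l y).
    apply/funext => y; have [_ ->] := diff_comp_aff v (is_derive_cos (aff l y)); ring.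
  have := congr1 (fun F => F x) (SM_deriveZ (- lin l.1 v) v (SM_sin l)) => /= ->.
  have [_ ->] := diff_comp_aff v (is_derive_sin (aff l x)); ring.
by apply: etrans (f_equal2 +%R (h e1) (h e2)) _; rewrite /lin /=; ring.
Qed.

Lemma Lap_sin_aff l x : Lap (fun y => sin (aff l y)) x =
  - (l.1.1 ^+ 2 + l.1.2 ^+ 2) * sin (aff l x).
Proof.
have h v : 'D_v (fun y => 'D_v (fun z => sin (aff l z)) y) x = - (lin l.1 v ^+ 2) * sin (aff l x).
  have -> : (fun y => 'D_v (fun z => sin (aff l z)) y) = fun y => lin l.1 v * cos (aff l y).
    apply/funext => y; have [_ ->] := diff_comp_aff v (is_derive_sin (aff l y)); ring.
  have := congr1 (fun F => F x) (SM_deriveZ (lin l.1 v) v (SM_cos l)) => /= ->.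
  have [_ ->] := diff_comp_aff v (is_derive_cos (aff l x)); ring.
by apply: etrans (f_equal2 +%R (h e1) (h e2)) _; rewrite /lin /=; ring.
Qed.

Variables (p q o : R * R).

Definition freq k : (R * R) * R :=
  ((2 * pi * fx p q k, 2 * pi * fy p q k), 2 * pi * (k.1%:~R * o.1 + k.2%:~R * o.2)).

Lemma phase_aff k x : phase p q o k x = aff (freq k) x.
Proof. by rewrite /phase /angk /fs /ft /aff /freq /fx /fy /=; ring. Qed.

Definition energy k : R := (2 * pi) ^+ 2 * fQ p q k.

Lemma Lap_ck k x : Lap (ck p q o k) x = - energy k * ck p q o k x.
Proof.
have -> : ck p q o k = fun x => cos (aff (freq k) x).
  by apply/funext => y; rewrite -phase_aff.
by rewrite Lap_cos_aff /energy /fQ /=; ring.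
Qed.

Lemma Lap_sk k x : Lap (sk p q o k) x = - energy k * sk p q o k x.
Proof.
have -> : sk p q o k = fun x => sin (aff (freq k) x).
  by apply/funext => y; rewrite -phase_aff.
by rewrite Lap_sin_aff /energy /fQ /=; ring.
Qed.

End Laplacian.

Section Modes.
Context {R : realType}.
Variables (p q o : R * R).
Hypothesis fdet0 : fdet p q != 0.
Implicit Types (x : plane R) (k m : int * int) (W : seq intmx).

Lemma Lap_cst (a : R) x : Lap (fun=> a) x = 0.
Proof.
have z v : (fun y : plane R => 'D_v (fun=> a : R^o) y) = fun=> 0.
  by apply/funext => y; exact: derive_cst.
have h v : 'D_v (fun y : plane R => 'D_v (fun=> a : R^o) y) x = 0.
  exact: (etrans (congr1 (fun F : plane R -> R => 'D_v F x) (z v)) (derive_cst _ _ _)).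
exact: (etrans (f_equal2 +%R (h e1) (h e2)) (addr0 0)).
Qed.

Lemma Lap_sum (I : Type) (s : seq I) (F : I -> plane R -> R) (c : R) x : (forall i, SM (F i)) ->
  (forall i x, Lap (F i) x = c * F i x) ->
  Lap (fun y => \sum_(i <- s) F i y) x = c * \sum_(i <- s) F i x.
Proof.
move=> hF hc; elim: s => [|i s ih].
  have -> : (fun y : plane R => \sum_(i <- [::]) F i y) = fun=> 0.
    by apply/funext => y; rewrite big_nil.
  by rewrite Lap_cst big_nil mulr0.
have -> : (fun y : plane R => \sum_(j <- i :: s) F j y) =
    fun y => F i y + \sum_(j <- s) F j y.
  by apply/funext => y; rewrite big_cons.
rewrite big_cons LapD//; last exact: SM_sum.
by rewrite hc ih mulrDr.
Qed.

Definition mode W (i : bool * (int * int)) : PT R -> R :=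
  anti p q o W (if i.1 then tc i.2 else ts i.2).

Definition wave (b : bool) k : plane R -> R := if b then ck p q o k else sk p q o k.

Lemma modeE W b k : mode W (b, k) = fun x => \sum_(w <- W) (wdet w)%:~R * wave b (kact w k) x.
Proof.
by apply/funext => x; case: b; rewrite /mode /=; [exact: anti_tc|exact: anti_ts].
Qed.

Lemma SM_wave b k : SM (wave b k).
Proof. by case: b; [exact: (SM_phase_trig p q o k).1|exact: (SM_phase_trig p q o k).2]. Qed.

Lemma SM_mode W i : SM (mode W i : plane R -> R).
Proof. by case: i => b k; rewrite modeE; apply: SM_sum => w; apply: SM_scale; exact: SM_wave. Qed.

Lemma Lap_mode W i x : (forall w k, w \in W -> fQ p q (kact w k) = fQ p q k) ->
  Lap (mode W i : plane R -> R) x = - energy p q i.2 * mode W i x.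
Proof.
case: i => b k hW; rewrite modeE /=.
(* Terms outside [W] are set to zero so that the eigenvalue equation holds for every index, as
   [Lap_sum] asks. *)
pose F w : plane R -> R := if w \in W then (fun x => (wdet w)%:~R * wave b (kact w k) x)
  else fun=> 0.
have FE : (fun x => \sum_(w <- W) (wdet w)%:~R * wave b (kact w k) x) =
    fun x => \sum_(w <- W) F w x.
  by apply/funext => y; apply: eq_big_seq => w wW; rewrite /F wW.
rewrite FE [in RHS](congr1 (fun G => G x) FE).
apply: Lap_sum => [w|w y]; rewrite /F; case: ifPn => wW.
- by apply: SM_scale; exact: SM_wave.
- exact: SM_cst.
- rewrite LapZ; last exact: SM_wave.
  have -> : energy p q k = energy p q (kact w k) by rewrite /energy hW.
  by rewrite mulrCA; congr (_ * _); case: (b); [exact: Lap_ck|exact: Lap_sk].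
- by rewrite mulr0 Lap_cst.
Qed.

End Modes.

(** * Real combinations of modes as trigonometric polynomials *)

Section RealTrig.
Context {R : realType}.
Variables (p q o : R * R) (K : seq (int * int)).
Hypothesis uK : uniq K.
Implicit Types (x : PT R) (k m : int * int).

Definition real_trig (g : PT R -> R) : Prop :=
  exists a b, forall x, reU p q o K a b x = g x /\ imU p q o K a b x = 0.

Lemma real_trig0 : real_trig (fun=> 0).
Proof.
exists (fun=> 0), (fun=> 0) => x; rewrite /reU /imU.
by split; apply: big1 => k _; rewrite !mul0r ?subr0 ?addr0.
Qed.

Lemma real_trigD g h : real_trig g -> real_trig h -> real_trig (fun x => g x + h x).
Proof.
move=> [a [b hg]] [a' [b' hh]]; exists (fun k => a k + a' k), (fun k => b k + b' k) => x.
have [<- g0] := hg x; have [<- h0] := hh x.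
split; first by rewrite -big_split; apply: eq_bigr => k _ /=; ring.
transitivity (imU p q o K a b x + imU p q o K a' b' x); last by rewrite g0 h0 addr0.
by rewrite -big_split; apply: eq_bigr => k _ /=; ring.
Qed.

Lemma real_trigZ c g : real_trig g -> real_trig (fun x => c * g x).
Proof.
move=> [a [b hg]]; exists (fun k => c * a k), (fun k => c * b k) => x.
have [<- g0] := hg x.
split; first by rewrite mulr_sumr; apply: eq_bigr => k _ /=; ring.
by rewrite -[RHS](mulr0 c) -g0 mulr_sumr; apply: eq_bigr => k _ /=; ring.
Qed.

Lemma sum_pick m (F : int * int -> R) : m \in K ->
  \sum_(k <- K) (k == m)%:R * F k = F m.
Proof.
move=> mK; rewrite (bigD1_seq m)//= eqxx mul1r big1 ?addr0// => k /negbTE ->.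
by rewrite mul0r.
Qed.

(** Euler's formulas. The coefficients are combinations of the indicators of m and - m, which also
    covers m = - m. *)
Lemma real_trig_wave b m : m \in K -> - m \in K -> real_trig (wave p q o b m).
Proof.
move=> mK nK.
have ckN x : ck p q o (- m) x = ck p q o m x.
  by rewrite /ck /phase /angk /= !intrN -cosN; congr cos; ring.
have skN x : sk p q o (- m) x = - sk p q o m x.
  by rewrite /sk /phase /angk /= !intrN -sinN; congr sin; ring.
case: b.
  exists (fun k => (1 / 2) * ((k == m)%:R + (k == - m)%:R)), (fun=> 0) => x.
  split.
    transitivity (1 / 2 * (\sum_(k <- K) (k == m)%:R * ck p q o k x +
        \sum_(k <- K) (k == - m)%:R * ck p q o k x)).
      by rewrite -big_split mulr_sumr; apply: eq_bigr => k _ /=; ring.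
    by rewrite !sum_pick// ckN /=; field.
  transitivity (1 / 2 * (\sum_(k <- K) (k == m)%:R * sk p q o k x +
      \sum_(k <- K) (k == - m)%:R * sk p q o k x)).
    by rewrite -big_split mulr_sumr; apply: eq_bigr => k _ /=; ring.
  by rewrite !sum_pick// skN subrr mulr0.
exists (fun=> 0), (fun k => (1 / 2) * ((k == - m)%:R - (k == m)%:R)) => x.
split.
  transitivity (1 / 2 * (\sum_(k <- K) (k == m)%:R * sk p q o k x -
      \sum_(k <- K) (k == - m)%:R * sk p q o k x)).
    by rewrite -sumrB mulr_sumr; apply: eq_bigr => k _ /=; ring.
  by rewrite !sum_pick// skN /=; field.
transitivity (1 / 2 * (\sum_(k <- K) (k == - m)%:R * ck p q o k x -
    \sum_(k <- K) (k == m)%:R * ck p q o k x)).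
  by rewrite -sumrB mulr_sumr; apply: eq_bigr => k _ /=; ring.
by rewrite !sum_pick// ckN subrr mulr0.
Qed.

Lemma real_trig_mode W i : (forall k, k \in K -> - k \in K) ->
  (forall w k, w \in W -> k \in K -> kact w k \in K) -> i.2 \in K ->
  real_trig (mode p q o W i).
Proof.
case: i => b k KN KW /= kK; rewrite modeE.
elim: W KW => [|w W ih] KW.
  by under eq_fun do rewrite big_nil; exact: real_trig0.
under eq_fun do rewrite big_cons.
apply: real_trigD.
  have wK : kact w k \in K by rewrite KW// mem_head.
  by apply: real_trigZ; apply: real_trig_wave => //; exact: KN.
by apply: ih => v l vW; apply: KW; rewrite inE vW orbT.
Qed.

Lemma real_trig_lspan W s g : (forall k, k \in K -> - k \in K) ->
  (forall w k, w \in W -> k \in K -> kact w k \in K) ->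
  (forall i, i \in s -> i.2 \in K) -> lspan (mode p q o W) s g -> real_trig g.
Proof.
move=> KN KW sK; elim=> [|i c h si _ ih]; first exact: real_trig0.
by apply: real_trigD ih; apply: real_trigZ; apply: real_trig_mode => //; exact: sK.
Qed.

(** The coefficients are those of g + i h, which brings a complex eigenfunction into the form of the
    torus bound with the same frequency list. *)
Lemma real_trig_pair g h : real_trig g -> real_trig h ->
  exists a b, forall x, en p q o K a b x = g x ^+ 2 + h x ^+ 2.
Proof.
move=> [a [b hg]] [a' [b' hh]]; exists (fun k => a k - b' k), (fun k => b k + a' k) => x.
have [<- g0] := hg x; have [<- h0] := hh x; rewrite /en; congr (_ ^+ 2 + _ ^+ 2).
  transitivity (reU p q o K a b x - imU p q o K a' b' x); last by rewrite h0 subr0.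
  by rewrite -sumrB; apply: eq_bigr => k _ /=; ring.
transitivity (imU p q o K a b x + reU p q o K a' b' x); last by rewrite g0 add0r.
by rewrite -big_split; apply: eq_bigr => k _ /=; ring.
Qed.

End RealTrig.

(** * Eigenfunctions of one domain and their lower bound *)

Section Eigenfunctions.
Context {R : realType}.
Local Notation Re := complex.Re.
Local Notation Im := complex.Im.
Variables (p q o : R * R) (r : seq ((R * R) * R)) (M : R) (W : seq intmx).
Hypothesis fdet0 : fdet p q != 0.
Local Notation Om := (walls r).
Local Notation fs := (fs p o).
Local Notation ft := (ft q o).
Local Notation sig := (sig p q o).
Local Notation mode := (mode p q o W).
Hypothesis OmM : Om `<=` sq M.
Hypothesis Omcell : forall x, Om x -> 0 <= fs x < 1 /\ 0 <= ft x < 1.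
Hypotheses (uW : uniq W) (idW : idmx \in W).
Hypothesis fund : forall w x x' (n : int * int), w \in W -> Om x -> Om x' ->
  (wact w (sig x)).1 = fs x' + n.1%:~R -> (wact w (sig x)).2 = ft x' + n.2%:~R -> w = idmx.
Hypothesis mode_wall : forall l i, l \in r ->
  exists C, forall x, Om x -> `|mode i x| <= C * aff l x.
Hypothesis fQW : forall w k, w \in W -> fQ p q (kact w k) = fQ p q k.
Implicit Types (x : plane R) (i j : bool * (int * int)) (u : plane R -> R[i]%C).

Let mOm : measurable (Om : set (PT R)) := measurable_walls r.
Let Omoo : (leb2 Om < +oo)%E := walls_finite OmM.

Lemma H10_mode i : H10 Om (cx (mode i)).
Proof. by apply: (H10_SM fdet0 OmM Omcell) => [|l lr]; [exact: SM_mode|exact: mode_wall]. Qed.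

Lemma bmf_mode i : bmf (mode i).
Proof. exact: SM_bmf (SM_mode p q o W i). Qed.

Lemma green_mode u gu b i : H10 Om u -> weak_grad Om u gu ->
  \int[leb2]_(x in Om) (part b (gu.1 x) * 'D_e1 (mode i : plane R -> R) x) +
  \int[leb2]_(x in Om) (part b (gu.2 x) * 'D_e2 (mode i : plane R -> R) x)
  = energy p q i.2 * \int[leb2]_(x in Om) (part b (u x) * mode i x).
Proof.
move=> hu hg; apply: (green mOm Omoo) => //; first exact: SM_mode.
by move=> x; exact: (Lap_mode o i x fQW).
Qed.

(** Symmetry of the Dirichlet form, which Green's identity evaluates with either of the two
    energies. *)
Lemma mode_orth i j : energy p q i.2 != energy p q j.2 ->
  \int[leb2]_(x in Om) (mode i x * mode j x) = 0.
Proof.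
move=> ij.
have gi := weak_grad_SM mOm Omoo (SM_mode p q o W i).
have gj := weak_grad_SM mOm Omoo (SM_mode p q o W j).
have k1 := green_mode true j (H10_mode i) gi; have k2 := green_mode true i (H10_mode j) gj.
have comm (f g : plane R -> R) : \int[leb2]_(x in Om) (f x * g x) = \int[leb2]_(x in Om) (g x * f x).
  by apply: eq_Rintegral => x _; rewrite mulrC.
move: k1 k2; rewrite /part /= => k1 k2.
have e : energy p q j.2 * \int[leb2]_(x in Om) (mode i x * mode j x) =
    energy p q i.2 * \int[leb2]_(x in Om) (mode i x * mode j x).
  rewrite [in RHS]comm; apply: etrans (etrans (esym k1) _) k2.
  exact: (f_equal2 +%R (comm ('D_e1 (mode i : plane R -> R)) ('D_e1 (mode j : plane R -> R)))
    (comm ('D_e2 (mode i : plane R -> R)) ('D_e2 (mode j : plane R -> R)))).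
apply/eqP; move/eqP: e; rewrite -subr_eq0 -mulrBl mulf_eq0 subr_eq0 eq_sym (negbTE ij) /=.
by [].
Qed.

Lemma L2inner_cx (f : plane R -> R[i]%C) (g : plane R -> R) b :
  part b (L2inner Om f (cx g)) = \int[leb2]_(x in Om) (part b (f x) * g x).
Proof.
case: b; rewrite /L2inner /part ?ReCint ?ImCint; apply: eq_Rintegral => x _.
  by rewrite Re_mul Re_conj Im_conj Re_cx Im_cx oppr0 mulr0 subr0.
by rewrite Im_mul Re_conj Im_conj Re_cx Im_cx oppr0 mulr0 add0r.
Qed.

(** Testing the eigenvalue equation against the mode and applying Green's identity multiplies the
    same complex pairing by the energy on one side and by [lam] on the other. Since [lam] may be
    complex, this is a real 2 x 2 system in the two parts, of determinant |energy - lam|^2. *)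
Lemma eigen_orth lam u i b : dirichlet_eigenspace Om lam u ->
  ~ (energy p q i.2 = Re lam /\ Im lam = 0) ->
  \int[leb2]_(x in Om) (part b (u x) * mode i x) = 0.
Proof.
move=> [hu _ eig] ne; have [[Lu [gu hgu]] _] := hu.
have [iR iI] := L2_integrable mOm Omoo Lu.
have sm := SM_mode p q o W i; have wg := weak_grad_SM mOm Omoo sm.
have key := eig _ hgu _ _ (H10_mode i) wg.
have kb c : energy p q i.2 * \int[leb2]_(x in Om) (part c (u x) * mode i x) =
    \int[leb2]_(x in Om) (part c (lam * u x + 0) * mode i x).
  rewrite -(green_mode c i hu hgu).
  have := congr1 (part c) key; rewrite L2inner_cx => <-.
  have partD z w : part c (z + w) = part c z + part c w by case: c; rewrite /part ?Re_add ?Im_add.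
  by rewrite partD; congr (_ + _); rewrite L2inner_cx.
have iA : leb2.-integrable Om (EFin \o (fun x => Re (u x) * mode i x)).
  exact: (integrable_bmfM mOm iR (bmf_mode i)).
have iB : leb2.-integrable Om (EFin \o (fun x => Im (u x) * mode i x)).
  exact: (integrable_bmfM mOm iI (bmf_mode i)).
have k1 := kb true; have k2 := kb false; move: k1 k2; rewrite /part.
set A := \int[leb2]_(x in Om) (Re (u x) * mode i x).
set B := \int[leb2]_(x in Om) (Im (u x) * mode i x).
have -> : \int[leb2]_(x in Om) (Re (lam * u x + 0) * mode i x) = Re lam * A - Im lam * B.
  rewrite -!RintegralZl// -RintegralB//;
    [|exact: (integrableZl mOm _ iA)|exact: (integrableZl mOm _ iB)].
  by apply: eq_Rintegral => x _; rewrite addr0 Re_mul mulrBl !mulrA.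
have -> : \int[leb2]_(x in Om) (Im (lam * u x + 0) * mode i x) = Re lam * B + Im lam * A.
  rewrite -!RintegralZl// -RintegralD//;
    [|exact: (integrableZl mOm _ iB)|exact: (integrableZl mOm _ iA)].
  by apply: eq_Rintegral => x _; rewrite addr0 Im_mul mulrDl !mulrA.
move=> k1 k2; have [A0 B0] : A = 0 /\ B = 0; last by case: (b).
move: k1 k2 ne; move: (energy p q i.2) (Re lam) (Im lam) A B => m c d A B k1 k2 ne.
have D0 : (m - c) ^+ 2 + d ^+ 2 != 0.
  apply/negP; rewrite paddr_eq0 ?sqr_ge0// !sqrf_eq0 subr_eq0 => /andP[/eqP h1 /eqP h2].
  exact: ne.
split; apply: (mulfI D0); rewrite mulr0.
  have -> : ((m - c) ^+ 2 + d ^+ 2) * A = (m - c) * (m * A - (c * A - d * B))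
     - d * (m * B - (c * B + d * A)) by ring.
  by rewrite k1 k2 !subrr !mulr0 subr0.
have -> : ((m - c) ^+ 2 + d ^+ 2) * B = (m - c) * (m * B - (c * B + d * A))
   + d * (m * A - (c * A - d * B)) by ring.
by rewrite k1 k2 !subrr !mulr0 addr0.
Qed.

(** Each part of [u] minus its projection onto the modes of energy [lam] is orthogonal to those
    modes by construction and to all others by [eigen_orth] and [mode_orth]. Completeness makes the
    remainder null. *)
Lemma eigen_trig lam u : dirichlet_eigenspace Om lam u ->
  exists K a b mu, [/\ uniq K, forall k, k \in K -> fQ p q k = mu &
    {ae leb2, forall x : PT R, Om x -> Normc.normc (u x) ^+ 2 = en p q o K a b x}].
Proof.
move=> eig; have [[[Lu _] _] _ _] := eig.
have [iR iI] := L2_integrable mOm Omoo Lu.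
have pi0 : (2 * pi : R) ^+ 2 != 0 by rewrite expf_neq0// mulf_neq0// gt_eqF// pi_gt0.
pose mu := Re lam / (2 * pi) ^+ 2.
have muE k : (energy p q k == Re lam) = (fQ p q k == mu).
  rewrite /energy /mu; apply/eqP/eqP => [<-|->]; last by rewrite mulrC divfK.
  by rewrite [_ * fQ _ _ _]mulrC mulfK.
have [K0 uK0 hK0] := disc_finite fdet0 mu.
(* Empty when [lam] is not real; the conclusion then says that [u] vanishes almost everywhere on the
   domain. *)
pose K := [seq k <- K0 | (fQ p q k == mu) && (Im lam == 0)].
have inK k : (k \in K) = (fQ p q k == mu) && (Im lam == 0).
  rewrite mem_filter; case: eqP => //= fk; case: (Im lam == 0) => //=.
  by apply: hK0; rewrite fk.
pose s := [seq (b, k) | b <- [:: true; false], k <- K].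
have ins i : (i \in s) = (i.2 \in K).
  case: i => b k; apply/allpairsP/idP => [[[b' k'] [/= _ kK [_ ->]]]//|/= kK].
  by exists (b, k); split => //; case: (b).
have proj c : exists2 g, lspan mode s g &
    {ae leb2, forall x : PT R, Om x -> part c (u x) = g x}.
  have ic : leb2.-integrable Om (EFin \o (fun x => part c (u x))) by case: (c).
  have [g sg og] := projection mOm Omoo bmf_mode s ic.
  have bg := lspan_bmf bmf_mode sg.
  exists g => //.
  have id : leb2.-integrable Om (EFin \o (fun x => part c (u x) - g x)).
    exact: (integrableB mOm ic (bmf_integrable mOm Omoo bg)).
  have z i : \int[leb2]_(x in Om) ((part c (u x) - g x) * mode i x) = 0.
    have [/og//|nis] := boolP (i \in s).
    have gi := integrable_bmfM mOm (bmf_integrable mOm Omoo bg) (bmf_mode i).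
    transitivity (\int[leb2]_(x in Om) (part c (u x) * mode i x) -
        \int[leb2]_(x in Om) (g x * mode i x)).
      rewrite -RintegralB//; last exact: (integrable_bmfM mOm ic (bmf_mode i)).
      by apply: eq_Rintegral => x _; rewrite mulrBl.
    rewrite (eigen_orth c eig); last first.
      move=> [e1 e2]; move: nis; rewrite ins inK -muE e1 e2 !eqxx//.
    rewrite (_ : \int[leb2]_(x in Om) (g x * mode i x) = 0) ?subr0//.
    transitivity (\int[leb2]_(x in Om) (mode i x * g x)).
      by apply: eq_Rintegral => x _; rewrite mulrC.
    apply: (lspan_orth mOm bmf_mode (bmf_integrable mOm Omoo (bmf_mode i)) sg) => j js.
     apply: mode_orth; move: nis js; rewrite !ins !inK -!muE.
    by move=> h /andP[/eqP e2 im0]; move: h; rewrite im0 andbT e2.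
  have := @ae_null R p q o fdet0 Om W _ mOm id uW idW Omcell fund.
  case=> [k|N [? ? sub]].
    split; [rewrite -[RHS](z (true, k))|rewrite -[RHS](z (false, k))];
      apply: eq_Rintegral => x _; congr (_ * _); apply: esym.
      exact: anti_tc.
    exact: anti_ts.
  exists N; split => // x nx; apply: sub => zx; apply: nx => Omx.
  by have [/eqP] := zx Omx; rewrite subr_eq0 => /eqP.
have [g1 s1 h1] := proj true; have [g2 s2 h2] := proj false.
have KN k : k \in K -> - k \in K.
  rewrite !inK; congr (_ && _); congr (_ == _); rewrite /fQ /fx /fy /= !intrN; ring.
have KW w k : w \in W -> k \in K -> kact w k \in K.
  by move=> wW; rewrite !inK fQW.
have sK i : i \in s -> i.2 \in K by rewrite ins.
have uK : uniq K by rewrite filter_uniq.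
have [a [b abE]] := real_trig_pair (real_trig_lspan uK KN KW sK s1) (real_trig_lspan uK KN KW sK s2).
exists K, a, b, mu; split => // [k|]; first by rewrite inK => /andP[/eqP].
apply: filterS2 h1 h2 => x h1 h2 Omx.
by rewrite normc_sq abE -(h1 Omx) -(h2 Omx).
Qed.

Lemma domain_bound (A : set (PT R)) : measurable A -> A `<=` Om -> (0 < leb2 A)%E ->
  exists2 c : R, 0 < c & forall lam u, dirichlet_eigenspace Om lam u ->
    c * L2norm Om u <= L2norm A u.
Proof.
move=> mA AOm A0.
have OmP : Om `<=` Pcell p q o by move=> x /Omcell.
have [dl dl0 hdl] := torus_lower fdet0 mA (subset_trans AOm OmP) A0.
pose P := fine (leb2 (Pcell p q o)).
have P0 : 0 <= P by rewrite fine_ge0.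
have P10 : 0 < P + 1 by rewrite ltr_wpDl.
(* The squared norm over [Om] is at most the integral of [en] over the cell, which by Parseval is
   [P] times the sum of the squared coefficients. Writing [P + 1] keeps the denominator positive. *)
exists (Num.sqrt (dl / (P + 1))); first by rewrite sqrtr_gt0 divr_gt0.
move=> lam u eig; have [K [a [b [mu [uK hK hae]]]]] := eigen_trig eig.
have [[[[mR mI iu] _] _] _ _] := eig.
have ie := bmf_integrable mOm Omoo (bmf_en p q o K a b).
have e0 x : 0 <= en p q o K a b x by exact: en_ge0.
have aeq D : measurable D -> D `<=` Om ->
    \int[leb2]_(x in D) (Normc.normc (u x) ^+ 2) = \int[leb2]_(x in D) en p q o K a b x.
  move=> mD DOm; rewrite /Rintegral; congr fine; apply: ae_eq_integral => //.
  - exact: measurable_funS mOm DOm (measurable_int _ iu).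
  - exact: measurable_funS mOm DOm (measurable_int _ ie).
  - by apply: filterS hae => x hx Dx; rewrite /= hx//; exact: DOm.
rewrite /L2norm -sqrtrM; last by rewrite divr_ge0// ltW.
rewrite ler_wsqrtr// aeq// [leRHS]aeq//.
apply: le_trans (hdl mu K a b uK hK).
rewrite mulrAC ler_pdivrMr// -mulrA; apply: ler_wpM2l; first exact: ltW.
apply: le_trans (_ : P * nrm K a b <= _); last first.
  by rewrite mulrC; apply: ler_wpM2l; [exact: nrm_ge0|lra].
rewrite -(parseval_cell o fdet0 a b uK); apply: Rintegral_subset => //.
- exact: measurable_P.
- exact: (bmf_integrable (measurable_P p q o) (leb2_P o fdet0) (bmf_en p q o K a b)).
Qed.

End Eigenfunctions.

(** * From Lebesgue measurable sets to their Borel cores *)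

Section LebesgueSets.
Context {R : realType}.
Implicit Types (u : plane R -> R[i]%C).

(** If the Borel part were null, V would lie in a Borel null set and its outer measure would be
    zero. *)
Lemma lebesgue_core (V : set (plane R)) : lebesgue_measurable2 V -> (0 < area V)%E ->
  exists A N : set (PT R), [/\ V = A `|` N, measurable A, leb2.-negligible N & (0 < leb2 A)%E].
Proof.
move=> [A mA [N nN <-]] h; exists A, N; split => //; rewrite lt0e measure_ge0 andbT.
apply/negP => /eqP A0; move: h.
have nA : leb2.-negligible A by exists A; split.
have [B [mB B0 sB]] := negligibleU nA nN.
rewrite ltNge => /negP; apply; rewrite /area.
apply: le_trans (le_mu_ext leb2 sB) _.
by have -> : (leb2^*%mu B = 0)%E by rewrite -B0; exact: measurable_mu_extE.
Qed.

Lemma L2norm_eq0 (Om : set (plane R)) u : measurable (Om : set (PT R)) -> L2 Om u ->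
  L2norm Om u = 0 -> L2zero Om u.
Proof.
move=> mOm [_ _ iu] /eqP; rewrite sqrtr_eq0 => h.
have z : ae_eq leb2 Om (EFin \o (fun x => Normc.normc (u x) ^+ 2)) (cst 0%E).
  apply/(ae_eq_integral_abs leb2 mOm (measurable_int _ iu)).
  have -> : (\int[leb2]_(x in Om) `|(EFin \o (fun x => (Normc.normc (u x) ^+ 2)%R)) x| =
      \int[leb2]_(x in Om) (EFin \o (fun x => (Normc.normc (u x) ^+ 2)%R)) x)%E.
    by apply: eq_integral => x _; rewrite /= ger0_norm// sqr_ge0.
  have h0 : \int[leb2]_(x in Om) (Normc.normc (u x) ^+ 2) = 0.
    by apply/eqP; rewrite eq_le h Rintegral_ge0// => x _; exact: sqr_ge0.
  by move: h0; rewrite /Rintegral => h0; rewrite -(fineK (integrable_fin_num mOm iu)) h0.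
apply: filterS z => x zx Omx; have [/eqP] := zx Omx.
by rewrite sqrf_eq0 => /eqP /(congr1 (real_complex R)); exact: eq0_normC.
Qed.

(** Only Borel subsets are tested here; the null part of a Lebesgue set does not change the norm and
    is added in [observable_lower]. *)
Definition observable (Om : set (plane R)) := measurable (Om : set (PT R)) /\
  forall A : set (PT R), measurable A -> A `<=` Om -> (0 < leb2 A)%E ->
  exists2 c : R, 0 < c & forall lam u, dirichlet_eigenspace Om lam u ->
    c * L2norm Om u <= L2norm A u.

Lemma observable_lower (Om V : set (plane R)) : observable Om -> V `<=` Om ->
  lebesgue_measurable2 V -> (0 < area V)%E ->
  (exists2 c : R, 0 < c &
     forall (lambda : R[i]%C) (u : plane R -> R[i]%C),
       spectrum Om lambda -> dirichlet_eigenspace Om lambda u ->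
       c * L2norm Om u <= L2norm V u) /\
  (0 < C2 V Om)%E.
Proof.
move=> [mOm hOm] VOm mV V0; have [A [N [VE mA nN A0]]] := lebesgue_core mV V0.
have [c c0 hc] : exists2 c : R, 0 < c & forall lam u, dirichlet_eigenspace Om lam u ->
    c * L2norm Om u <= L2norm V u.
  have AOm : A `<=` Om by move=> x Ax; apply: VOm; rewrite VE; left.
  have [c c0 hc] := hOm A mA AOm A0; exists c => // lam u eig.
  by rewrite VE L2norm_setU_negligible//; exact: hc eig.
split; first by exists c => // lam u _; exact: hc.
apply: (@lt_le_trans _ _ c%:E); first by rewrite lte_fin.
apply: le_ereal_inf_tmp => _ [lam _ <-]; apply: le_ereal_inf_tmp => _ [u [eig nz] <-].
have [[[Lu _] _] _ _] := eig.
have n0 : 0 < L2norm Om u.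
  rewrite lt_neqAle sqrtr_ge0 andbT eq_sym; apply/negP => /eqP z.
  by apply: nz; exact: L2norm_eq0.
by rewrite lee_fin ler_pdivlMr//; exact: hc eig.
Qed.

End LebesgueSets.

(** * The four polygons *)

Section Mirrors.
Context {R : realType}.
Implicit Types (y z : PT R) (F : PT R -> R) (W : seq intmx) (d : (R * R) * R).

Definition wmul (w v : intmx) : intmx :=
  ((w.1.1 * v.1.1 + w.1.2 * v.2.1, w.1.1 * v.1.2 + w.1.2 * v.2.2),
   (w.2.1 * v.1.1 + w.2.2 * v.2.1, w.2.1 * v.1.2 + w.2.2 * v.2.2)).

Lemma wdet_wmul w v : wdet (wmul w v) = wdet w * wdet v.
Proof. by rewrite /wdet /wmul /=; ring. Qed.

(* The reflection in the line [d = 0] lies in the affine group [W * Z^2]. *)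
Definition mirror W d := exists (rho : intmx) (n : int * int) (v : R * R),
  [/\ perm_eq [seq wmul w rho | w <- W] W, wdet rho = -1 &
    forall y, (wact rho y).1 + n.1%:~R = y.1 + aff d y * v.1 /\
              (wact rho y).2 + n.2%:~R = y.2 + aff d y * v.2].

Definition alt W F y : R := \sum_(w <- W) (wdet w)%:~R * F (wact w y).

(** Reindexing by w -> w rho reverses every determinant, and periodicity of [F] absorbs the integer
    translation. *)
Lemma alt_mirror W F rho (n : int * int) y y' :
  perm_eq [seq wmul w rho | w <- W] W -> wdet rho = -1 ->
  (forall y (n : int * int), F (y.1 + n.1%:~R, y.2 + n.2%:~R) = F y) ->
  (wact rho y).1 + n.1%:~R = y'.1 -> (wact rho y).2 + n.2%:~R = y'.2 ->
  alt W F y' = - alt W F y.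
Proof.
move=> pW drho per h1 h2; rewrite /alt -[in RHS](perm_big _ pW) big_map -sumrN.
apply: eq_bigr => w _; rewrite wdet_wmul drho mulrN1 intrN mulNr opprK; congr (_ * _).
rewrite -[RHS](per _ (w.1.1 * n.1 + w.1.2 * n.2, w.2.1 * n.1 + w.2.2 * n.2)).
by congr F; rewrite /wact -h1 -h2 /wact /wmul /= !intrD !intrM; congr pair; ring.
Qed.

(** The alternating sum is odd under the reflection y -> y', so it equals half the difference of its
    values at y and y'. The Lipschitz bound compares this with y - y' = - aff d y * v, which is
    linear in the distance to the wall. *)
Lemma alt_wall W F (L : R) d : 0 <= L ->
  (forall y z, `|F y - F z| <= L * (`|y.1 - z.1| + `|y.2 - z.2|)) ->
  (forall y (n : int * int), F (y.1 + n.1%:~R, y.2 + n.2%:~R) = F y) ->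
  mirror W d -> exists C, forall y, 0 < aff d y -> `|alt W F y| <= C * aff d y.
Proof.
move=> L0 lipF per [rho [n [v [pW drho hrho]]]].
pose c (w : intmx) := L * (`|w.1.1%:~R * v.1 + w.1.2%:~R * v.2| + `|w.2.1%:~R * v.1 + w.2.2%:~R * v.2|).
exists (1 / 2 * \sum_(w <- W) `|(wdet w)%:~R| * c w) => y d0.
pose y' : PT R := (y.1 + aff d y * v.1, y.2 + aff d y * v.2).
have [h1 h2] := hrho y.
have flip : alt W F y' = - alt W F y by apply: (@alt_mirror _ F rho n) => //.
have -> : alt W F y = 1 / 2 * (alt W F y - alt W F y') by rewrite flip; field.
rewrite normrM ger0_norm ?divr_ge0// -[leRHS]mulrA ler_wpM2l ?divr_ge0//.
rewrite /alt -sumrB mulr_suml; apply: le_trans (ler_norm_sum _ _ _) _.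
apply: ler_sum => w _; rewrite -mulrBr normrM -mulrA ler_wpM2l//.
apply: le_trans (lipF _ _) _; rewrite /c -mulrA ler_wpM2l// mulrDl.
have key (a b : R) : `|a * y.1 + b * y.2 - (a * y'.1 + b * y'.2)| = `|a * v.1 + b * v.2| * aff d y.
  rewrite -[in RHS](gtr0_norm d0) -normrM -normrN; congr `|_|; rewrite /y' /=; ring.
by rewrite /wact /= !key.
Qed.

Definition trig (b : bool) : R -> R := if b then cos else sin.

Lemma trig_lip b (s t : R) : `|trig b s - trig b t| <= `|s - t|.
Proof.
wlog st : s t / t <= s.
  move=> h; have [/h//|/ltW/h] := leP t s.
  by rewrite distrC [leRHS]distrC.
have hd x : is_derive x (1 : R) (trig b : R -> R) (if b then - sin x else cos x).
  by case: b; [exact: is_derive_cos|exact: is_derive_sin].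
have [x _ ->] : exists2 x, x \in `[t, s] & trig b s - trig b t =
    (if b then - sin x else cos x) * (s - t).
  apply: MVT_segment => //.
  apply: continuous_subspaceT => x; apply: differentiable_continuous.
  by apply/derivable1_diffP; have [] := hd x.
rewrite normrM ler_piMl//; case: (b); first by rewrite normrN; exact: sin_max.
exact: cos_max.
Qed.

Lemma trigD2pi_int b (t : R) (n : int) : trig b (t + 2 * pi * n%:~R) = trig b t.
Proof.
case: b; first exact: cosD2pi_int.
have h (x : R) : sin x = cos (x - pi / 2).
  by rewrite cosB cos_pihalf sin_pihalf mulr0 add0r mulr1.
by rewrite /trig !h -[RHS](cosD2pi_int _ n); congr cos; ring.
Qed.

Lemma trig_wall W d b k : mirror W d ->
  exists C, forall y, 0 < aff d y ->
    `|alt W (fun y => trig b (angk k y.1 y.2)) y| <= C * aff d y.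
Proof.
have pi0 : 0 <= 2 * pi :> R by rewrite mulr_ge0// pi_ge0.
apply: (@alt_wall _ _ (2 * pi * (`|k.1%:~R| + `|k.2%:~R|))).
- by rewrite mulr_ge0// addr_ge0.
- move=> y z; apply: le_trans (trig_lip _ _ _) _.
  rewrite /angk -mulrBr normrM ger0_norm// -mulrA ler_wpM2l//.
  have -> : k.1%:~R * y.1 + k.2%:~R * y.2 - (k.1%:~R * z.1 + k.2%:~R * z.2) =
    k.1%:~R * (y.1 - z.1) + k.2%:~R * (y.2 - z.2) :> R by ring.
  apply: le_trans (ler_normD _ _) _; rewrite !normrM.
  move: (normr_ge0 (k.1%:~R : R)) (normr_ge0 (k.2%:~R : R)) (normr_ge0 (y.1 - z.1)) (normr_ge0 (y.2 - z.2)).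
  by move: `|_| `|_| `|_| `|_| => A B C E; nra.
- move=> y n; rewrite -[RHS](trigD2pi_int _ _ (k.1 * n.1 + k.2 * n.2)).
  by congr trig; rewrite /angk /= intrD !intrM; ring.
Qed.

End Mirrors.

(** * Transport of a polygon to alcove coordinates *)

Section Frames.
Context {R : realType}.
Implicit Types (x O e f : plane R) (D : seq ((R * R) * R)) (W : seq intmx).

(** The chart rows [p], [q] form the basis dual to [e], [f]. Up to the squared determinant, |k.1 p +
    k.2 q|^2 is the quadratic form of the last hypothesis, which therefore says that [W] preserves
    the energy of a frequency. *)
Lemma frame_observable O e f D W (Om : set (plane R)) :
  e.1 * f.2 - e.2 * f.1 != 0 ->
  Om = [set x | exists s t, walls D (s, t) /\ x = O + s *: e + t *: f] ->
  (forall s t, walls D (s, t) -> 0 <= s < 1 /\ 0 <= t < 1) ->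
  uniq W -> idmx \in W ->
  (forall w (s t s' t' : R) (n : int * int), w \in W -> walls D (s, t) -> walls D (s', t') ->
    (wact w (s, t)).1 = s' + n.1%:~R -> (wact w (s, t)).2 = t' + n.2%:~R -> w = idmx) ->
  (forall d, d \in D -> mirror W d) ->
  (forall w (k : int * int), w \in W ->
    (kact w k).1%:~R ^+ 2 * dot f f + (kact w k).2%:~R ^+ 2 * dot e e
      - 2 * ((kact w k).1%:~R * (kact w k).2%:~R) * dot e f =
    k.1%:~R ^+ 2 * dot f f + k.2%:~R ^+ 2 * dot e e - 2 * (k.1%:~R * k.2%:~R) * dot e f) ->
  observable Om.
Proof.
case: O => O1 O2; case: e => a b; case: f => c d /= D0 OmE cell uW idW fund mir gram.
pose q0 := a * d - b * c.
pose p : R * R := (d / q0, - c / q0); pose q : R * R := (- b / q0, a / q0).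
pose o : R * R := (- (p.1 * O1 + p.2 * O2), - (q.1 * O1 + q.2 * O2)).
have q00 : q0 != 0 := D0.
have fd : fdet p q != 0.
  rewrite (_ : fdet p q = q0^-1) ?invr_eq0//.
  by rewrite /fdet /p /q /=; rewrite /q0 in q00 *; field.
pose pull (l : (R * R) * R) : (R * R) * R :=
  ((l.1.1 * p.1 + l.1.2 * q.1, l.1.1 * p.2 + l.1.2 * q.2), l.1.1 * o.1 + l.1.2 * o.2 + l.2).
have pullE l x : aff (pull l) x = aff l (fs p o x, ft q o x).
  by rewrite /aff /pull /fs /ft /=; ring.
pose r := map pull D.
have wE x : walls r x <-> walls D (fs p o x, ft q o x).
  split=> h l lD; first by rewrite -pullE; apply: h; exact: map_f.
  by have /mapP[l' l'D ->] := lD; rewrite pullE; exact: h.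
have xE (s t : R) : (O1, O2) + s *: (a, b) + t *: (c, d) =
    (O1 + s * a + t * c, O2 + s * b + t * d) :> plane R by [].
have OmW : Om = walls r.
  rewrite OmE; apply/seteqP; split => x.
    move=> [s [t [h ->]]]; apply/wE; move: h; congr (walls D _); rewrite xE /fs /ft /o /p /q /=.
    by rewrite /q0 in q00 *; congr pair; field.
  move=> /wE h; exists (fs p o x), (ft q o x); split => //.
  case: x h => x1 x2 _; rewrite /fs /ft /o /p /q /=.
  by rewrite xE; rewrite /q0 in q00 *; congr pair; field.
have cell' x : walls r x -> 0 <= fs p o x < 1 /\ 0 <= ft q o x < 1 by move=> /wE; exact: cell.
pose M := `|O1| + `|O2| + (`|a| + `|b| + `|c| + `|d|).
rewrite OmW; split; first exact: measurable_walls.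
apply: (@domain_bound _ p q o r M W) => //.
- move=> x; rewrite -OmW OmE => -[s [t [/cell[/andP[s0 s1] /andP[t0 t1]] ->]]].
  have key (y u v : R) : `|y + s * u + t * v| <= `|y| + (`|u| + `|v|).
    apply: le_trans (ler_normD _ _) _; rewrite addrA; apply: lerD.
      apply: le_trans (ler_normD _ _) _; rewrite lerD2l normrM ger0_norm//.
      by apply: ler_piMl => //; exact: ltW.
    by rewrite normrM ger0_norm//; apply: ler_piMl => //; exact: ltW.
  by rewrite xE /M; split; apply: le_trans (key _ _ _) _ => /=;
    move: (normr_ge0 O1) (normr_ge0 O2) (normr_ge0 a) (normr_ge0 b) (normr_ge0 c) (normr_ge0 d); lra.
- move=> w x x' n wW /wE h /wE h' e1 e2; exact: (fund w _ _ _ _ n wW h h').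
- move=> _ i /mapP[l lD ->]; case: i => bb k.
  have [C hC] := trig_wall bb k (mir _ lD); exists C => x /wE h.
  by rewrite pullE; apply: le_trans (hC _ (h _ lD)); case: (bb).
- move=> w k wW; rewrite /fQ /fx /fy /p /q /=.
  have := gram w k wW; rewrite /dot /=.
  move: (kact w k).1%:~R (kact w k).2%:~R k.1%:~R k.2%:~R => A B E F h.
  have G (X Y : R) : (X * (d / q0) + Y * (- b / q0)) ^+ 2 + (X * (- c / q0) + Y * (a / q0)) ^+ 2 =
    (X ^+ 2 * (c * c + d * d) + Y ^+ 2 * (a * a + b * b) - 2 * (X * Y) * (a * c + b * d)) / q0 ^+ 2.
    by field.
  by rewrite !G h.
Qed.

End Frames.

(** * The four alcoves and their reflection groups *)

Section Alcoves.
Context {R : realType}.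
Implicit Types (s t : R) (D : seq ((R * R) * R)) (w : intmx).

Lemma walls_cons d D (y : plane R) : walls (d :: D) y <-> 0 < aff d y /\ walls D y.
Proof.
split=> [h|[h h'] l]; last by rewrite inE => /orP[/eqP ->|/h'].
by split=> [|l lD]; apply: h; rewrite inE ?eqxx// lD orbT.
Qed.

Lemma int_cases (n : int) : n%:~R <= -2 :> R \/ n%:~R = -1 :> R \/ n%:~R = 0 :> R \/ 1 <= n%:~R :> R.
Proof.
have [h|h] := lerP n (-2); [left|right; have [->|h1] := eqVneq n (-1); [left|right]].
- by rewrite -[-2]/((-2)%:~R) ler_int.
- by [].
- have [->|h0] := eqVneq n 0; [left|right] => //.
  rewrite -[1]/(1%:~R) ler_int; lia.
Qed.

(** The point groups have orders 4, 8, 6 and 12: sign changes of the coordinates, symmetries of the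
    square, and the Weyl groups of types A2 and G2 in a lattice basis with e.e = f.f = - 2 e.f. *)
Definition Wrect : seq intmx :=
  [:: ((1, 0), (0, 1)); ((-1, 0), (0, 1)); ((1, 0), (0, -1)); ((-1, 0), (0, -1))].
Definition Wsquare : seq intmx := Wrect ++
  [:: ((0, 1), (1, 0)); ((0, -1), (1, 0)); ((0, 1), (-1, 0)); ((0, -1), (-1, 0))].
Definition Whex3 : seq intmx := [:: ((1, 0), (0, 1)); ((-1, 1), (0, 1)); ((1, 0), (1, -1));
  ((0, -1), (1, -1)); ((-1, 1), (-1, 0)); ((0, -1), (-1, 0))].
Definition Whex : seq intmx := Whex3 ++ [:: ((0, 1), (1, 0)); ((1, -1), (0, -1)); ((-1, 0), (-1, 1));
  ((0, 1), (-1, 1)); ((1, -1), (1, 0)); ((-1, 0), (0, -1))].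

(** Inward affine forms of the walls, in coordinates where the translation lattice is Z^2. [Dhemi]
    is the half of [Dequi] on the side t < s of its symmetry axis. *)
Definition Drect : seq ((R * R) * R) :=
  [:: ((1, 0), 0); ((0, 1), 0); ((-1, 0), 1 / 2); ((0, -1), 1 / 2)].
Definition Diso : seq ((R * R) * R) := [:: ((0, 1), 0); ((1, -1), 0); ((-1, 0), 1 / 2)].
Definition Dequi : seq ((R * R) * R) := [:: ((2, -1), 0); ((-1, 2), 0); ((-1, -1), 1)].
Definition Dhemi : seq ((R * R) * R) := [:: ((1, -1), 0); ((-1, 2), 0); ((-1, -1), 1)].

Lemma DrectP s t : walls Drect (s, t) <-> [/\ 0 < s, s < 1 / 2, 0 < t & t < 1 / 2].
Proof.
rewrite /Drect !walls_cons /aff /=.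
split=> [[h1 [h2 [h3 [h4 _]]]]|[h1 h2 h3 h4]]; first by split; lra.
by do 4 (split; first by lra).
Qed.

Lemma DisoP s t : walls Diso (s, t) <-> [/\ 0 < t, t < s & s < 1 / 2].
Proof.
rewrite /Diso !walls_cons /aff /=.
split=> [[h1 [h2 [h3 _]]]|[h1 h2 h3]]; first by split; lra.
by do 3 (split; first by lra).
Qed.

Lemma DequiP s t : walls Dequi (s, t) <-> [/\ t < 2 * s, s < 2 * t & s + t < 1].
Proof.
rewrite /Dequi !walls_cons /aff /=.
split=> [[h1 [h2 [h3 _]]]|[h1 h2 h3]]; first by split; lra.
by do 3 (split; first by lra).
Qed.

Lemma DhemiP s t : walls Dhemi (s, t) <-> [/\ t < s, s < 2 * t & s + t < 1].
Proof.
rewrite /Dhemi !walls_cons /aff /=.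
split=> [[h1 [h2 [h3 _]]]|[h1 h2 h3]]; first by split; lra.
by do 3 (split; first by lra).
Qed.

Ltac each tac := first [case/predU1P => [->|]; [tac|each tac] | move=> /eqP ->; tac].

(* Two points of the alcove cannot be exchanged by a nontrivial [w] up to an integer
   translation, whose components are confined to a few values. *)
Ltac alcove n :=
  let n1 := fresh "n1" in let n2 := fresh "n2" in let x := fresh "x" in let y := fresh "y" in
  let h1 := fresh "h1" in let h2 := fresh "h2" in
  move: n => [n1 n2]; rewrite /wact /= ?(mulr0z, mulr1z, mulrN1z);
  move: (int_cases n1) (int_cases n2); move: (n1%:~R : R) (n2%:~R : R) => x y h1 h2 ? ?; exfalso;
  case: h1 => [?|[?|[?|?]]]; try lra; case: h2 => [?|[?|[?|?]]]; lra.

Lemma fund_rect w s t s' t' (n : int * int) : w \in Wrect ->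
  walls Drect (s, t) -> walls Drect (s', t') ->
  (wact w (s, t)).1 = s' + n.1%:~R -> (wact w (s, t)).2 = t' + n.2%:~R -> w = idmx.
Proof.
move=> wW /DrectP[? ? ? ?] /DrectP[? ? ? ?].
by move: wW; rewrite !inE; each ltac:(first [by move=> _ _|alcove n]).
Qed.

Lemma fund_square w s t s' t' (n : int * int) : w \in Wsquare ->
  walls Diso (s, t) -> walls Diso (s', t') ->
  (wact w (s, t)).1 = s' + n.1%:~R -> (wact w (s, t)).2 = t' + n.2%:~R -> w = idmx.
Proof.
move=> wW /DisoP[? ? ?] /DisoP[? ? ?].
by move: wW; rewrite !inE; each ltac:(first [by move=> _ _|alcove n]).
Qed.

Lemma fund_hex3 w s t s' t' (n : int * int) : w \in Whex3 ->
  walls Dequi (s, t) -> walls Dequi (s', t') ->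
  (wact w (s, t)).1 = s' + n.1%:~R -> (wact w (s, t)).2 = t' + n.2%:~R -> w = idmx.
Proof.
move=> wW /DequiP[? ? ?] /DequiP[? ? ?].
by move: wW; rewrite !inE; each ltac:(first [by move=> _ _|alcove n]).
Qed.

Lemma fund_hex w s t s' t' (n : int * int) : w \in Whex ->
  walls Dhemi (s, t) -> walls Dhemi (s', t') ->
  (wact w (s, t)).1 = s' + n.1%:~R -> (wact w (s, t)).2 = t' + n.2%:~R -> w = idmx.
Proof.
move=> wW /DhemiP[? ? ?] /DhemiP[? ? ?].
by move: wW; rewrite !inE; each ltac:(first [by move=> _ _|alcove n]).
Qed.

Lemma mirror_intro W d rho n v : perm_eq [seq wmul w rho | w <- W] W -> wdet rho = -1 ->
  (forall y, (wact rho y).1 + n.1%:~R = y.1 + aff d y * v.1 /\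
             (wact rho y).2 + n.2%:~R = y.2 + aff d y * v.2) -> @mirror R W d.
Proof. by move=> *; exists rho, n, v. Qed.

Ltac mirror_at rho n v :=
  apply: (@mirror_intro _ _ rho n v) => // y; rewrite /wact /aff /= ?(mulr0z, mulr1z, mulrN1z);
  split; lra.

Lemma mirror_rect d : d \in Drect -> mirror Wrect d.
Proof.
rewrite !inE; move=> /or4P[]/eqP ->.
- mirror_at (((-1, 0), (0, 1)) : intmx) ((0, 0) : int * int) ((-2, 0) : R * R).
- mirror_at (((1, 0), (0, -1)) : intmx) ((0, 0) : int * int) ((0, -2) : R * R).
- mirror_at (((-1, 0), (0, 1)) : intmx) ((1, 0) : int * int) ((2, 0) : R * R).
- mirror_at (((1, 0), (0, -1)) : intmx) ((0, 1) : int * int) ((0, 2) : R * R).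
Qed.

Lemma mirror_square d : d \in Diso -> mirror Wsquare d.
Proof.
rewrite !inE; move=> /or3P[]/eqP ->.
- mirror_at (((1, 0), (0, -1)) : intmx) ((0, 0) : int * int) ((0, -2) : R * R).
- mirror_at (((0, 1), (1, 0)) : intmx) ((0, 0) : int * int) ((-1, 1) : R * R).
- mirror_at (((-1, 0), (0, 1)) : intmx) ((1, 0) : int * int) ((2, 0) : R * R).
Qed.

Lemma mirror_hex3 d : d \in Dequi -> mirror Whex3 d.
Proof.
rewrite !inE; move=> /or3P[]/eqP ->.
- mirror_at (((-1, 1), (0, 1)) : intmx) ((0, 0) : int * int) ((-1, 0) : R * R).
- mirror_at (((1, 0), (1, -1)) : intmx) ((0, 0) : int * int) ((0, -1) : R * R).
- mirror_at (((0, -1), (-1, 0)) : intmx) ((1, 1) : int * int) ((1, 1) : R * R).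
Qed.

Lemma mirror_hex d : d \in Dhemi -> mirror Whex d.
Proof.
rewrite !inE; move=> /or3P[]/eqP ->.
- mirror_at (((0, 1), (1, 0)) : intmx) ((0, 0) : int * int) ((-1, 1) : R * R).
- mirror_at (((1, 0), (1, -1)) : intmx) ((0, 0) : int * int) ((0, -1) : R * R).
- mirror_at (((0, -1), (-1, 0)) : intmx) ((1, 1) : int * int) ((1, 1) : R * R).
Qed.

Ltac gram_case := rewrite /kact /= ?intrD ?intrM ?(mulr0z, mulr1z, mulrN1z); lra.

Lemma gram_rect w (k : int * int) (a b : R) : w \in Wrect ->
  (kact w k).1%:~R ^+ 2 * a + (kact w k).2%:~R ^+ 2 * b = k.1%:~R ^+ 2 * a + k.2%:~R ^+ 2 * b.
Proof.
by rewrite !inE; each gram_case.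
Qed.

Lemma gram_square w (k : int * int) (a : R) : w \in Wsquare ->
  (kact w k).1%:~R ^+ 2 * a + (kact w k).2%:~R ^+ 2 * a = k.1%:~R ^+ 2 * a + k.2%:~R ^+ 2 * a.
Proof.
by rewrite !inE; each gram_case.
Qed.

Lemma gram_hex w (k : int * int) (a : R) : w \in Whex ->
  (kact w k).1%:~R ^+ 2 * (- 2 * a) + (kact w k).2%:~R ^+ 2 * (- 2 * a)
    - 2 * ((kact w k).1%:~R * (kact w k).2%:~R) * a =
  k.1%:~R ^+ 2 * (- 2 * a) + k.2%:~R ^+ 2 * (- 2 * a) - 2 * (k.1%:~R * k.2%:~R) * a.
Proof.
by rewrite !inE; each gram_case.
Qed.

End Alcoves.

(** * Fitting each shape to its alcove *)

Section Shapes.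
Context {R : realType}.
Implicit Types (A B C p q : plane R) (Om : set (plane R)).

Lemma scale_plane (c a b : R) : c *: ((a, b) : plane R) = (c * a, c * b).
Proof. by []. Qed.

Lemma euclid_sq p : euclid p ^+ 2 = dot p p.
Proof. by rewrite sqr_sqrtr// addr_ge0// -expr2 sqr_ge0. Qed.

Lemma euclid_gt0 p : p != 0 -> 0 < euclid p.
Proof.
case: p => a b p0; rewrite sqrtr_gt0 /dot /= -!expr2 lt_neqAle addr_ge0 ?sqr_ge0// andbT.
rewrite eq_sym paddr_eq0 ?sqr_ge0// !sqrf_eq0; apply/negP => /andP[/eqP a0 /eqP b0].
by move: p0; rewrite a0 b0 => /eqP; apply.
Qed.

Lemma cauchy_schwarz p q : dot p q ^+ 2 <= (euclid p * euclid q) ^+ 2.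
Proof.
rewrite exprMn !euclid_sq; case: p => a b; case: q => c d; rewrite /dot /=.
rewrite -subr_ge0 (_ : _ - _ = (a * d - b * c) ^+ 2) ?sqr_ge0//; ring.
Qed.

Lemma cos_angle A B C : B != A -> C != A ->
  dot (B - A) (C - A) = cos (angle A B C) * (euclid (B - A) * euclid (C - A)).
Proof.
move=> BA CA; have N0 : 0 < euclid (B - A) * euclid (C - A).
  by rewrite mulr_gt0// euclid_gt0// subr_eq0.
rewrite /angle acosK ?divfK ?gt_eqF//.
have : (dot (B - A) (C - A) / (euclid (B - A) * euclid (C - A))) ^+ 2 <= 1.
  by rewrite expr_div_n ler_pdivrMr ?exprn_gt0// mul1r; exact: cauchy_schwarz.
by rewrite in_itv /=; move: (_ / _) => y y1; apply/andP; split; nra.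
Qed.

Lemma right_angle A B C : B != A -> C != A -> angle A B C = pi / 2 -> dot (B - A) (C - A) = 0.
Proof. by move=> BA CA h; rewrite cos_angle// h cos_pihalf mul0r. Qed.

(** The triple angle formula reads (c + 1) (2 c - 1)^2 = 0 for the cosine c of pi / 3, which is
    positive. *)
Lemma cos_pi3 : cos (pi / 3) = 1 / 2 :> R.
Proof.
have pi0 := pi_gt0 R.
have c0 : 0 < cos (pi / 3 : R) by apply: cos_gt0_pihalf; lra.
have h : cos (pi / 3 + (pi / 3 + pi / 3)) = -1 :> R by rewrite -cospi; congr cos; lra.
move: h c0; rewrite !cosD sinD.
have := cos2Dsin2 (pi / 3 : R); move: (cos _) (sin _) => c s e h c0.
have : (c + 1) * (2 * c - 1) ^+ 2 = 0 by nra.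
by move=> /eqP; rewrite mulf_eq0 sqrf_eq0 => /orP[] /eqP; lra.
Qed.

Lemma triangle_neq A B C Om : triangle A B C Om -> [/\ B != A, C != A & C != B].
Proof.
move=> [d0 _]; split; apply: contraNneq d0 => ->; first by rewrite subrr /= !mul0r subrr.
  by rewrite subrr /= !mulr0 subrr.
by rewrite mulrC subrr.
Qed.

Lemma rectangle_observable Om : rectangle Om -> observable Om.
Proof.
move=> [A [p [q [p0 q0 pq OmE]]]].
(* The alcove is the quarter (0, 1/2)^2 of the unit cell, hence the doubled sides. *)
apply: (@frame_observable _ A (2 *: p) (2 *: q) Drect Wrect).
- have := mulr_gt0 (euclid_gt0 p0) (euclid_gt0 q0); have := euclid_sq p; have := euclid_sq q.
  move: pq; rewrite {p0 q0 OmE}; case: p => a b; case: q => c d; rewrite /dot /=.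
  move: (euclid _) (euclid _) => P Q h hQ hP h0.
  rewrite /GRing.scale /=; apply/eqP => z.
  have : (P * Q) ^+ 2 = (a * d - b * c) ^+ 2 + (a * c + b * d) ^+ 2 by rewrite exprMn hP hQ; ring.
  have -> : a * d - b * c = 0 by lra.
  rewrite h expr0n addr0 => /eqP; rewrite sqrf_eq0 => /eqP; lra.
- rewrite OmE; apply/seteqP; split => x [s [t]].
    move=> [/andP[s0 s1] /andP[t0 t1] ->]; exists (s / 2), (t / 2); split.
      by apply/DrectP; split; lra.
    by rewrite !scalerA !divfK.
  move=> [/DrectP[s0 s1 t0 t1] ->]; exists (s * 2), (t * 2); split; [lra|lra|].
  by rewrite !scalerA.
- by move=> s t /DrectP[? ? ? ?]; split; lra.
- by [].
- by rewrite mem_head.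
- exact: fund_rect.
- exact: mirror_rect.
- move=> w k wW; have e0 : dot (2 *: p) (2 *: q) = 0.
    by move: pq; case: (p) => a b; case: (q) => c d; rewrite !scale_plane /dot /=; lra.
  by rewrite e0 !mulr0 !subr0; exact: gram_rect.
Qed.

Lemma isosceles_observable Om : isosceles_right_triangle Om -> observable Om.
Proof.
move=> [A [B [C [tr ang len]]]]; have [BA CA CB] := triangle_neq tr.
have d0 := right_angle BA CA ang; have l0 : dot (B - A) (B - A) = dot (C - A) (C - A).
  by rewrite -!euclid_sq len.
have [D0 OmE] := tr; rewrite {tr ang len BA CA CB}.
case: A D0 OmE d0 l0 => A1 A2; case: B => B1 B2; case: C => C1 C2 /= D0 OmE; rewrite /dot /= => d0 l0.
(* The frame gives B, A and C the coordinates (0, 0), (1/2, 0) and (1/2, 1/2). *)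
apply: (@frame_observable _ (B1, B2) (2 * (A1 - B1), 2 * (A2 - B2)) (2 * (C1 - A1), 2 * (C2 - A2))
  Diso Wsquare).
- by apply: contraNneq D0 => /= z; apply/eqP; lra.
- rewrite OmE; apply/seteqP; split => x.
    move=> [a [b [c [a0 b0 c0 abc ->]]]]; exists ((a + c) / 2), (c / 2); split.
      by apply/DisoP; split; lra.
    have -> : b = 1 - a - c by lra.
    by rewrite !scale_plane; congr pair => /=; field.
  move=> [s [t [/DisoP[h1 h2 h3] ->]]]; exists (2 * s - 2 * t), (1 - 2 * s), (2 * t).
  split; [lra|lra|lra|ring|].
  by rewrite !scale_plane; congr pair => /=; ring.
- by move=> s t /DisoP[? ? ?]; split; lra.
- by [].
- by rewrite mem_head.
- exact: fund_square.
- exact: mirror_square.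
- move=> w k wW; set e := (2 * (A1 - B1), _); set f := (2 * (C1 - A1), _).
  have -> : dot e f = 0 by rewrite /dot /e /f /=; lra.
  have -> : dot e e = dot f f by rewrite /dot /e /f /=; lra.
  by rewrite !mulr0 !subr0; exact: gram_square.
Qed.

Lemma equilateral_observable Om : equilateral_triangle Om -> observable Om.
Proof.
move=> [A [B [C [[D0 OmE] l1 l2]]]].
have h1 : dot (B - A) (B - A) = dot (C - B) (C - B) by rewrite -!euclid_sq l1.
have h2 : dot (C - B) (C - B) = dot (A - C) (A - C) by rewrite -!euclid_sq l2.
rewrite {l1 l2}; case: A D0 OmE h1 h2 => A1 A2; case: B => B1 B2; case: C => C1 C2 /= D0 OmE.
rewrite /dot /= => h1 h2.
(* The frame gives A, B and C the coordinates (0, 0), (2/3, 1/3) and (1/3, 2/3). *)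
apply: (@frame_observable _ (A1, A2)
  (2 * (B1 - A1) - (C1 - A1), 2 * (B2 - A2) - (C2 - A2))
  (2 * (C1 - A1) - (B1 - A1), 2 * (C2 - A2) - (B2 - A2)) Dequi Whex3).
- by apply: contraNneq D0 => /= z; apply/eqP; lra.
- rewrite OmE; apply/seteqP; split => x.
    move=> [a [b [c [a0 b0 c0 abc ->]]]]; exists ((2 * b + c) / 3), ((b + 2 * c) / 3); split.
      by apply/DequiP; split; lra.
    have -> : a = 1 - b - c by lra.
    by rewrite !scale_plane; congr pair => /=; field.
  move=> [s [t [/DequiP[k1 k2 k3] ->]]]; exists (1 - s - t), (2 * s - t), (2 * t - s).
  split; [lra|lra|lra|ring|].
  by rewrite !scale_plane; congr pair => /=; ring.
- by move=> s t /DequiP[? ? ?]; split; lra.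
- by [].
- by rewrite mem_head.
- exact: fund_hex3.
- exact: mirror_hex3.
- move=> w k wW; set e := (2 * (B1 - A1) - _, _); set f := (2 * (C1 - A1) - _, _).
  have -> : dot e e = - 2 * dot e f by rewrite /dot /e /f /=; lra.
  have -> : dot f f = - 2 * dot e f by rewrite /dot /e /f /=; lra.
  by apply: gram_hex; rewrite mem_cat wW.
Qed.

Lemma hemi_equilateral_observable Om : hemi_equilateral_triangle Om -> observable Om.
Proof.
move=> [A [B [C [tr angA angB _]]]]; have [BA CA CB] := triangle_neq tr.
have d0 := right_angle BA CA angA; have [D0 OmE] := tr.
(* The angle pi / 3 at B makes the hypotenuse BC twice the leg AB. *)
have l0 : dot (C - B) (C - B) = 4 * dot (B - A) (B - A).
  have AB : A != B by rewrite eq_sym.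
  have e0 : 0 < euclid (A - B) by rewrite euclid_gt0// subr_eq0.
  have := cos_angle CB AB; rewrite angB cos_pi3.
  have -> : dot (C - B) (A - B) = euclid (A - B) ^+ 2.
    by rewrite euclid_sq; move: d0; rewrite /dot /=; lra.
  move=> h; have -> : dot (B - A) (B - A) = dot (A - B) (A - B) by rewrite /dot /=; ring.
  rewrite -!euclid_sq; have -> : euclid (C - B) = 2 * euclid (A - B).
    by apply: (mulIf (lt0r_neq0 e0)); lra.
  by ring.
rewrite {tr angA angB BA CA CB}.
case: A D0 OmE d0 l0 => A1 A2; case: B => B1 B2; case: C => C1 C2 /= D0 OmE; rewrite /dot /= => d0 l0.
(* The vertex C, with the angle pi / 6, is the origin; A and B get the coordinates (1/2, 1/2) and
   (2/3, 1/3), and solving for the frame vectors gives these combinations. *)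
apply: (@frame_observable _ (C1, C2)
  (3 * (B1 - C1) - 2 * (A1 - C1), 3 * (B2 - C2) - 2 * (A2 - C2))
  (4 * (A1 - C1) - 3 * (B1 - C1), 4 * (A2 - C2) - 3 * (B2 - C2)) Dhemi Whex).
- by apply: contraNneq D0 => /= z; apply/eqP; lra.
- rewrite OmE; apply/seteqP; split => x.
    move=> [a [b [c [a0 b0 c0 abc ->]]]]; exists (a / 2 + 2 * b / 3), (a / 2 + b / 3); split.
      by apply/DhemiP; split; lra.
    have -> : c = 1 - a - b by lra.
    by rewrite !scale_plane; congr pair => /=; field.
  move=> [s [t [/DhemiP[k1 k2 k3] ->]]]; exists (2 * (2 * t - s)), (3 * (s - t)), (1 - s - t).
  split; [lra|lra|lra|ring|].
  by rewrite !scale_plane; congr pair => /=; ring.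
- by move=> s t /DhemiP[? ? ?]; split; lra.
- by [].
- by rewrite mem_head.
- exact: fund_hex.
- exact: mirror_hex.
- move=> w k wW; set e := (3 * (B1 - C1) - _, _); set f := (4 * (A1 - C1) - _, _).
  have -> : dot e e = - 2 * dot e f by rewrite /dot /e /f /=; lra.
  have -> : dot f f = - 2 * dot e f by rewrite /dot /e /f /=; lra.
  exact: gram_hex.
Qed.

End Shapes.

Theorem theorem5p2 (R : realType) (Om V : set (plane R))
    (hOm : rectangle Om \/ isosceles_right_triangle Om \/
           equilateral_triangle Om \/ hemi_equilateral_triangle Om)
    (hVOm : V `<=` Om) (mV : lebesgue_measurable2 V) (V_gt0 : (0 < area V)%E) :
  (exists2 c : R, 0 < c &
     forall (lambda : R[i]%C) (u : plane R -> R[i]%C),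
       spectrum Om lambda -> dirichlet_eigenspace Om lambda u ->
       c * L2norm Om u <= L2norm V u) /\
  (0 < C2 V Om)%E.
Proof.
apply: observable_lower => //; case: hOm => [|[|[|]]].
- exact: rectangle_observable.
- exact: isosceles_observable.
- exact: equilateral_observable.
- exact: hemi_equilateral_observable.
Qed.
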